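(* Let $2\le r\le m\le n$ and $k\ge 1$. Let $Z_0\subseteq\mathcal Z^{m,n}_{r,k}$ be the union of the zero sets of those prime ideals of $S$ minimal over $\mathcal I^{m,n}_{r,k}$ that do not contain $x^{(0)}_{i,j}$ for some $(i,j)$, and let $Z_1\subseteq\mathcal Z^{m,n}_{r,k}$ be the subvariety where all $x^{(0)}_{i,j}$ ($1\le i\le m$, $1\le j\le n$) vanish. For each $(i,j)$ let $U_{i,j}$ be the open subset of $\mathcal Z^{m,n}_{r,k}$ where $x^{(0)}_{i,j}\ne0$, and let $U$ be the open subset where all $x^{(0)}_{i,j}\neq 0$. Then: (1) $\mathcal Z^{m,n}_{r,k}=Z_0\cup Z_1$. (2) $Z_0$ is nonempty and equals the Zariski closure of $U_{i,j}$ for every $(i,j)$, and also equals the closure of $U$. (3) The irreducible components of $Z_0$ are irreducible components of $\mathcal Z^{m,n}_{r,k}$ and are in bijection with the irreducible components of $\mathcal Z^{m-1,n-1}_{r-1,k}$, the bijection preserving codimension (in $\mathbf A^{mnk}$ and $\mathbf A^{(m-1)(n-1)k}$ respectively). (4) $Z_0$ is birational to $\mathcal Z^{m-1,n-1}_{r-1,k}\times\mathbf A^{(m+n-1)k}$. (5) $Z_1\cong\mathcal Z^{m,n}_{r,k-r}\times\mathbf A^{mn(r-1)}$ if $k>r$ and $Z_1\cong\mathbf A^{mn(k-1)}$ if $k\le r$. (6) $Z_1\subseteq Z_0$ if and only if no prime ideal minimal over $\mathcal I^{m,n}_{r,k}$ contains some $x^{(0)}_{i,j}$; the zero sets of the minimal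 primes containing some (equivalently all) $x^{(0)}_{i,j}$ are irreducible components of both $Z_1$ and $\mathcal Z^{m,n}_{r,k}$.
   Context: Let $F$ be an algebraically closed field. For integers $1\le r\le m\le n$ and $k\ge 1$, let $S=F[x^{(l)}_{i,j}:1\le i\le m,\ 1\le j\le n,\ 0\le l\le k-1]$, the coordinate ring of $\mathbf A^{mnk}_F$, and let $X(t)$ be the $m\times n$ matrix over $S[t]/(t^k)$ with $(i,j)$ entry $x_{i,j}(t)=\sum_{l=0}^{k-1}x^{(l)}_{i,j}t^l$. Every element of $S[t]/(t^k)$ is uniquely $\sum_{l=0}^{k-1}c_lt^l$ with $c_l\in S$ (its coefficient of $t^l$). $\mathcal I^{m,n}_{r,k}\subseteq S$ is the ideal generated by the coefficients of $t^l$, $0\le l\le k-1$, of all $r\times r$ minors of $X(t)$, and $\mathcal Z^{m,n}_{r,k}\subseteq\mathbf A^{mnk}_F$ is its zero set (with the same definition for other values of the indices, e.g. $\mathcal Z^{m-1,n-1}_{r-1,k}\subseteq\mathbf A^{(m-1)(n-1)k}$). *)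

(* Defs.v *)
From HB Require Import structures.
From mathcomp Require Import all_boot all_order all_algebra.
From mathcomp Require Import mpoly.
Unset Printing Implicit Defensive.
Import GRing.Theory.
Local Open Scope ring_scope.

Section Geometry.
Context {F : closedFieldType}.

Definition pt (N : nat) := 'I_N -> F.

Definition sincl {N} (A B : pt N -> Prop) := forall x, A x -> B x.
Definition seqv {N} (A B : pt N -> Prop) := forall x, A x <-> B x.

Definition Zset {N} (T : {mpoly F[N]} -> Prop) : pt N -> Prop :=
  fun x => forall p, T p -> p.@[x] = 0.

Definition zclosed {N} (A : pt N -> Prop) :=
  exists T : {mpoly F[N]} -> Prop, seqv A (Zset T).
Definition zclosure {N} (A : pt N -> Prop) : pt N -> Prop :=
  fun x => forall C, zclosed C -> sincl A C -> C x.
Definition open_in {N} (Z V : pt N -> Prop) :=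
  exists O, zclosed O /\ seqv V (fun x => Z x /\ ~ O x).
Definition dense_open_in {N} (Z V : pt N -> Prop) :=
  open_in Z V /\ seqv (zclosure V) Z.

Definition irreducible {N} (A : pt N -> Prop) :=
  (exists x, A x) /\
  forall C1 C2, zclosed C1 -> zclosed C2 ->
    sincl A (fun x => C1 x \/ C2 x) -> sincl A C1 \/ sincl A C2.
Definition irr_comp {N} (A C : pt N -> Prop) :=
  zclosed C /\ irreducible C /\ sincl C A /\
  forall D, zclosed D -> irreducible D -> sincl C D -> sincl D A ->
    sincl D C.

Definition has_chain {N} (A : pt N -> Prop) (d : nat) :=
  exists C : nat -> pt N -> Prop,
    (forall i, (i <= d)%N -> zclosed (C i) /\ irreducible (C i) /\ sincl (C i) A) /\
    (forall i, (i < d)%N -> sincl (C i) (C i.+1) /\ ~ sincl (C i.+1) (C i)).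
Definition dimP {N} (A : pt N -> Prop) (d : nat) :=
  has_chain A d /\ ~ has_chain A d.+1.

Definition regular_on {N M} (V : pt N -> Prop) (f : pt N -> pt M) :=
  forall p, V p -> exists (g : 'I_M -> {mpoly F[N]}) (h : {mpoly F[N]}),
    h.@[p] != 0 /\
    forall q, V q -> h.@[q] != 0 -> forall i, f q i = (g i).@[q] / h.@[q].
Definition var_iso {N M} (V : pt N -> Prop) (W : pt M -> Prop) :=
  exists (f : pt N -> pt M) (g : pt M -> pt N),
    regular_on V f /\ regular_on W g /\
    (forall x, V x -> W (f x)) /\ (forall y, W y -> V (g y)) /\
    (forall x, V x -> g (f x) = x) /\ (forall y, W y -> f (g y) = y).
Definition birational {N M} (X : pt N -> Prop) (Y : pt M -> Prop) :=
  exists V W, dense_open_in X V /\ dense_open_in Y W /\ var_iso V W.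

Definition prodset {N M} (A : pt N -> Prop) (B : pt M -> Prop) : pt (N + M) -> Prop :=
  fun x => A (fun i => x (lshift M i)) /\ B (fun j => x (rshift N j)).
Definition affsp (N : nat) : pt N -> Prop := fun _ => True.

Definition ideal_gen {N} (G : {mpoly F[N]} -> Prop) : {mpoly F[N]} -> Prop :=
  fun p => exists (s : nat) (c g : 'I_s -> {mpoly F[N]}),
    (forall i, G (g i)) /\ p = \sum_(i < s) c i * g i.
Definition is_ideal {N} (P : {mpoly F[N]} -> Prop) :=
  P 0 /\ (forall a b, P a -> P b -> P (a + b)) /\ (forall a b, P b -> P (a * b)).
Definition prime_ideal {N} (P : {mpoly F[N]} -> Prop) :=
  is_ideal P /\ ~ P 1 /\ forall a b, P (a * b) -> P a \/ P b.
Definition minprime_over {N} (I P : {mpoly F[N]} -> Prop) :=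
  prime_ideal P /\ (forall p, I p -> P p) /\
  forall Q, prime_ideal Q -> (forall p, I p -> Q p) -> (forall p, Q p -> P p) ->
    forall p, P p -> Q p.

Definition idx {m n k} (i : 'I_m) (j : 'I_n) (l : 'I_k) : 'I_(m * n * k) :=
  mxvec_index (mxvec_index i j) l.
Definition xvar {m n k} (i : 'I_m) (j : 'I_n) (l : 'I_k) : {mpoly F[m * n * k]} :=
  'X_(idx i j l).
(* x^{(0)}_{i,j} (for k >= 1; it is 0 when k = 0) *)
Definition x0var {m n k} (i : 'I_m) (j : 'I_n) : {mpoly F[m * n * k]} :=
  \sum_(l < k | nat_of_ord l == 0%N) xvar i j l.
(* X(t), viewed as a matrix of polynomials in t (truncation mod t^k is
   taken care of by only using the coefficients of t^l, l < k) *)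
Definition Xt (m n k : nat) : 'M[{poly {mpoly F[m * n * k]}}]_(m, n) :=
  \matrix_(i, j) \sum_(l < k) (xvar i j l)%:P * 'X^l.
Definition minor_gen (m n r k : nat) : {mpoly F[m * n * k]} -> Prop :=
  fun p => exists (f : 'I_r -> 'I_m) (g : 'I_r -> 'I_n) (l : 'I_k),
    (forall a b : 'I_r, (a < b)%N -> (f a < f b)%N) /\
    (forall a b : 'I_r, (a < b)%N -> (g a < g b)%N) /\
    p = (\det (\matrix_(a, b) Xt m n k (f a) (g b)))`_l.
Definition Iideal (m n r k : nat) := ideal_gen (minor_gen m n r k).
Definition Zvar (m n r k : nat) : pt (m * n * k) -> Prop := Zset (Iideal m n r k).

Definition Z0 (m n r k : nat) : pt (m * n * k) -> Prop :=
  fun x => exists P, minprime_over (Iideal m n r k) P /\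
    (exists (i : 'I_m) (j : 'I_n), ~ P (x0var i j)) /\ Zset P x.
Definition Z1 (m n r k : nat) : pt (m * n * k) -> Prop :=
  fun x => Zvar m n r k x /\ forall (i : 'I_m) (j : 'I_n), (x0var i j).@[x] = 0.
Definition Uij (m n r k : nat) (i : 'I_m) (j : 'I_n) : pt (m * n * k) -> Prop :=
  fun x => Zvar m n r k x /\ (x0var i j).@[x] != 0.
Definition Uall (m n r k : nat) : pt (m * n * k) -> Prop :=
  fun x => Zvar m n r k x /\ forall (i : 'I_m) (j : 'I_n), (x0var i j).@[x] != 0.

End Geometry.

(* Main.v *)
Require Import Defs.
From HB Require Import structures.
From mathcomp Require Import all_boot all_order all_algebra.
From mathcomp Require Import generic_quotient ring_quotient.
From mathcomp Require Import mpoly ring zify.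
From Stdlib Require Import Classical ClassicalEpsilon FunctionalExtensionality.
Set Implicit Arguments.
Unset Strict Implicit.
Unset Printing Implicit Defensive.
Import Order.TTheory GRing.Theory.
Local Open Scope ring_scope.

(** A prime ideal is the kernel of evaluation at a generic point with coordinates in a field, so dimensions are
    transcendence degrees of generic points, and specializing one coordinate at a time gives both the
    Nullstellensatz and the lifting of points through generically finite projections.

    For the theorem, write a matrix [X] whose corner entry is a unit modulo [t^k] as
    [X = (1; v) w + (0 0; 0 Y)], where [w] is its first row and [Y] its Schur complement.  The
    [r.+1]-minors of [X] vanish modulo [t^k] iff the [r]-minors of [Y] do, and [(Y, w, v) |-> X] is polynomial
    even where the corner vanishes.  Hence the components of the determinantal jet variety meeting the locus where
    the corner has nonzero constant term are the closures of the images of the components of the smaller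
    variety times an affine space.  Elementary row and column operations form connected one-parameter families, so
    they preserve each component: a component on which one [x^(0)_ij] vanishes lies in [Z1].  On [Z1] one
    has [X = t X'], and the minors acquire a factor [t^r]. *)

(** The definitions mix ideals with bare sets of points. The bridge is the Nullstellensatz for
    primes: a prime is the vanishing ideal of its zero set, so minimal primes and maximal
    irreducible closed subsets correspond, and the geometry can be done on points. The inverse of
    the parametrization divides by the corner entry, so it exists only where the constant term of
    the corner is nonzero. Components are therefore transported by closures of images, and
    maximality is tested on the dense open part where both directions are defined. The row [w] has n
    entries and the column [v] has m-1 entries below its leading 1, which gives (m+n-1)k frame
    coordinates. The identity mn = (m-1)(n-1) + (m+n-1) is what preserves codimension. A
    one-parameter family of operations preserves a component [C] because the image of C x A^1 is
    irreducible and contains [C] at parameter 0. On [Z1] division by t leaves k-1 coefficients per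
    entry. The factor t^r turns the condition modulo t^k into one modulo t^(k-r), so k-r of these
    coefficients are constrained and r-1 are free. *)

Definition asbool (P : Prop) : bool := if excluded_middle_informative P then true else false.

Lemma asboolP (P : Prop) : reflect P (asbool P).
Proof. by rewrite /asbool; case: excluded_middle_informative => h; constructor. Qed.

(** * Prime ideals as kernels of morphisms to fields *)

Section PrimeField.
Context {R : comNzRingType} (P : R -> Prop).
Context (P0 : P 0) (PD : forall a b, P a -> P b -> P (a + b)).
Context (PM : forall a b, P b -> P (a * b)).
Context (P1 : ~ P 1) (Pprime : forall a b, P (a * b) -> P a \/ P b).

Definition prime_pred : {pred R} := fun a => asbool (P a).

Lemma prime_predE a : (a \in prime_pred) = asbool (P a).
Proof. by []. Qed.

Lemma prime_pred_idealr : idealr_closed prime_pred.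
Proof.
split.
- by rewrite prime_predE; apply/asboolP.
- by rewrite prime_predE; apply/asboolP.
- move=> a u v; rewrite !prime_predE => /asboolP hu /asboolP hv.
  by apply/asboolP/PD => //; apply: PM.
Qed.

Lemma prime_pred_prime : prime_idealr_closed prime_pred.
Proof.
move=> u v; rewrite !prime_predE => /asboolP /Pprime [] h; apply/orP; [left|right]; exact/asboolP.
Qed.

HB.instance Definition _ := isIdealr.Build R prime_pred prime_pred_idealr.
HB.instance Definition _ := isPrimeIdealrClosed.Build R prime_pred prime_pred_prime.

Definition prime_quot := {ideal_quot (prime_pred : prime_idealr R)}.
HB.instance Definition _ := GRing.ComNzRing.on prime_quot.

(** The fraction field construction expects an integral domain with a unit predicate and an inverse;
    both are supplied by classical choice. *)
Definition pq_unit : pred prime_quot := fun x => asbool (exists y, y * x = 1).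
Definition pq_inv (x : prime_quot) : prime_quot :=
  if excluded_middle_informative (exists y, y * x = 1) is left e
  then proj1_sig (constructive_indefinite_description _ e) else x.

Lemma pq_mulVx : {in pq_unit, left_inverse 1 pq_inv *%R}.
Proof.
move=> x /asboolP ex; rewrite /pq_inv; case: excluded_middle_informative => // e.
by case: constructive_indefinite_description.
Qed.

Lemma pq_unitPl (x y : prime_quot) : y * x = 1 -> pq_unit x.
Proof. by move=> h; apply/asboolP; exists y. Qed.

Lemma pq_inv_out : {in [predC pq_unit], pq_inv =1 id}.
Proof.
move=> x; rewrite inE /= => /asboolP nx.
by rewrite /pq_inv; case: excluded_middle_informative => // e; case: nx.
Qed.

HB.instance Definition _ :=
  GRing.ComNzRing_hasMulInverse.Build prime_quot pq_mulVx pq_unitPl pq_inv_out.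

Lemma pq_domain : GRing.integral_domain_axiom prime_quot.
Proof. exact: Quotient.rquot_IdomainAxiom. Qed.

HB.instance Definition _ :=
  GRing.ComUnitRing_isIntegral.Build prime_quot pq_domain.

Lemma prime_kernel_field :
  exists (K : fieldType) (phi : {rmorphism R -> K}), forall a, phi a = 0 <-> P a.
Proof.
exists {fraction prime_quot}.
pose pi0 : {rmorphism R -> prime_quot} := \pi_({ideal_quot (prime_pred : prime_idealr R)})%qT.
exists (GRing.RMorphism.clone _ _ (@tofrac prime_quot \o pi0) _) => a /=.
have -> : (tofrac (pi0 a) = 0) <-> (pi0 a = 0).
  by split=> [/eqP|->]; rewrite ?tofrac_eq0 ?tofrac0 // => /eqP.
have -> : (0 : prime_quot) = pi0 0 by rewrite rmorph0.
rewrite /pi0 /=; split.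
  by move=> /eqP; rewrite -Quotient.idealrBE subr0 prime_predE => /asboolP.
by move=> Pa; apply/eqP; rewrite -Quotient.idealrBE subr0 prime_predE; apply/asboolP.
Qed.
End PrimeField.

Lemma prop_min (Q : nat -> Prop) :
  (exists n, Q n) -> exists n, Q n /\ forall m, Q m -> (n <= m)%N.
Proof.
move=> [n Qn].
have ex : exists n, asbool (Q n) by exists n; apply/asboolP.
exists (ex_minn ex); case: ex_minnP => k /asboolP Qk kmin; split=> // j Qj.
by apply: kmin; apply/asboolP.
Qed.

Lemma prop_argmin (T : Type) (Q : T -> Prop) (f : T -> nat) :
  (exists x, Q x) -> exists x, Q x /\ forall y, Q y -> (f x <= f y)%N.
Proof.
move=> [x Qx].
have [|n [[y [Qy <-]] nmin]] := @prop_min (fun n => exists x, Q x /\ f x = n).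
  by exists (f x), x.
by exists y; split=> // z Qz; apply: nmin; exists z.
Qed.

(** * Extending a specialization to one more coordinate *)

Section Specialization.
Context {F : closedFieldType} {R : comNzRingType} {K : fieldType}.
Context (phi : {rmorphism R -> K}).
Local Notation ph := (map_poly phi).

(** For a ring morphism [sigma] this says that it factors through the image of [phi]. *)
Definition specializes (sigma : R -> F) := forall a, phi a = 0 -> sigma a = 0.

(** Coefficients live in [R], not in its image, so leading coefficients may die under [phi].
    Truncation gives a representative whose degree is the true one. *)
Lemma map_poly_normal (p : {poly R}) : exists2 p', ph p' = ph p & size p' = size (ph p).
Proof.
have e : ph (take_poly (size (ph p)) p) = ph p.
  apply/polyP => i; rewrite !coef_map coef_take_poly /=; case: ltnP => // h.
  by rewrite rmorph0 -coef_map nth_default.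
exists (take_poly (size (ph p)) p) => //.
apply/eqP; rewrite eqn_leq size_take_poly -{1}e.
by rewrite (leq_trans (size_poly _ _)).
Qed.

Lemma lead_coef_normal (p : {poly R}) : p != 0 -> size p = size (ph p) ->
  phi (lead_coef p) != 0.
Proof.
move=> p0 e; rewrite lead_coefE -coef_map /= e -lead_coefE lead_coef_eq0.
by rewrite -size_poly_eq0 -e size_poly_eq0.
Qed.

Lemma map_poly_specialize (sigma : {rmorphism R -> F}) p :
  specializes sigma -> ph p = 0 -> map_poly sigma p = 0.
Proof.
move=> hs e; apply/polyP => i; rewrite coef_map coef0 /=; apply: hs.
by rewrite -coef_map e coef0.
Qed.

(** Every relation on a transcendental [x] is trivial, so any value [z] is allowed. [H] is the
    leading coefficient of the image of [g]: when it survives, [g] specializes to a nonzero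
    polynomial, which has a nonroot. *)
Lemma specialize_transcendental (x : K) (g : {poly R}) :
    (forall p, (ph p).[x] = 0 -> ph p = 0) -> (ph g).[x] != 0 ->
  exists H, phi H != 0 /\ forall sigma : {rmorphism R -> F}, specializes sigma ->
    sigma H != 0 -> exists z, (map_poly sigma g).[z] != 0 /\
      forall q, (ph q).[x] = 0 -> (map_poly sigma q).[z] = 0.
Proof.
move=> tr gx0.
have g0 : ph g != 0 by apply: contra_neq gx0 => ->; rewrite horner0.
exists g`_(size (ph g)).-1; split.
  by rewrite -coef_map -lead_coefE lead_coef_eq0.
move=> sigma hs h.
have : map_poly sigma g != 0.
  by apply: contra_neq h => e; rewrite -coef_map e coef0.
move/closed_nonrootP => [z hz]; exists z; split => // q /tr.
by move/(map_poly_specialize hs) => ->; rewrite horner0.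
Qed.

(* In the algebraic case a polynomial of minimal degree vanishing at [x] plays the role of a minimal polynomial
   over the fraction field of the image; pseudo-division replaces division. *)
Section Algebraic.
Context (x : K) (p : {poly R}).
Context (p0 : ph p != 0) (px0 : (ph p).[x] = 0) (np : size p = size (ph p)).
Context (pmin : forall q, (ph q).[x] = 0 -> (size (ph q) < size p)%N -> ph q = 0).

Let pN0 : p != 0.
Proof. by apply: contra_neq p0 => ->; rewrite map_poly0. Qed.

Lemma pseudo_div (d q : {poly R}) : d != 0 -> exists s t r,
  (lead_coef d ^+ s) *: q = t * d + r /\ (size r < size d)%N.
Proof.
move=> d0; exists (Pdiv.Ring.rscalp q d), (Pdiv.Ring.rdivp q d), (Pdiv.Ring.rmodp q d).
by rewrite -Pdiv.ComRing.rdivp_eq Pdiv.Ring.ltn_rmodp.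
Qed.

(** Any root [z] of the specialized [p] works: a relation [q] is, up to a power of the leading
    coefficient, a multiple of [p] plus a remainder that minimality kills. *)
Lemma algebraic_root_specialize (sigma : {rmorphism R -> F}) :
    specializes sigma -> sigma (lead_coef p) != 0 ->
  exists z, forall q, (ph q).[x] = 0 -> (map_poly sigma q).[z] = 0.
Proof.
move=> hs h.
(* The leading coefficient survives, so size one would make [ph p] a nonzero constant with root
   [x]. *)
have : size (map_poly sigma p) != 1%N.
  rewrite size_map_poly_id0 // np; apply: contraNneq p0 => /eqP /size_poly1P [c c0 e].
  by move: px0 c0; rewrite e hornerC => ->; rewrite eqxx.
move/closed_rootP => [z /rootP hz]; exists z => q qx0.
have [s [t [r [e lr]]]] := pseudo_div q pN0.
have rx0 : (ph r).[x] = 0.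
  move/(congr1 (fun u => (ph u).[x])): e.
  by rewrite map_polyZ rmorphD rmorphM !hornerE /= qx0 px0 !mulr0 add0r => <-.
have r0 : ph r = 0 by apply: pmin => //; apply: leq_ltn_trans lr; apply: size_poly.
move/(congr1 (fun u => (map_poly sigma u).[z])): e.
rewrite map_polyZ rmorphD rmorphM !hornerE /= hz (map_poly_specialize hs r0) horner0 mulr0 add0r.
move/eqP; rewrite mulf_eq0 => /orP [|/eqP //].
by rewrite rmorphXn expf_eq0 (negPf h) andbF.
Qed.

(** This is inversion of [g] modulo the minimal polynomial, with the denominator [H] kept explicit.
    Among the polynomials nonzero at [x] that agree there with a multiple of [g], one of least
    degree is shown to be constant by dividing [p] by it. *)
Lemma algebraic_multiple (g : {poly R}) : (ph g).[x] != 0 ->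
  exists w H, phi H != 0 /\ (ph (w * g - H%:P)).[x] = 0.
Proof.
move=> gx0.
pose J q := (ph q).[x] != 0 /\ size q = size (ph q) /\ exists w, (ph (w * g - q)).[x] = 0.
have Jnorm q w : (ph q).[x] != 0 -> (ph (w * g - q)).[x] = 0 ->
    exists q', J q' /\ (size q' <= size q)%N.
  move=> qx0 hw; have [q' e sq'] := map_poly_normal q; exists q'; split; last first.
    by rewrite sq' size_poly.
  split; [by rewrite e | split; [by rewrite e |]].
  by exists w; rewrite rmorphB /= e -rmorphB.
have [|d [Jd dmin]] := @prop_argmin _ J (fun q => size q).
  by have [|q [Jq _]] := @Jnorm g 1 gx0; [rewrite mul1r subrr map_poly0 horner0 | exists q].
have [dx0 [sd [w hw]]] := Jd.
have d0 : d != 0 by apply: contra_neq dx0 => ->; rewrite map_poly0 horner0.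
have ltdp : (size d < size p)%N.
  have [s [t [r [e lr]]]] := pseudo_div g pN0.
  have er : (ph r).[x] = phi (lead_coef p) ^+ s * (ph g).[x].
    move/(congr1 (fun u => (ph u).[x])): e.
    by rewrite map_polyZ rmorphD rmorphM !hornerE /= px0 mulr0 add0r rmorphXn.
  have [||q [Jq sq]] := @Jnorm r (lead_coef p ^+ s)%:P.
  - by rewrite er mulf_neq0 // expf_neq0 // lead_coef_normal.
  - rewrite mul_polyC e addrK rmorphM hornerM /= px0 mulr0 //.
  by apply: leq_ltn_trans lr; apply: leq_trans sq; apply: dmin.
have [s1|s1] := leqP (size d) 1.
  exists w, d`_0; split.
    by rewrite (size1_polyC s1) map_polyC hornerC in dx0.
  by rewrite -(size1_polyC s1).
have [s [t [r [e lr]]]] := pseudo_div p d0.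
have e1 : ph (lead_coef d ^+ s *: p) = ph (t * d + r) by rewrite e.
rewrite map_polyZ rmorphD rmorphM /= in e1.
have e2 : (phi (lead_coef d ^+ s) *: ph p).[x] = (ph t * ph d + ph r).[x] by rewrite e1.
rewrite !hornerE px0 mulr0 in e2.
have rx0 : (ph r).[x] = 0.
  apply/eqP; case: eqP => // /eqP rx0.
  (* A remainder not vanishing at [x] would again agree at [x] with a multiple of [g], in smaller
     degree than [d]. *)
  have [|q [Jq sq]] := @Jnorm r (- t * w) rx0.
    rewrite -mulrA mulNr -opprD rmorphN hornerN; apply/eqP; rewrite oppr_eq0; apply/eqP.
    have -> : t * (w * g) + r = t * (w * g - d) + (lead_coef d ^+ s) *: p.
      by rewrite e mulrBr addrA subrK.
    by rewrite rmorphD rmorphM /= map_polyZ !hornerE /= hw px0 !mulr0 addr0.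
  by have := dmin q Jq; rewrite leqNgt (leq_ltn_trans sq lr).
rewrite rx0 addr0 in e2.
have tx0 : (ph t).[x] = 0.
  by move/esym/eqP: e2; rewrite mulf_eq0 (negPf dx0) orbF => /eqP.
have cN0 : phi (lead_coef d ^+ s) != 0 by rewrite rmorphXn expf_neq0 // lead_coef_normal.
have sz : size (ph t * ph d + ph r) = size p.
  by rewrite -e1 size_scale // np.
have lrd : (size (ph r) < size d)%N by apply: leq_ltn_trans lr; apply: size_poly.
(* Since [d] is nonconstant, [t] has smaller degree than [p] and vanishes at [x]; minimality of [p]
   then leaves only the remainder, whose degree is too small. *)
have t0 : ph t = 0.
  apply: pmin => //; case: (eqVneq (ph t) 0) => [->|t0].
    by rewrite size_poly0 (leq_ltn_trans _ ltdp).
  have stn0 : (0 < size (ph t))%N by rewrite size_poly_gt0.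
  have d'0 : ph d != 0 by rewrite -size_poly_gt0 -sd (ltn_trans _ s1).
  have : size (ph t * ph d) = (size (ph t) + size d).-1 by rewrite size_mul // sd.
  move=> sm; rewrite -sz size_polyDl; rewrite sm -(prednK stn0) addSn /=.
    by rewrite -addn1 -addn1 -addnA leq_add2l.
  by rewrite (leq_trans lrd) // leq_addl.
move: sz; rewrite t0 mul0r add0r => e3.
by move: lrd; rewrite e3 ltnNge (ltnW ltdp).
Qed.

(** At the lifted root, [w * g] takes the value [sigma H], which is nonzero; hence so is the value
    of [g]. *)
Lemma specialize_algebraic (g : {poly R}) : (ph g).[x] != 0 ->
  exists H, phi H != 0 /\ forall sigma : {rmorphism R -> F}, specializes sigma ->
    sigma H != 0 -> exists z, (map_poly sigma g).[z] != 0 /\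
      forall q, (ph q).[x] = 0 -> (map_poly sigma q).[z] = 0.
Proof.
move=> /algebraic_multiple [w [H [H0 hw]]].
exists (H * lead_coef p); split.
  by rewrite rmorphM mulf_neq0 // lead_coef_normal.
move=> sigma hs; rewrite rmorphM mulf_eq0 negb_or => /andP [sH sl].
have [z hz] := algebraic_root_specialize hs sl; exists z; split=> //.
have := hz _ hw; rewrite rmorphB rmorphM /= map_polyC !hornerE => /eqP.
rewrite subr_eq0 => /eqP e; apply: contra_neq sH => g0.
by rewrite -e g0 mulr0.
Qed.
End Algebraic.

Theorem specialization_step (x : K) (g : {poly R}) : (ph g).[x] != 0 ->
  exists H, phi H != 0 /\ forall sigma : {rmorphism R -> F}, specializes sigma ->
    sigma H != 0 -> exists z, (map_poly sigma g).[z] != 0 /\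
      forall q, (ph q).[x] = 0 -> (map_poly sigma q).[z] = 0.
Proof.
move=> gx0.
have [[p0 [h1 h2]]|tr] := classic (exists p, (ph p).[x] = 0 /\ ph p <> 0); last first.
  apply: specialize_transcendental => // p hp.
  by have [//|ne] := classic (ph p = 0); case: tr; exists p.
have [|q [[qx0 q0] qmin]] := @prop_argmin _ (fun p => (ph p).[x] = 0 /\ ph p <> 0) (fun p => size (ph p)).
  by exists p0.
have [p e sp] := map_poly_normal q.
apply: (@specialize_algebraic x p) => //.
- by rewrite e; apply/eqP.
- by rewrite e.
- by rewrite e.
move=> q' q'x0; rewrite sp ltnNge.
have [//|ne] := classic (ph q' = 0).
by rewrite qmin.
Qed.
End Specialization.

(** * Specialization of generic points and the Nullstellensatz *)

Lemma mpoly_rmorph_ext (n : nat) (R S : comNzRingType) (f g : {rmorphism {mpoly R[n]} -> S}) :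
  (forall c, f c%:MP = g c%:MP) -> (forall i, f 'X_i = g 'X_i) -> f =1 g.
Proof.
move=> hC hX; elim/mpolyind => [|c m p _ _ IH]; first by rewrite !rmorph0.
rewrite !rmorphD IH -mul_mpolyC !rmorphM hC; congr (_ * _ + _).
rewrite mpolyXE_id !rmorph_prod; apply: eq_bigr => i _.
by rewrite !rmorphXn hX.
Qed.

Lemma mmap_ext (n : nat) (R S : comNzRingType) (f : {rmorphism R -> S}) (u v : 'I_n -> S) :
  u =1 v -> mmap f u =1 mmap f v.
Proof. by move=> e; have -> : u = v by apply: functional_extensionality. Qed.

Section Restrict.
Context {N : nat}.
Implicit Types (S T : {set 'I_N}).

(* A polynomial in the variables indexed by [S] is encoded as an arbitrary polynomial, evaluated at points that are
   set to 0 outside [S]. *)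
Definition restr {L : nmodType} S (t : 'I_N -> L) : 'I_N -> L := fun i => if i \in S then t i else 0.

(** The polynomial is read as univariate in the variable [j]. The coefficients stay in the same ring
    with that variable absent, which avoids reindexing. *)
Definition isolate {R : comNzRingType} (j : 'I_N) : {mpoly R[N]} -> {poly {mpoly R[N]}} :=
  mmap (polyC \o @mpolyC N R) (fun i => if i == j then 'X else ('X_i)%:P).

HB.instance Definition _ (R : comNzRingType) (j : 'I_N) := GRing.RMorphism.on (@isolate R j).

Lemma isolate_eval (R : comNzRingType) (L : comNzRingType) (a : {rmorphism R -> L}) (t : 'I_N -> L) j y p :
  (map_poly (mmap a t) (isolate j p)).[y] = mmap a (fun i => if i == j then y else t i) p.
Proof.
pose f : {rmorphism {mpoly R[N]} -> L} := (horner_eval y \o (map_poly (mmap a t) \o isolate j)).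
pose g : {rmorphism {mpoly R[N]} -> L} := mmap a (fun i => if i == j then y else t i).
have h : f =1 g.
  apply: mpoly_rmorph_ext => [c|i] /=.
    by rewrite /isolate !mmapC /= map_polyC /= /horner_eval hornerC mmapC.
  rewrite /isolate !mmapX !mmap1U /horner_eval; case: eqP => _.
    by rewrite map_polyX hornerX.
  by rewrite map_polyC /= hornerC mmapX mmap1U.
exact: h.
Qed.
End Restrict.

Section Lifting.
Context {F : closedFieldType} {K : fieldType} {N : nat}.
Context (iota : {rmorphism F -> K}) (xi : 'I_N -> K).
Implicit Types (S T : {set 'I_N}) (z : 'I_N -> F).
Local Notation ev S := (mmap iota (restr S xi)).

Definition spec S z := forall p : {mpoly F[N]}, ev S p = 0 -> p.@[restr S z] = 0.
(** Algebraic independence over [F] of the coordinates of [xi] in [S]. It is stated through values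
    because only the restriction of [p] to the variables in [S] matters. *)
Definition afree S := forall p : {mpoly F[N]}, ev S p = 0 -> forall z, p.@[restr S z] = 0.

Lemma restrU1 (L : nmodType) S j (t : 'I_N -> L) :
  (fun i => if i == j then t j else restr S t i) =1 restr (j |: S) t.
Proof. by move=> i; rewrite /restr !inE; case: eqP => [->|]. Qed.

Lemma spec_step S j (G : {mpoly F[N]}) : j \notin S -> ev (j |: S) G != 0 ->
  exists H, ev S H != 0 /\ forall z, spec S z -> H.@[restr S z] != 0 ->
   exists z', (forall i, i \in S -> z' i = z i) /\ spec (j |: S) z' /\ G.@[restr (j |: S) z'] != 0.
Proof.
move=> jS GN0.
have E (L : comNzRingType) (a : {rmorphism F -> L}) (t : 'I_N -> L) (q : {mpoly F[N]}) :
    (map_poly (mmap a (restr S t)) (isolate j q)).[t j] = mmap a (restr (j |: S) t) q.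
  by rewrite isolate_eval; apply: mmap_ext; apply: restrU1.
have [|H [H0 hH]] := @specialization_step F _ _ (ev S) (xi j) (isolate j G).
  by rewrite E.
exists H; split=> // z sz Hz.
have [||y [hy1 hy2]] := hH (meval (restr S z)) => //.
pose z' i := if i == j then y else z i.
have e : restr S z =1 restr S z'.
  by move=> i; rewrite /restr /z'; case: eqP => // -> ; rewrite (negPf jS).
have e' q : (map_poly (meval (restr S z)) (isolate j q)).[y] = q.@[restr (j |: S) z'].
  rewrite /meval -E /z' eqxx; congr (_.[y]).
  by have -> : restr S z = restr S z' by apply: functional_extensionality.
exists z'; split; first by move=> i iS; rewrite /z'; case: eqP => // ij; rewrite -ij iS in jS.
split; last by rewrite -e'.
by move=> p hp; rewrite -e' hy2 // E.
Qed.

(** The conditions are computed by removing the coordinates of [T] outside [S] one by one; the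
    values are then chosen in the opposite order. *)
Lemma spec_lift S T (G : {mpoly F[N]}) : S \subset T -> ev T G != 0 ->
  exists H, ev S H != 0 /\ forall z, spec S z -> H.@[restr S z] != 0 ->
   exists z', (forall i, i \in S -> z' i = z i) /\ spec T z' /\ G.@[restr T z'] != 0.
Proof.
elim: {T}#|T :\: S| {-2}T (erefl #|T :\: S|) G => [|n IH] T.
  move=> /eqP; rewrite cards_eq0 setD_eq0 => TS G ST GN0.
  have e : S = T by apply/eqP; rewrite eqEsubset ST TS.
  by subst T; exists G; split=> // z sz Gz; exists z.
move=> cT G ST GN0.
have [j] : exists j, j \in T :\: S by apply/set0Pn; rewrite -card_gt0 cT.
rewrite inE => /andP [jS jT].
have eT : T = j |: (T :\ j) by rewrite setD1K.
have [||H1 [H10 hH1]] := @spec_step (T :\ j) j G; rewrite -?eT ?setD11 //.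
have [||H [H0 hH]] := IH (T :\ j) _ H1 _ H10.
- have -> : (T :\ j) :\: S = (T :\: S) :\ j by apply/setP => i; rewrite !inE andbCA.
  by apply: succn_inj; rewrite -cT (cardsD1 j (T :\: S)) !inE jS jT.
- by rewrite subsetD1 ST.
exists H; split=> // z sz Hz.
have [z1 [e1 [s1 G1]]] := hH z sz Hz.
have [z2 [e2 [s2 G2]]] := hH1 z1 s1 G1.
exists z2; rewrite eT; split=> // i iS; rewrite e2 ?e1 //.
by rewrite !inE (subsetP ST i iS) andbT; apply: contraNneq jS => <-.
Qed.

Lemma spec_free S z : afree S -> spec S z.
Proof. by move=> h p hp; apply: h. Qed.

Lemma restr0 (L : nmodType) (t : 'I_N -> L) : restr set0 t = (fun=> 0).
Proof. by apply: functional_extensionality => i; rewrite /restr inE. Qed.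

Lemma restrT (L : nmodType) (t : 'I_N -> L) : restr setT t = t.
Proof. by apply: functional_extensionality => i; rewrite /restr inE. Qed.

Lemma mmap_zero (p : {mpoly F[N]}) : mmap iota (fun=> 0) p = iota p.@[fun=> 0].
Proof.
pose f : {rmorphism {mpoly F[N]} -> K} := (iota \o meval (fun=> 0)).
pose g : {rmorphism {mpoly F[N]} -> K} := mmap iota (fun=> 0).
have h : g =1 f.
  apply: mpoly_rmorph_ext => [c|i] /=; first by rewrite mevalC mmapC.
  by rewrite mevalXU mmapX mmap1U rmorph0.
exact: h.
Qed.

Lemma free_set0 : afree set0.
Proof.
move=> p; rewrite restr0 => hp z; rewrite restr0.
have : iota p.@[fun=> 0] = 0.
  by rewrite -hp mmap_zero.
by move/eqP; rewrite fmorph_eq0 => /eqP.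
Qed.
End Lifting.

Section Nullstellensatz.
Context {F : closedFieldType} {N : nat}.
Implicit Types (S T : {set 'I_N}) (P : {mpoly F[N]} -> Prop).

Definition generic {K : fieldType} (iota : {rmorphism F -> K}) (xi : 'I_N -> K) P :=
  forall p, mmap iota xi p = 0 <-> P p.

Lemma prime_generic P : prime_ideal P ->
  exists (K : fieldType) (iota : {rmorphism F -> K}) (xi : 'I_N -> K), generic iota xi P.
Proof.
move=> [[P0 [PD PM]] [P1 Pp]].
have [K [phi hphi]] := prime_kernel_field P0 PD PM P1 Pp.
pose iota : {rmorphism F -> K} := phi \o @mpolyC N F.
exists K, iota, (fun i => phi 'X_i) => p; rewrite -hphi.
pose g : {rmorphism {mpoly F[N]} -> K} := mmap iota (fun i => phi 'X_i).
have h : g =1 phi.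
  apply: mpoly_rmorph_ext => [c|i] /=; first by rewrite mmapC.
  by rewrite mmapX mmap1U.
by rewrite -[mmap _ _ p]/(g p) h.
Qed.

(** Points outside a hypersurface of the [S]-space lift to the zero set of [P]. Empty [S] gives the
    Nullstellensatz; an independent [S] gives the dominance needed for cutting by hyperplanes. *)
Lemma generic_lift (K : fieldType) (iota : {rmorphism F -> K}) xi P S G :
    generic iota xi P -> afree iota xi S -> ~ P G ->
  exists H : {mpoly F[N]}, mmap iota (restr S xi) H != 0 /\
   forall z, H.@[restr S z] != 0 ->
   exists z', (forall i, i \in S -> z' i = z i) /\ Zset P z' /\ G.@[z'] != 0.
Proof.
move=> gen fr PG.
have [|H [H0 hH]] := @spec_lift F K N iota xi S setT G (subsetT _).
  by rewrite restrT; apply/eqP => /gen.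
exists H; split=> // z /(hH z (@spec_free _ _ _ _ _ _ z fr)) [z' [h1 [h2]]].
rewrite restrT => h3; exists z'; split=> //; split=> // p /gen hp.
by have := h2 p; rewrite !restrT; apply.
Qed.

Theorem prime_nullstellensatz P G : prime_ideal P -> ~ P G ->
  exists z, Zset P z /\ G.@[z] != 0.
Proof.
move=> /prime_generic [K [iota [xi gen]]] PG.
have [H [H0 hH]] := generic_lift gen (@free_set0 F K N iota xi) PG.
(* With no coordinates prescribed, the condition [H] is just a constant of [F]. *)
have : iota H.@[fun=> 0] != 0.
  apply: contra_neq H0 => /eqP; rewrite fmorph_eq0 restr0 => /eqP e.
  by rewrite mmap_zero e rmorph0.
rewrite fmorph_eq0 => HN0.
have [|z [_ hz]] := hH (fun=> 0); first by rewrite restr0.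
by exists z.
Qed.

Lemma mpoly_zero_ideal : prime_ideal (fun p : {mpoly F[N]} => p = 0).
Proof.
split; first by split=> //; split=> [a b -> ->|a b ->]; rewrite ?addr0 ?mulr0.
split; first by apply/eqP; rewrite oner_eq0.
by move=> a b /eqP; rewrite mulf_eq0 => /orP [] /eqP; [left|right].
Qed.

Lemma mpoly_nonzero_eval (p : {mpoly F[N]}) : p != 0 -> exists z, p.@[z] != 0.
Proof.
move=> /eqP pN0; have [z [_ hz]] := prime_nullstellensatz mpoly_zero_ideal pN0.
by exists z.
Qed.
End Nullstellensatz.

(** * Noetherianity and irreducible decomposition *)

(** Each index is chosen to minimize [a] among all indices beyond the previous one, so no later
    value can be smaller. *)
Lemma nat_nondecreasing_subseq (a : nat -> nat) :
  exists v : nat -> nat, (forall i, (v i < v i.+1)%N) /\ (forall i, (a (v i) <= a (v i.+1))%N).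
Proof.
have step i : {j | (i < j)%N /\ forall l, (i < l)%N -> (a j <= a l)%N}.
  apply: constructive_indefinite_description.
  by apply: (@prop_argmin nat (fun j => (i < j)%N) a); exists i.+1.
pose v := fix v n := if n is n'.+1 then sval (step (v n')) else sval (step 0%N).
exists v; split=> i /=; first by case: (step (v i)) => j [].
case: (step (v i)) => j [/= ij _].
case: i ij => [|i] /=.
  by case: (step 0%N) => l [l0 lm] /= lj; apply: lm; apply: ltn_trans lj.
by case: (step (v i)) => l [l0 lm] /= lj; apply: lm; apply: ltn_trans lj.
Qed.

Lemma strict_mono_lt (v : nat -> nat) : (forall i, (v i < v i.+1)%N) ->
  forall i j, (i < j)%N -> (v i < v j)%N.
Proof.
move=> h i j; elim: j => // j IH; rewrite ltnS leq_eqVlt => /orP [/eqP->//|/IH ij].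
exact: ltn_trans (h j).
Qed.

Lemma dickson_seq (N : nat) (m : nat -> 'X_{1..N}) (s : seq 'I_N) :
  exists u : nat -> nat, (forall i, (u i < u i.+1)%N) /\
    forall j, j \in s -> forall i i', (i <= i')%N -> (m (u i) j <= m (u i') j)%N.
Proof.
elim: s => [|j s [u [hu IH]]]; first by exists id; split.
have [v [hv hm]] := nat_nondecreasing_subseq (fun i => m (u i) j).
exists (u \o v); split=> [i|j' jin i i' ii'] /=.
  by apply: strict_mono_lt.
move: jin; rewrite inE => /orP [/eqP ->|jin].
  elim: i' ii' => [|i' IHi]; first by rewrite leqn0 => /eqP->.
  rewrite leq_eqVlt => /orP [/eqP->//|]; rewrite ltnS => /IHi h.
  exact: leq_trans (hm i').
apply: IH => //; move: ii'; rewrite leq_eqVlt => /orP [/eqP->//|] h.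
by apply/ltnW/strict_mono_lt.
Qed.

Lemma dickson (N : nat) (m : nat -> 'X_{1..N}) : exists i j, (i < j)%N /\ (m i <= m j)%MM.
Proof.
have [u [hu hm]] := dickson_seq m (enum 'I_N).
exists (u 0%N), (u 1%N); split; first exact: hu.
by apply/mnm_lepP => l; apply: hm => //; rewrite mem_enum.
Qed.

Lemma wf_min (T : Type) (lt : T -> T -> Prop) (wf : well_founded lt) (A : Type) (Q : A -> Prop) (f : A -> T) :
  (exists x, Q x) -> exists x, Q x /\ forall y, Q y -> ~ lt (f y) (f x).
Proof.
move=> [x]; have [t] : exists t, t = f x by exists (f x).
elim/(well_founded_ind wf): t x => t IH x e Qx.
have [[y [Qy lyx]]|nex] := classic (exists y, Q y /\ lt (f y) (f x)).
  by apply: (IH (f y) _ y) => //; rewrite e.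
by exists x; split=> // y Qy lyx; apply: nex; exists y.
Qed.

Section Noether.
Context {F : closedFieldType} {N : nat}.
Implicit Types (p q : {mpoly F[N]}).

(** One step of multivariate division, cancelling the leading term of [p]. *)
Lemma mlead_cancel p q : p != 0 -> q != 0 -> (mlead q <= mlead p)%MM ->
  exists a, p - a * q = 0 \/ (mlead (p - a * q) < mlead p)%O.
Proof.
move=> p0 q0 le.
have lq0 : mleadc q != 0 by rewrite mleadc_eq0.
have lp0 : mleadc p != 0 by rewrite mleadc_eq0.
pose c := mleadc p / mleadc q.
have c0 : c != 0 by rewrite mulf_neq0 // invr_eq0.
pose a : {mpoly F[N]} := c *: 'X_[(mlead p - mlead q)%MM].
have a0 : a != 0 by rewrite scaler_eq0 negb_or c0 -msupp_eq0 msuppX.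
have la : mlead a = (mlead p - mlead q)%MM by rewrite /a mleadZ // mleadXm.
have laq : mlead (a * q) = mlead p by rewrite mleadM // la submK.
exists a; case: (eqVneq (p - a * q) 0) => [->|d0]; [by left | right].
rewrite lt_neqAle; apply/andP; split; last first.
  by have := mleadB_le p (a * q); rewrite laq joinxx.
apply: contra_neq d0 => e; apply/eqP; rewrite -mleadc_eq0 e mcoeffB.
rewrite -[X in (a * q)@_X]laq -[X in _ - X]/(mleadc (a * q)) mleadM // mleadcM.
by rewrite /a mleadcZE mleadXm mcoeffX eqxx mulr1 /c divfK // subrr.
Qed.

(** In a chain that grows at every step, choose in each gap an element with least leading monomial.
    Dickson's lemma makes an earlier leading monomial divide a later one, and cancelling gives a
    smaller element of the same gap. *)
Theorem mpoly_acc (I : nat -> {mpoly F[N]} -> Prop) :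
  (forall n, is_ideal (I n)) -> (forall n p, I n p -> I n.+1 p) ->
  exists n, forall p, I n.+1 p -> I n p.
Proof.
move=> idI incI; apply: NNPP => hn.
have ex n : {f | (I n.+1 f /\ ~ I n f) /\
    forall q, I n.+1 q /\ ~ I n q -> ~ (mlead q < mlead f)%O}.
  apply: constructive_indefinite_description.
  apply: (@wf_min _ _ (@ltom_wf N) _ (fun q => I n.+1 q /\ ~ I n q) (@mlead N F)).
  apply: NNPP => h; apply: hn; exists n => p hp; apply: NNPP => np; apply: h; by exists p.
pose f n := sval (ex n).
have f1 n : I n.+1 (f n) by rewrite /f; case: (ex n) => /= x [[]].
have f2 n : ~ I n (f n) by rewrite /f; case: (ex n) => /= x [[]].
have f3 n q : I n.+1 q -> ~ I n q -> ~ (mlead q < mlead (f n))%O.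
  by rewrite /f; case: (ex n) => /= x [_ h] *; apply: h.
have [i [j [ij le]]] := dickson (fun n => mlead (f n)).
have mono a b p : (a <= b)%N -> I a p -> I b p.
  elim: b => [|b IH]; first by rewrite leqn0 => /eqP->.
  by rewrite leq_eqVlt => /orP [/eqP->//|/IH h] /h; apply: incI.
have nz n : f n != 0 by apply/eqP => e; apply: (f2 n); rewrite e; case: (idI n).
have Iji : I j (f i) by apply: mono (f1 i).
have [a ha] := mlead_cancel (nz j) (nz i) le.
have [I0 [ID IM]] := idI j.
have nI : ~ I j (f j - a * f i).
  by move=> h; apply: (f2 j); rewrite -(subrK (a * f i) (f j)); apply: ID => //; apply: IM.
case: ha => [e|lt]; first by apply: nI; rewrite e.
apply: (f3 j _ _ nI lt).
have [_ [ID' IM']] := idI j.+1; apply: ID'; first exact: f1.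
by rewrite -mulNr; apply: IM'; apply: incI.
Qed.
End Noether.

(** * Zariski closed sets, irreducibility and vanishing ideals *)

Section Topology.
Context {F : closedFieldType}.
Implicit Types (N : nat).

Definition vanish {N} (A : @pt F N -> Prop) : {mpoly F[N]} -> Prop :=
  fun p => forall x, A x -> p.@[x] = 0.

Lemma vanish_ideal N (A : @pt F N -> Prop) : is_ideal (vanish A).
Proof.
split; first by move=> x _; rewrite meval0.
split=> [a b ha hb x Ax|a b hb x Ax]; first by rewrite mevalD ha ?hb ?addr0.
by rewrite mevalM hb ?mulr0.
Qed.

Lemma Zset_vanish N (A : @pt F N -> Prop) : zclosed A -> seqv A (Zset (vanish A)).
Proof.
move=> [T hT] x; split=> [Ax p hp|hx]; first exact: hp.
by apply/hT => p Tp; apply: hx => y /hT; apply.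
Qed.

Lemma zclosed_Zset N (T : {mpoly F[N]} -> Prop) : zclosed (Zset T).
Proof. by exists T. Qed.

Lemma zclosed_ext N (A B : @pt F N -> Prop) : seqv A B -> zclosed A -> zclosed B.
Proof.
move=> e [T h]; exists T => x; split; first by move/e/h.
by move/h/e.
Qed.

Lemma zclosedI_fam N (X : Type) (A : X -> @pt F N -> Prop) :
  (forall t, zclosed (A t)) -> zclosed (fun x => forall t, A t x).
Proof.
move=> h; exists (fun p => exists t, vanish (A t) p) => x; split.
  by move=> hx p [t hp]; apply: hp.
by move=> hx t; apply/(Zset_vanish (h t)) => p hp; apply: hx; exists t.
Qed.

Lemma zclosedI N (A B : @pt F N -> Prop) :
  zclosed A -> zclosed B -> zclosed (fun x => A x /\ B x).
Proof.
move=> hA hB; have [t|T hT] := @zclosedI_fam N bool (fun b => if b then A else B).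
  by case: t.
exists T => x; split=> [[a b]|/hT h].
  by apply/hT => -[].
by split; [apply: (h true) | apply: (h false)].
Qed.

Lemma zclosedU N (A B : @pt F N -> Prop) :
  zclosed A -> zclosed B -> zclosed (fun x => A x \/ B x).
Proof.
move=> [S hS] [T hT]; exists (fun p => exists s t, S s /\ T t /\ p = s * t) => x; split.
  by move=> [/hS h|/hT h] p [s [t [Ss [Tt ->]]]]; rewrite mevalM ?(h s Ss) ?(h t Tt) ?mul0r ?mulr0.
move=> h; have [/hS|nA] := classic (Zset S x); [by left | right; apply/hT => t Tt].
apply: NNPP => nt; apply: nA => s Ss; apply/eqP; rewrite -[_ == 0]orbF.
move/eqP/negPf: nt => <-; rewrite -mulf_eq0 -mevalM; apply/eqP/h.
by exists s, t.
Qed.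

Lemma zclosed_zero N (p : {mpoly F[N]}) : zclosed (fun x => p.@[x] = 0).
Proof.
by exists (fun q => q = p) => x; split=> [h q ->|h]; [exact: h | exact: (h p)].
Qed.

Lemma zclosed_empty N : zclosed (fun _ : @pt F N => False).
Proof.
exists (fun=> True) => x; split=> // h; have := h 1 I.
by rewrite meval1 => /eqP; rewrite oner_eq0.
Qed.

Lemma zclosed_affsp N : zclosed (@affsp F N).
Proof. by exists (fun=> False) => x; split=> // _ p []. Qed.

Lemma zclosure_closed N (A : @pt F N -> Prop) : zclosed (zclosure A).
Proof.
exists (vanish A) => x; split=> [h|h C Ccl AC].
  apply: (h (Zset (vanish A))); first exact: zclosed_Zset.
  by move=> y Ay p; apply.
by apply/(Zset_vanish Ccl) => p hp; apply: h => y /AC; apply: hp.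
Qed.

Lemma sub_zclosure N (A : @pt F N -> Prop) : sincl A (zclosure A).
Proof. by move=> x Ax C _; apply. Qed.

Lemma zclosure_min N (A C : @pt F N -> Prop) : zclosed C -> sincl A C -> sincl (zclosure A) C.
Proof. by move=> h1 h2 x; apply. Qed.

Lemma vanish_zclosure N (A : @pt F N -> Prop) p : vanish (zclosure A) p <-> vanish A p.
Proof.
split=> h x; first by move/sub_zclosure/h.
by apply: (zclosure_min (zclosed_zero p)).
Qed.

Lemma irreducible_zclosure N (A : @pt F N -> Prop) : irreducible A -> irreducible (zclosure A).
Proof.
move=> [[x Ax] h]; split; first by exists x; apply: sub_zclosure.
move=> C1 C2 h1 h2 hs; have [|s|s] := h _ _ h1 h2; first by move=> y /sub_zclosure/hs.
- by left; apply: zclosure_min.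
- by right; apply: zclosure_min.
Qed.

Lemma irreducible_ext N (A B : @pt F N -> Prop) : seqv A B -> irreducible A -> irreducible B.
Proof.
move=> e [[x Ax] h]; split; first by exists x; apply/e.
move=> C1 C2 h1 h2 hs; have [|s|s] := h _ _ h1 h2; first by move=> y /e/hs.
- by left => y /e/s.
- by right => y /e/s.
Qed.

Lemma irreducible_vanish_prime N (A : @pt F N -> Prop) : irreducible A -> prime_ideal (vanish A).
Proof.
move=> [[x Ax] h]; split; first exact: vanish_ideal.
split; first by move=> /(_ x Ax); rewrite meval1 => /eqP; rewrite oner_eq0.
move=> a b hab.
have [|s|s] := h _ _ (zclosed_zero a) (zclosed_zero b).
- move=> y /hab; rewrite mevalM => /eqP; rewrite mulf_eq0 => /orP [] /eqP; by [left|right].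
- by left.
- by right.
Qed.

Lemma vanish_Zset N (P : {mpoly F[N]} -> Prop) p : prime_ideal P -> vanish (Zset P) p <-> P p.
Proof.
move=> hP; split=> [h|Pp x]; last exact.
apply: NNPP => /(prime_nullstellensatz hP) [z [Pz]]; rewrite h ?eqxx //.
Qed.

Lemma prime_Zset_irreducible N (P : {mpoly F[N]} -> Prop) : prime_ideal P -> irreducible (Zset P).
Proof.
move=> hP; have [hI [P1 Pp]] := hP.
split; first by have [z [hz _]] := prime_nullstellensatz hP P1; exists z.
move=> C1 C2 h1 h2 hs; apply: NNPP => /not_or_and [n1 n2].
have sep C : zclosed C -> ~ sincl (Zset P) C -> exists p, vanish C p /\ ~ P p.
  move=> hC nC; apply: NNPP => h; apply: nC => x Px; apply/(Zset_vanish hC) => p hp.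
  by apply: Px; apply: NNPP => np; apply: h; exists p.
have [p [hp np]] := sep _ h1 n1; have [q [hq nq]] := sep _ h2 n2.
have : P (p * q).
  by apply/(vanish_Zset _ hP) => x /hs [/hp|/hq] e; rewrite mevalM e ?mul0r ?mulr0.
by move/Pp => [].
Qed.

Lemma irreducible_affsp N : irreducible (@affsp F N).
Proof.
have := prime_Zset_irreducible (@mpoly_zero_ideal F N); apply: irreducible_ext.
by move=> x; split=> // _ p ->; rewrite meval0.
Qed.

Lemma irreducible_open N (A : @pt F N -> Prop) (p : {mpoly F[N]}) x :
  irreducible A -> A x -> p.@[x] != 0 -> irreducible (fun y => A y /\ p.@[y] != 0).
Proof.
move=> [_ h] Ax px; split; first by exists x.
move=> C1 C2 h1 h2 hs.
have [|s|s] := h _ _ (zclosedU (zclosed_zero p) h1) h2.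
- move=> y Ay; have [e|e] := eqVneq p.@[y] 0; first by left; left.
  by case: (hs y) => //; [left; right | right].
- by left => y [/s [->|//]]; rewrite eqxx.
- by right => y [/s].
Qed.

(** The closed sets [p = 0] and [C] cover [A], and the first misses [x]. *)
Lemma irreducible_open_dense N (A C : @pt F N -> Prop) (p : {mpoly F[N]}) x :
  irreducible A -> A x -> p.@[x] != 0 -> zclosed C ->
  (forall y, A y -> p.@[y] != 0 -> C y) -> sincl A C.
Proof.
move=> [_ h] Ax px hC hs.
have [|s|//] := h _ _ (zclosed_zero p) hC.
- move=> y Ay; have [e|e] := eqVneq p.@[y] 0; [by left|by right; apply: hs].
- by rewrite s ?eqxx in px.
Qed.

Lemma zclosed_finite N n (C : nat -> @pt F N -> Prop) :
  (forall i, (i < n)%N -> zclosed (C i)) ->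
  zclosed (fun x => exists2 i, (i < n)%N & C i x).
Proof.
elim: n => [|n IHn] hC.
  by apply: zclosed_ext (@zclosed_empty N) => x; split=> // -[].
apply: (@zclosed_ext _ (fun x => (exists2 i, (i < n)%N & C i x) \/ C n x)).
  move=> x; split=> [[[i h1 h2]|h]|[i]]; first by exists i => //; apply: ltnW.
    by exists n.
  by rewrite ltnS leq_eqVlt => /orP [/eqP->|h1 h2]; [right | left; exists i].
apply: zclosedU; last by apply: hC.
by apply: IHn => i h; apply: hC; apply: ltnW.
Qed.

Lemma irreducible_finite N (A : @pt F N -> Prop) n (C : nat -> @pt F N -> Prop) :
  irreducible A -> (forall i, (i < n)%N -> zclosed (C i)) ->
  (forall x, A x -> exists2 i, (i < n)%N & C i x) ->
  exists2 i, (i < n)%N & sincl A (C i).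
Proof.
move=> irA; elim: n => [|n IH] hC hs.
  by have [[x Ax] _] := irA; have [] := hs x Ax.
have hU := @zclosed_finite _ n C (fun i h => hC i (ltnW h)).
have [_ h] := irA.
have [||s|s] := h _ _ hU (hC n _) => //.
- move=> x /hs [i]; rewrite ltnS leq_eqVlt => /orP [/eqP->|h1 h2]; [by right | by left; exists i].
- have [|i h1 h2] := IH _ s; first by move=> i hi; apply: hC; apply: ltnW.
  by exists i => //; apply: ltnW.
by exists n.
Qed.

(** A failing set would start an infinite strictly decreasing sequence of closed sets, whose
    vanishing ideals contradict the ascending chain condition. *)
Lemma noetherian_ind N (Q : (@pt F N -> Prop) -> Prop) :
  (forall A, zclosed A ->
     (forall B, zclosed B -> sincl B A -> ~ sincl A B -> Q B) -> Q A) ->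
  forall A, zclosed A -> Q A.
Proof.
move=> hQ A0 cA0; apply: NNPP => nQ0.
pose T := {A : @pt F N -> Prop | zclosed A /\ ~ Q A}.
have step (A : T) : {B : T | sincl (sval B) (sval A) /\ ~ sincl (sval A) (sval B)}.
  apply: constructive_indefinite_description; case: A => A [cA nQ] /=.
  apply: NNPP => h; apply: nQ; apply: hQ => // B cB BA nAB; apply: NNPP => nQB.
  by apply: h; exists (exist _ B (conj cB nQB)).
pose A := fix A n := if n is n'.+1 then sval (step (A n')) else exist _ A0 (conj cA0 nQ0) : T.
have [n hn] := @mpoly_acc F N (fun n => vanish (sval (A n))) (fun n => vanish_ideal _)
  (fun n p h x Ax => h x (proj1 (svalP (step (A n))) x Ax)).
apply: (proj2 (svalP (step (A n)))) => x Ax.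
have [cB _] := svalP (sval (step (A n))).
apply/(Zset_vanish cB) => p hp.
exact: (hn p hp).
Qed.

(** The pieces may contain one another; maximality is handled separately by [irr_comp]. *)
Lemma irreducible_decomposition N (A : @pt F N -> Prop) : zclosed A ->
  exists n (C : nat -> @pt F N -> Prop),
    (forall i, (i < n)%N -> zclosed (C i) /\ irreducible (C i)) /\
    (forall x, A x <-> exists2 i, (i < n)%N & C i x).
Proof.
elim/noetherian_ind => {}A cA IH.
have [irA|nirA] := classic (irreducible A).
  exists 1%N, (fun=> A); split=> // x; split; first by exists 0%N.
  by case.
have [neA|/not_ex_all_not eA] := classic (exists x, A x); last first.
  exists 0%N, (fun=> A); split=> // x; split; last by case.
  by move/eA.
have [C1 [C2 [h1 [h2 [hs [n1 n2]]]]]] : exists C1 C2, zclosed C1 /\ zclosed C2 /\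
    sincl A (fun x => C1 x \/ C2 x) /\ ~ sincl A C1 /\ ~ sincl A C2.
  apply: NNPP => h; apply: nirA; split=> // C1 C2 h1 h2 hs; apply: NNPP => /not_or_and [n1 n2].
  by apply: h; exists C1, C2.
have [|||m1 [D1 [hD1 e1]]] := IH (fun x => A x /\ C1 x).
- exact: zclosedI.
- by move=> x [].
- by move=> h; apply: n1 => x /h [].
have [|||m2 [D2 [hD2 e2]]] := IH (fun x => A x /\ C2 x).
- exact: zclosedI.
- by move=> x [].
- by move=> h; apply: n2 => x /h [].
exists (m1 + m2)%N, (fun i => if (i < m1)%N then D1 i else D2 (i - m1)%N); split.
  move=> i hi; case: ltnP => h; first exact: hD1.
  by apply: hD2; rewrite ltn_subLR.
move=> x; split.
  move=> Ax; case: (hs x Ax) => hx.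
    have [i hi Di] := (proj1 (e1 x)) (conj Ax hx).
    by exists i; [apply: ltn_addr | rewrite hi].
  have [i hi Di] := (proj1 (e2 x)) (conj Ax hx).
  by exists (m1 + i)%N; [rewrite ltn_add2l | rewrite ltnNge leq_addr addKn].
move=> [i hi]; case: ltnP => h Di.
  by case: (proj2 (e1 x)); first by exists i.
by case: (proj2 (e2 x)); first by exists (i - m1)%N => //; rewrite ltn_subLR.
Qed.
End Topology.

(** * Algebraic dependence *)

Section FractionSubfield.
Context {R : comNzRingType} {K : fieldType} (phi : {rmorphism R -> K}).

(** The subfield of [K] generated by the image of [phi]. Giving it a field structure makes the
    library closure properties of integral elements available for algebraic ones. *)
Definition frac_pred : {pred K} :=
  fun u => asbool (exists a b, phi b != 0 /\ u = phi a / phi b).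

Lemma frac_predP u : reflect (exists a b, phi b != 0 /\ u = phi a / phi b) (u \in frac_pred).
Proof. exact: asboolP. Qed.

Lemma frac_pred_divring : divring_closed frac_pred.
Proof.
split.
- by apply/frac_predP; exists 1, 1; rewrite rmorph1 oner_eq0 divr1.
- move=> u v /frac_predP [a [b [b0 ->]]] /frac_predP [c [d [d0 ->]]].
  apply/frac_predP; exists (a * d - c * b), (b * d).
  by rewrite rmorphM mulf_neq0 // rmorphB !rmorphM; split=> //; field; rewrite b0 d0.
- move=> u v /frac_predP [a [b [b0 ->]]] /frac_predP [c [d [d0 ->]]].
  apply/frac_predP; case: (eqVneq (phi c) 0) => [->|c0].
    by exists 0, 1; rewrite rmorph1 oner_eq0 rmorph0 !mul0r invr0 mulr0.
  by exists (a * d), (b * c); rewrite !rmorphM mulf_neq0 // invf_div mulf_div.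
Qed.

HB.instance Definition _ := GRing.isDivringClosed.Build K frac_pred frac_pred_divring.

Record frac_field := FracField { frac_val : K; frac_valP : frac_val \in frac_pred }.
HB.instance Definition _ := [isSub for frac_val].
HB.instance Definition _ := [Choice of frac_field by <:].
HB.instance Definition _ := [SubChoice_isSubComUnitRing of frac_field by <:].
HB.instance Definition _ := [SubComUnitRing_isSubIntegralDomain of frac_field by <:].
HB.instance Definition _ := [SubIntegralDomain_isSubField of frac_field by <:].

Definition frac_incl : {rmorphism frac_field -> K} := val.

Definition alg_over (y : K) := exists p : {poly R}, map_poly phi p != 0 /\ (map_poly phi p).[y] = 0.

Lemma frac_incl_phi a : exists u : frac_field, phi a = frac_incl u.
Proof.
have h : phi a \in frac_pred by apply/frac_predP; exists a, 1; rewrite rmorph1 oner_eq0 divr1.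
by exists (FracField h).
Qed.

Lemma integral_phi a : integralOver frac_incl (phi a).
Proof. by have [u ->] := frac_incl_phi a; apply: integral_id. Qed.

(** Over a field, integral and algebraic agree; what remains is to clear the denominators of a
    polynomial over the fraction subfield. *)
Lemma alg_over_integral y : alg_over y <-> integralOver frac_incl y.
Proof.
split=> [[p [p0 py]]|].
  apply: (integral_root p0); first exact/rootP.
  by apply/integral_poly => i; rewrite coef_map; apply: integral_phi.
move/integral_algebraic => [q q0 /rootP qy].
have [p [B [B0 e]]] : exists (p : {poly R}) B, phi B != 0 /\
    map_poly phi p = phi B *: map_poly frac_incl q.
  elim/poly_ind: {q0 qy}q => [|q [u uP] [p [B [B0 e]]]].
    by exists 0, 1; rewrite rmorph1 oner_eq0 !map_poly0 scaler0.
  have [a [b [b0 eu]]] := frac_predP _ uP.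
  exists (b *: p * 'X + (a * B)%:P), (b * B); rewrite rmorphM mulf_neq0 //; split=> //.
  have -> : map_poly frac_incl (q * 'X + (FracField uP)%:P) = map_poly frac_incl q * 'X + u%:P.
    by apply/polyP => i; rewrite coef_map !coefD !coefMX !coefC coef_map; case: i => [|i] /=; rewrite ?add0r ?addr0.
  rewrite rmorphD rmorphM /= map_polyX map_polyZ /= e map_polyC /= rmorphM scalerA scalerDr scalerAl.
  by congr (_ + _); rewrite -mul_polyC -polyCM eu; congr (_%:P); field.
exists p; rewrite e scaler_eq0 negb_or B0 map_poly_eq0 q0; split=> //.
by rewrite hornerZ qy mulr0.
Qed.
End FractionSubfield.

Lemma closed_field_uniq_seq (F : closedFieldType) n : exists s : seq F, uniq s /\ size s = n.
Proof.
elim: n => [|n [s [us ss]]]; first by exists [::].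
have [|c hc] := closed_nonrootP (\prod_(a <- s) ('X - a%:P)) _.
  by rewrite monic_neq0 // monic_prod_XsubC.
by exists (c :: s); rewrite /= -root_prod_XsubC hc us ss.
Qed.

Lemma subfield_nonroot (F : closedFieldType) (K : fieldType) (iota : {rmorphism F -> K}) (q : {poly K}) :
  q != 0 -> exists c, q.[iota c] != 0.
Proof.
move=> q0; have [s [us ss]] := closed_field_uniq_seq F (size q).
apply: NNPP => h.
have : (size (map iota s) < size q)%N.
  apply: max_poly_roots => //; last by rewrite map_inj_uniq //; apply: fmorph_inj.
  apply/allP => _ /mapP [c _ ->]; apply/negPn/negP => hc; apply: h; exists c.
  by move: hc; rewrite /root.
by rewrite size_map ss ltnn.
Qed.

Section AlgebraicClosure.
Context {F : closedFieldType} {K : fieldType} {N : nat}.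
Context (iota : {rmorphism F -> K}) (xi : 'I_N -> K).
Implicit Types (S T : {set 'I_N}).
Local Notation ev S := (mmap iota (restr S xi)).

Definition alg S (y : K) := alg_over (ev S) y.

Lemma alg_ev S p : alg S (ev S p).
Proof. by apply/alg_over_integral/integral_phi. Qed.

Lemma alg_in S j : j \in S -> alg S (xi j).
Proof.
move=> jS; have -> : xi j = ev S 'X_j by rewrite mmapX mmap1U /restr jS.
exact: alg_ev.
Qed.

Lemma alg_add S x y : alg S x -> alg S y -> alg S (x + y).
Proof. by move=> /alg_over_integral h1 /alg_over_integral h2; apply/alg_over_integral/integral_add. Qed.

Lemma alg_mul S x y : alg S x -> alg S y -> alg S (x * y).
Proof. by move=> /alg_over_integral h1 /alg_over_integral h2; apply/alg_over_integral/integral_mul. Qed.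

Lemma alg_div S x y : alg S x -> alg S y -> alg S (x / y).
Proof. by move=> /alg_over_integral h1 /alg_over_integral h2; apply/alg_over_integral/integral_div. Qed.

Lemma alg_iota S c : alg S (iota c).
Proof. by have := alg_ev S c%:MP; rewrite mmapC. Qed.

Lemma alg_mmap S (M : nat) (t : 'I_M -> K) (p : {mpoly F[M]}) :
  (forall i, alg S (t i)) -> alg S (mmap iota t p).
Proof.
move=> ht; rewrite /mmap.
have h0 : alg S 0 by rewrite -(rmorph0 iota); apply: alg_iota.
have h1 : alg S 1 by rewrite -(rmorph1 iota); apply: alg_iota.
apply: (big_ind (alg S)) => // [*|m _]; first exact: alg_add.
apply: alg_mul; first exact: alg_iota.
rewrite /mmap1; apply: (big_ind (alg S)) => // [*|i _]; first exact: alg_mul.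
elim: (m i) => [|k IH]; first by rewrite expr0.
by rewrite exprS; apply: alg_mul.
Qed.

Lemma alg_trans S T y : (forall j, j \in T -> alg S (xi j)) -> alg T y -> alg S y.
Proof.
move=> hT [p [p0 py]]; apply/alg_over_integral.
apply: (integral_root p0); first exact/rootP.
apply/integral_poly => i; rewrite coef_map /=; apply/alg_over_integral.
apply: alg_mmap => j; rewrite /restr; case: ifP => [/hT //|_].
by rewrite -(rmorph0 iota); apply: alg_iota.
Qed.

Lemma alg_sub S T y : S \subset T -> alg S y -> alg T y.
Proof. by move=> /subsetP ST; apply: alg_trans => j /ST; apply: alg_in. Qed.

(** The syntactic counterpart of [restr]: evaluating after [kill S] is evaluating at the restricted
    point. *)
Definition kill S : {mpoly F[N]} -> {mpoly F[N]} := mmap (@mpolyC N F) (restr S (fun i => 'X_i)).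

Lemma kill_eval (L : comNzRingType) (a : {rmorphism F -> L}) (t : 'I_N -> L) S p :
  mmap a t (kill S p) = mmap a (restr S t) p.
Proof.
pose f : {rmorphism {mpoly F[N]} -> L} := (mmap a t \o kill S).
pose g : {rmorphism {mpoly F[N]} -> L} := mmap a (restr S t).
have h : f =1 g.
  apply: mpoly_rmorph_ext => [c|i] /=; first by rewrite /kill !mmapC.
  rewrite /kill !mmapX !mmap1U /restr; case: ifP => _; last by rewrite rmorph0.
  by rewrite mmapX mmap1U.
exact: h.
Qed.

Lemma restr_restr (L : nmodType) S T (t : 'I_N -> L) : restr S (restr T t) = restr (S :&: T) t.
Proof.
by apply: functional_extensionality => i; rewrite /restr inE; case: (i \in S); case: (i \in T).
Qed.

Lemma restr_ext (L : nmodType) S (t u : 'I_N -> L) : {in S, t =1 u} -> restr S t = restr S u.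
Proof.
by move=> h; apply: functional_extensionality => i; rewrite /restr; case: ifP => // /h.
Qed.

(** The converse of [isolate]: the polynomial variable becomes the variable [i] again, with
    coefficients reduced to the variables in [S]. *)
Definition extract S i (p : {poly {mpoly F[N]}}) : {mpoly F[N]} := (map_poly (kill S) p).['X_i].

HB.instance Definition _ S := GRing.RMorphism.on (kill S).

Lemma extract_eval (L : comNzRingType) (a : {rmorphism F -> L}) (t : 'I_N -> L) S i p :
  mmap a t (extract S i p) = (map_poly (mmap a (restr S t)) p).[t i].
Proof.
rewrite /extract -horner_map /= mmapX mmap1U -map_poly_comp; congr (_.[_]).
by apply: eq_map_poly => c /=; apply: kill_eval.
Qed.

Lemma restr_in (L : nmodType) S (t : 'I_N -> L) i : i \in S -> restr S t i = t i.
Proof. by rewrite /restr => ->. Qed.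

Definition upd {L : Type} (t : 'I_N -> L) (j : 'I_N) (y : L) := fun i => if i == j then y else t i.

Lemma upd_eq (L : Type) (t : 'I_N -> L) j y : upd t j y j = y.
Proof. by rewrite /upd eqxx. Qed.

Lemma isolate_upd (L : comNzRingType) (a : {rmorphism F -> L}) (t : 'I_N -> L) j y p :
  (map_poly (mmap a t) (isolate j p)).[y] = mmap a (upd t j y) p.
Proof. by rewrite isolate_eval. Qed.

Lemma map_poly_eq0_coef (R : nzRingType) (L : nzRingType) (f : {rmorphism R -> L}) (p : {poly R}) :
  map_poly f p = 0 -> forall l, f p`_l = 0.
Proof. by move=> h l; rewrite -coef_map h coef0. Qed.

(** A relation for [xi i] over the coordinates in [j |: S] is reread as a polynomial in the variable
    [j]. It can only degenerate if all its coefficients vanish at the transcendental [xi i], hence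
    at every value put in its place. *)
Lemma alg_exchange S i j : alg (j |: S) (xi i) -> ~ alg S (xi i) -> alg (i |: S) (xi j).
Proof.
move=> hji hi.
have iS : i \notin S by apply/negP => /alg_in.
have [eij|ij] := eqVneq i j; first by rewrite -eij in hji *; apply: alg_in; rewrite setU11.
have jS : j \notin S.
  by apply/negP => jS; apply: hi; apply: alg_sub hji; rewrite subUset sub1set jS subxx.
have [p [p0 hp]] := hji.
pose g := extract (j |: S) i p.
have evg y z : mmap iota (restr (i |: (j |: S)) (upd (upd xi j z) i y)) g =
    (map_poly (mmap iota (restr (j |: S) (upd xi j z))) p).[y].
  rewrite extract_eval restr_restr [X in _.[X]]restr_in ?setU11 // upd_eq.
  congr ((map_poly (mmap iota _) _).[_]).
  rewrite (setIidPl _) ?subsetUr //; apply: restr_ext => l.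
  by rewrite /upd; case: (eqVneq l i) => // ->; rewrite !inE (negPf ij) (negPf iS).
have updj : upd xi j (xi j) = xi.
  by apply: functional_extensionality => l; rewrite /upd; case: eqP => [->|].
have updi : upd xi i (xi i) = xi.
  by apply: functional_extensionality => l; rewrite /upd; case: eqP => [->|].
exists (isolate j g); split; last first.
  rewrite isolate_upd -[RHS]hp -[in RHS]updj -evg updj updi; congr (mmap _ _ _).
  apply: functional_extensionality => l; rewrite /upd /restr !inE.
  by case: (eqVneq l j) => [->|]; rewrite ?orbT.
apply/eqP => q0.
(* Since [F] is infinite, some constant [c] is not a root of the original relation; replacing [xi i]
   by it contradicts the degeneration. *)
have [c hc] := subfield_nonroot iota p0; move/eqP: hc; apply.
rewrite -[in LHS]updj -evg updj.
have gcoef0 l y : mmap iota (restr (i |: S) (upd xi i y)) (isolate j g)`_l = 0.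
  have e1 := map_poly_eq0_coef q0 l.
  pose h := isolate i (isolate j g)`_l.
  have hx : (map_poly (ev S) h).[xi i] = 0.
    rewrite isolate_upd -[RHS]e1; congr (mmap _ _ _).
    apply: functional_extensionality => l'; rewrite /upd /restr !inE.
    by case: (eqVneq l' i) => [->|].
  have h0 : map_poly (ev S) h = 0.
    by apply/eqP/negPn/negP => hn0; apply: hi; exists h.
  transitivity ((map_poly (ev S) h).[y]); last by rewrite h0 horner0.
  rewrite isolate_upd; congr (mmap _ _ _).
  apply: functional_extensionality => l'; rewrite /upd /restr !inE.
  by case: (eqVneq l' i) => [->|].
have : (map_poly (mmap iota (restr (i |: S) (upd xi i (iota c)))) (isolate j g)).[xi j] = 0.
  suff -> : map_poly (mmap iota (restr (i |: S) (upd xi i (iota c)))) (isolate j g) = 0 by rewrite horner0.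
  by apply/polyP => l; rewrite coef_map /= gcoef0 coef0.
rewrite isolate_upd => h0; rewrite -[RHS]h0; congr (mmap _ _ _).
apply: functional_extensionality => l; rewrite /upd /restr !inE.
by case: (eqVneq l j) => [->|] //; rewrite [j == i]eq_sym (negPf ij).
Qed.

(** Steinitz exchange: an element of [T] outside [S] replaces an element of [S] outside [T], which
    keeps the size of [S] and its span and shrinks [T :\: S]. *)
Theorem alg_steinitz S T : (forall i, i \in T -> ~ alg (T :\ i) (xi i)) ->
  (forall i, i \in T -> alg S (xi i)) -> (#|T| <= #|S|)%N.
Proof.
move=> indT.
elim: {S}#|T :\: S| {-2}S (erefl #|T :\: S|) => [|n IH] S.
  by move=> /eqP; rewrite cards_eq0 setD_eq0 => /subset_leq_card.
move=> cT spS.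
have [t] : exists t, t \in T :\: S by apply/set0Pn; rewrite -card_gt0 cT.
rewrite inE => /andP [tS tT].
have [|S1 [[S1S aS1] S1min]] := @prop_argmin _ (fun S' : {set 'I_N} => S' \subset S /\ alg S' (xi t)) (fun S' => #|S'|).
  by exists S; split=> //; apply: spS.
have [s sS1 sT] : exists2 s, s \in S1 & s \notin T.
  apply/subsetPn; apply/negP => S1T; apply: (indT t tT); apply: alg_sub aS1.
  by apply/subsetD1P; split=> //; apply: contra tS; apply: (subsetP S1S).
have sS := subsetP S1S s sS1.
have ast : alg (t |: (S1 :\ s)) (xi s).
  apply: alg_exchange; first by rewrite setD1K.
  move=> h; have := S1min (S1 :\ s); rewrite (cardsD1 s S1) sS1 add1n ltnn => H.
  by have //: false by apply: H; split=> //; apply: subset_trans S1S; apply: subsetDl.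
pose S' := t |: (S :\ s).
have aS' j : j \in S -> alg S' (xi j).
  move=> jS; case: (eqVneq j s) => [->|js].
    by apply: alg_sub ast; apply: setUS; apply: setSD.
  by apply: alg_in; rewrite !inE js jS orbT.
have c' : #|S'| = #|S|.
  by rewrite /S' cardsU1 !inE (negPf tS) andbF /= (cardsD1 s S) sS.
rewrite -c'; apply: IH; last by move=> i iT; apply: (alg_trans aS'); apply: spS.
apply: succn_inj; rewrite -cT (cardsD1 t (T :\: S)) !inE tS tT add1n; congr (_.+1).
apply: eq_card => l; rewrite !inE.
case: (eqVneq l t) => //= lt; case: (eqVneq l s) => //= ->.
by rewrite (negPf sT) !andbF.
Qed.
End AlgebraicClosure.

(** * Dimension *)

Section Dimension.
Context {F : closedFieldType}.
Implicit Types (N M : nat).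

(** Geometrically, the projection of [A] to the coordinates in [S] is dense. *)
Definition indepA N (A : @pt F N -> Prop) (S : {set 'I_N}) :=
  forall p : {mpoly F[N]}, (forall x, A x -> p.@[restr S x] = 0) -> forall z, p.@[restr S z] = 0.

Definition basisA N (A : @pt F N -> Prop) (S : {set 'I_N}) :=
  indepA A S /\ forall j, j \notin S -> ~ indepA A (j |: S).

Lemma kill_meval N (S : {set 'I_N}) (x : @pt F N) p : (kill S p).@[x] = p.@[restr S x].
Proof. exact: kill_eval. Qed.

Section Generic.
Context {N : nat} {K : fieldType} (iota : {rmorphism F -> K}) (xi : 'I_N -> K).
Context (A : @pt F N -> Prop) (gen : generic iota xi (vanish A)).
Implicit Types (S T : {set 'I_N}).
Local Notation ev S := (mmap iota (restr S xi)).

Lemma generic_restr S p : ev S p = 0 <-> forall x, A x -> p.@[restr S x] = 0.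
Proof.
rewrite -kill_eval; split=> [/gen h x Ax|h]; first by rewrite -kill_meval; apply: h.
by apply/gen => x Ax; rewrite kill_meval; apply: h.
Qed.

Lemma indepA_free S : indepA A S <-> afree iota xi S.
Proof.
split=> h p hp z; first by apply: h => x Ax; apply: (proj1 (generic_restr S p)).
by apply: h; apply/generic_restr.
Qed.

Lemma zero_ev S p : (forall z : @pt F N, p.@[restr S z] = 0) -> ev S p = 0.
Proof. by move=> h; apply/generic_restr => x _; apply: h. Qed.

Lemma nonzero_coef (R L : nzRingType) (f : {rmorphism R -> L}) (p : {poly R}) :
  map_poly f p != 0 -> exists l, f p`_l != 0.
Proof.
move=> p0; exists (size (map_poly f p)).-1.
by rewrite -coef_map -lead_coefE lead_coef_eq0.
Qed.

(** An algebraic relation would be a polynomial in the free coordinates that is zero everywhere;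
    choosing first the other coordinates and then a nonroot for coordinate [i] refutes this. *)
Lemma free_not_alg S i : afree iota xi S -> i \in S -> ~ alg iota xi (S :\ i) (xi i).
Proof.
move=> fr iS [p [p0 hp]].
have [l hl] := nonzero_coef p0.
have [z hz] : exists z : @pt F N, (p`_l).@[restr (S :\ i) z] != 0.
  apply: NNPP => h; move/eqP: hl; apply; apply: zero_ev => z.
  by apply/eqP/negPn/negP => hz; apply: h; exists z.
pose g := extract (S :\ i) i p.
have sub : (S :\ i) :&: S = S :\ i by apply/setIidPl/subsetDl.
have evg (L : comNzRingType) (a : {rmorphism F -> L}) (t : 'I_N -> L) :
    mmap a (restr S t) g = (map_poly (mmap a (restr (S :\ i) t)) p).[t i].
  by rewrite extract_eval restr_restr restr_in // sub.
have g0 : forall z, g.@[restr S z] = 0 by apply: fr; rewrite evg.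
have [|c /negP hc] := closed_nonrootP (map_poly (meval (restr (S :\ i) z)) p) _.
  by apply: contra_neq hz => h; apply: map_poly_eq0_coef h l.
apply: hc; apply/rootP; rewrite -(g0 (upd z i c)) /meval evg upd_eq.
congr ((map_poly (mmap _ _) _).[_]); apply: restr_ext => l'.
by rewrite !inE /upd => /andP [/negPf -> _].
Qed.

Lemma free_max_alg S j : afree iota xi S -> j \notin S -> ~ afree iota xi (j |: S) -> alg iota xi S (xi j).
Proof.
move=> fr jS nfr; apply: NNPP => nalg; apply: nfr => g hg z.
have e (L : comNzRingType) (a : {rmorphism F -> L}) (t : 'I_N -> L) :
    mmap a (restr (j |: S) t) g = (map_poly (mmap a (restr S t)) (isolate j g)).[t j].
  rewrite isolate_eval; apply: mmap_ext => i; rewrite /restr !inE.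
  by case: (eqVneq i j) => [->|].
have h0 : map_poly (ev S) (isolate j g) = 0.
  by apply/eqP/negPn/negP => n0; apply: nalg; exists (isolate j g); split; rewrite // -e.
rewrite /meval e (_ : map_poly _ _ = 0) ?horner0 //.
apply/polyP => l; rewrite coef_map coef0 /=; apply: fr.
exact: map_poly_eq0_coef h0 l.
Qed.

Lemma basisA_alg S j : basisA A S -> alg iota xi S (xi j).
Proof.
move=> [/indepA_free fr mx]; case: (boolP (j \in S)) => jS; first exact: alg_in.
by apply: free_max_alg => // /indepA_free; apply: mx.
Qed.

Lemma indepA_card S T : indepA A T -> (forall j, alg iota xi S (xi j)) -> (#|T| <= #|S|)%N.
Proof.
move=> /indepA_free fr sp; apply: (@alg_steinitz _ _ _ iota xi) => // i iT.
exact: free_not_alg.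
Qed.

(** In a relation of least degree the constant term is nonzero, since otherwise the nonzero [y]
    could be divided out. *)
Lemma alg_relation S y : alg iota xi S y -> y != 0 ->
  exists p : {poly {mpoly F[N]}}, ev S p`_0 != 0 /\ (map_poly (ev S) p).[y] = 0.
Proof.
move=> [p0 hp0] y0.
have [|p [[pn0 hp] pmin]] := @prop_argmin _ (fun p => map_poly (ev S) p != 0 /\ (map_poly (ev S) p).[y] = 0) (fun p => size p).
  by exists p0.
exists p; split=> //; apply/negP => /eqP c0.
pose q := \poly_(i < (size p).-1) p`_i.+1.
have pq : p = q * 'X + (p`_0)%:P.
  apply/polyP => i; rewrite coefD coefMX coefC coef_poly; case: i => [|i] /=.
    by rewrite add0r.
  rewrite addr0; case: ltnP => // h; rewrite nth_default //.
  by rewrite -ltnS in h; case: (size p) h => //= n.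
have eq : map_poly (ev S) p = map_poly (ev S) q * 'X.
  by rewrite [in LHS]pq rmorphD rmorphM /= map_polyX map_polyC /= c0 addr0.
have pN0 : (0 < size p)%N.
  by rewrite size_poly_gt0; apply: contra_neq pn0 => ->; rewrite map_poly0.
have : (size p <= size q)%N.
  apply: pmin; split; first by apply: contra_neq pn0 => h; rewrite eq h mul0r.
  by move/eqP: hp; rewrite eq hornerMX mulf_eq0 (negPf y0) orbF => /eqP.
by rewrite leqNgt (leq_ltn_trans (size_poly _ _)) // prednK.
Qed.
End Generic.

Lemma irreducible_generic N (A : @pt F N -> Prop) : irreducible A ->
  exists (K : fieldType) (iota : {rmorphism F -> K}) (xi : 'I_N -> K), generic iota xi (vanish A).
Proof. by move/irreducible_vanish_prime/prime_generic. Qed.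

Lemma indepA_le_basis N (A : @pt F N -> Prop) S T : irreducible A ->
  indepA A T -> basisA A S -> (#|T| <= #|S|)%N.
Proof.
move=> /irreducible_generic [K [iota [xi gen]]] hT hS.
by apply: (indepA_card gen hT) => j; apply: (basisA_alg gen).
Qed.

Lemma basisA_extend N (A : @pt F N -> Prop) S : indepA A S -> exists2 T : {set 'I_N}, S \subset T & basisA A T.
Proof.
move=> hS.
have [|T [[ST hT] Tmin]] := @prop_argmin _ (fun T : {set 'I_N} => S \subset T /\ indepA A T) (fun T => #|~: T|).
  by exists S.
exists T => //; split=> // j jT hj.
have := Tmin (j |: T); rewrite leqNgt => h.
have /negP: ~~ (#|~: (j |: T)| < #|~: T|)%N by apply: h; split=> //; apply: subset_trans ST (subsetUr _ _).
apply; apply: proper_card; rewrite setCU properE subsetIr /=.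
by apply/subsetPn; exists j; rewrite !inE // eqxx.
Qed.

Lemma indepA_sub N (A B : @pt F N -> Prop) S : sincl A B -> indepA A S -> indepA B S.
Proof. by move=> AB h p hp; apply: h => x /AB /hp. Qed.

Lemma indepA_zclosure N (A : @pt F N -> Prop) S : indepA (zclosure A) S <-> indepA A S.
Proof.
split; last by apply: indepA_sub; apply: sub_zclosure.
move=> h p hp; apply: h => x zx; rewrite -kill_meval.
by apply: (proj2 (vanish_zclosure A (kill S p))) zx => y Ay; rewrite kill_meval; apply: hp.
Qed.

(** Otherwise [T] is also a basis for [C]. A function [f] that vanishes on [D] but not on [C] is
    then algebraic over [T] with nonzero constant term, and on [D] the relation reduces to this
    term, against independence of [T] on [D]. *)
Lemma strict_subset_indep N (C D : @pt F N -> Prop) S T :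
    irreducible C -> sincl D C -> zclosed D -> ~ sincl C D ->
    basisA C S -> indepA D T -> (#|T| < #|S|)%N.
Proof.
move=> irC DC clD nCD bS iT; rewrite ltnNge; apply/negP => leST.
have [T' TT' bT'] := basisA_extend (indepA_sub DC iT).
have eT : T' = T.
  apply/eqP; rewrite eq_sym eqEcard TT' /=.
  by apply: leq_trans leST; apply: (indepA_le_basis irC (proj1 bT') bS).
subst T'.
have [f [hf nf]] : exists f, vanish D f /\ ~ vanish C f.
  apply: NNPP => h; apply: nCD => x Cx; apply/(Zset_vanish clD) => p hp.
  by apply: (NNPP (p.@[x] = 0)) => np; apply: h; exists p; split=> // /(_ x Cx).
have [K [iota [xi gen]]] := irreducible_generic irC.
have y0 : mmap iota xi f != 0 by apply/eqP => /gen.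
have aT : alg iota xi T (mmap iota xi f) by apply: alg_mmap => i; apply: (basisA_alg gen).
have [p [p0 hp]] := alg_relation aT y0.
have vC : vanish C (map_poly (kill T) p).[f].
  apply/gen; rewrite -horner_map /= -map_poly_comp -[RHS]hp; congr (_.[_]).
  by apply: eq_map_poly => c /=; apply: kill_eval.
move/eqP: p0; apply; apply: (zero_ev gen); apply: iT => x Dx.
have := vC x (DC x Dx); rewrite -horner_map /= hf // horner_coef0 -map_poly_comp coef_map /=.
by rewrite kill_meval.
Qed.

(* The points lifted from the hyperplane [x_s = c] are dense in it, so one of the finitely many components of the
   slice must dominate the remaining coordinates. *)
Lemma hyperplane_cut N (C : @pt F N -> Prop) S s :
    zclosed C -> irreducible C -> indepA C S -> s \in S ->
  exists D, zclosed D /\ irreducible D /\ sincl D C /\ ~ sincl C D /\ indepA D (S :\ s).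
Proof.
move=> clC irC iS sS.
have [K [iota [xi gen]]] := irreducible_generic irC.
have /(indepA_free gen) fr := iS.
have n1 : ~ vanish C 1.
  by move=> h; have [[x Cx] _] := irC; have := h x Cx; rewrite meval1 => /eqP; rewrite oner_eq0.
have [H [H0 hH]] := generic_lift gen fr n1.
have [z0 hz0] : exists z0 : @pt F N, H.@[restr S z0] != 0.
  apply: NNPP => h; move/eqP: H0; apply; apply: (zero_ev gen) => z.
  by apply/eqP/negPn/negP => hz; apply: h; exists z.
pose c := z0 s.
pose lin : {mpoly F[N]} := 'X_s - c%:MP.
have linE x : lin.@[x] = x s - c by rewrite mevalB mevalXU mevalC.
have nlin : ~ sincl C (fun x => lin.@[x] = 0).
  move=> h; have hz : forall z, lin.@[restr S z] = 0.
    by apply: iS => x Cx; rewrite linE restr_in // -linE; apply: h.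
  have := hz (fun=> c + 1); rewrite linE restr_in // addrC addKr => /eqP.
  by rewrite oner_eq0.
have [n [D [hD eD]]] := irreducible_decomposition (zclosedI clC (zclosed_zero lin)).
suff [i [hi iD]] : exists i, (i < n)%N /\ indepA (D i) (S :\ s).
  have [clD irD] := hD i hi.
  exists (D i); split=> //; split=> //; split.
    by move=> x Dx; have [] := proj2 (eD x) (ex_intro2 _ _ i hi Dx).
  split=> // CD; apply: nlin => x /CD Dx.
  by have [] := proj2 (eD x) (ex_intro2 _ _ i hi Dx).
apply: NNPP => nex.
have bad i : exists p : {mpoly F[N]}, ((i < n)%N -> forall x, D i x -> p.@[restr (S :\ s) x] = 0) /\
    exists z, p.@[restr (S :\ s) z] != 0.
  case: (boolP (i < n)%N) => hi; last first.
    by exists 1; split=> //; exists (fun=> 0); rewrite meval1 oner_eq0.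
  have : ~ indepA (D i) (S :\ s) by move=> h; apply: nex; exists i.
  move/not_all_ex_not => [p hp]; exists p; split.
    by move=> _; apply: NNPP => h; apply: hp.
  by apply: NNPP => h; apply: hp => _ z; apply/eqP/negPn/negP => hz; apply: h; exists z.
pose p i := sval (constructive_indefinite_description _ (bad i)).
have p1 i : (i < n)%N -> forall x, D i x -> (p i).@[restr (S :\ s) x] = 0.
  by rewrite /p; case: constructive_indefinite_description => ? [].
have p2 i : exists z, (p i).@[restr (S :\ s) z] != 0.
  by rewrite /p; case: constructive_indefinite_description => ? [].
(* The condition [H] on the slice where the coordinate [s] equals [c]. It is not identically zero
   because [c] was taken from a point where [H] does not vanish. *)
pose Hc : {mpoly F[N]} := mmap (@mpolyC N F) (fun i => if i == s then c%:MP else restr S (fun i => 'X_i) i) H.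
have HcE z : Hc.@[z] = H.@[restr S (upd z s c)].
  pose f : {rmorphism {mpoly F[N]} -> F} := meval z \o mmap (@mpolyC N F) (fun i => if i == s then c%:MP else restr S (fun i => 'X_i) i).
  pose g : {rmorphism {mpoly F[N]} -> F} := meval (restr S (upd z s c)).
  have h : f =1 g.
    apply: mpoly_rmorph_ext => [a|i] /=; first by rewrite mmapC !mevalC.
    rewrite mmapX mmap1U mevalXU /restr /upd; case: eqP => [->|_]; first by rewrite sS mevalC.
    by case: ifP => _; rewrite ?mevalXU ?meval0.
  exact: h.
have HcN0 : Hc != 0.
  apply: contra_neq hz0 => e; have := HcE z0; rewrite e meval0 => ->.
  congr (meval _ _); apply: restr_ext => i _; rewrite /upd; case: eqP => [->|] //.
pose q := \prod_(i < n) kill (S :\ s) (p i).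
have qN0 : q != 0.
  apply/prodf_neq0 => i _; have [z hz] := p2 i; apply: contra_neq hz => e.
  by rewrite -kill_meval e meval0.
have [z] := mpoly_nonzero_eval (mulf_neq0 qN0 HcN0).
rewrite mevalM mulf_eq0 negb_or HcE => /andP [qz /hH [z' [ez' [Cz' _]]]].
have Cz : C z' by apply/(Zset_vanish clC).
have [i hi Dz'] : exists2 i, (i < n)%N & D i z'.
  by apply/eD; split=> //; rewrite linE ez' // upd_eq subrr.
have := p1 i hi z' Dz'.
have -> : restr (S :\ s) z' = restr (S :\ s) z.
  apply: restr_ext => l; rewrite !inE => /andP [ls lS]; rewrite ez' // /upd (negPf ls) //.
move/eqP; apply/negP.
have := qz; rewrite /q rmorph_prod /= => /prodf_neq0 /(_ (Ordinal hi) isT).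
by rewrite kill_meval.
Qed.

(** Each hyperplane cut costs exactly one independent coordinate, so as many cuts as elements of [S]
    are possible. *)
Lemma indepA_chain N d (C : @pt F N -> Prop) S :
  zclosed C -> irreducible C -> indepA C S -> #|S| = d -> has_chain C d.
Proof.
elim: d C S => [|d IH] C S clC irC iS cS.
  by exists (fun=> C); split=> // i _; split=> //; split=> // x.
have [s sS] : exists s, s \in S by apply/set0Pn; rewrite -card_gt0 cS.
have [D [clD [irD [DC [nCD iD]]]]] := hyperplane_cut clC irC iS sS.
have [|E [hE1 hE2]] := IH D _ clD irD iD.
  by apply: succn_inj; rewrite -cS (cardsD1 s S) sS.
exists (fun i => if (i <= d)%N then E i else C); split=> i hi.
  case: ifP => h; last by split=> //; split=> // x.
  have [h1 [h2 h3]] := hE1 i h; split=> //; split=> // x /h3; exact: DC.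
have /orP [/eqP ->|{}hi] : (i == d) || (i < d)%N by rewrite -leq_eqVlt -ltnS.
  rewrite /= leqnn ltnn; have [_ [_ h3]] := hE1 d (leqnn d).
  split; first by move=> x /h3 /DC.
  by move=> h; apply: nCD => x /h /h3.
by rewrite /= (ltnW hi) hi; apply: hE2.
Qed.

Lemma indepA_set0 N (A : @pt F N -> Prop) : (exists x, A x) -> indepA A set0.
Proof. by move=> [x Ax] p hp z; have := hp x Ax; rewrite !restr0. Qed.

(** Each strict inclusion of the chain raises the size of a basis by at least one. *)
Lemma chain_bound N (C : @pt F N -> Prop) (E : nat -> @pt F N -> Prop) d S :
    (forall i, (i <= d)%N -> zclosed (E i) /\ irreducible (E i) /\ sincl (E i) C) ->
    (forall i, (i < d)%N -> sincl (E i) (E i.+1) /\ ~ sincl (E i.+1) (E i)) ->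
    basisA (E d) S -> (d <= #|S|)%N.
Proof.
elim: d S => [//|d IH] S h1 h2 bS.
have [clE [irE _]] := h1 d (leqnSn d).
have [T' _ bT] := basisA_extend (indepA_set0 (proj1 irE)).
 have [clE' [irE' _]] := h1 d.+1 (leqnn _).
have [s1 s2] := h2 d (leqnn _).
have lt := strict_subset_indep irE' s1 clE s2 bS (proj1 bT).
apply: leq_trans lt; rewrite ltnS; apply: (IH T') => // i hi; first by apply: h1; apply: ltnW.
by apply: h2; apply: ltnW.
Qed.

Theorem basisA_dim N (C : @pt F N -> Prop) S :
  zclosed C -> irreducible C -> basisA C S -> dimP C #|S|.
Proof.
move=> clC irC bS; split; first by apply: indepA_chain (proj1 bS) _.
move=> [E [h1 h2]].
have [clE [irE s3]] := h1 _ (leqnn #|S|.+1).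
have [T' _ bT] := basisA_extend (indepA_set0 (proj1 irE)).
have := chain_bound h1 h2 bT; rewrite leqNgt ltnS => /negP; apply.
by apply: (indepA_le_basis irC _ bS); apply: indepA_sub (proj1 bT).
Qed.
End Dimension.

(** * Transcendence bases under coordinate projections, products and birational maps *)

Lemma split_lshift m n (i : 'I_m) : split (lshift n i) = inl i.
Proof. exact: (unsplitK (inl i)). Qed.

Lemma split_rshift m n (j : 'I_n) : split (rshift m j) = inr j.
Proof. exact: (unsplitK (inr j)). Qed.

Section Rank.
Context {F : closedFieldType}.
Implicit Types (N M e : nat).

Lemma indepA_subset N (A : @pt F N -> Prop) (S T : {set 'I_N}) :
  T \subset S -> indepA A S -> indepA A T.
Proof.
move=> /setIidPl TS iS p hp z.
have E x : (kill T p).@[restr S x] = p.@[restr T x] by rewrite kill_meval restr_restr TS.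
by rewrite -E; apply: iS => x Ax; rewrite E hp.
Qed.

Definition rename N M (h : 'I_N -> 'I_M) (p : {mpoly F[N]}) : {mpoly F[M]} :=
  mmap (@mpolyC M F) (fun i => 'X_(h i)) p.

Lemma mmap_mmap N M (L : comNzRingType) (a : {rmorphism F -> L}) (t : 'I_M -> L)
    (u : 'I_N -> {mpoly F[M]}) p :
  mmap a t (mmap (@mpolyC M F) u p) = mmap a (fun i => mmap a t (u i)) p.
Proof.
pose f : {rmorphism {mpoly F[N]} -> L} := mmap a t \o mmap (@mpolyC M F) u.
pose g : {rmorphism {mpoly F[N]} -> L} := mmap a (fun i => mmap a t (u i)).
have h : f =1 g.
  apply: mpoly_rmorph_ext => [c|i] /=; first by rewrite !mmapC.
  by rewrite !mmapX !mmap1U.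
exact: h.
Qed.

Lemma meval_mmap N M (t : @pt F M) (u : 'I_N -> {mpoly F[M]}) p :
  (mmap (@mpolyC M F) u p).@[t] = p.@[fun i => (u i).@[t]].
Proof. exact: mmap_mmap. Qed.

(** The hypotheses make [h] induce a surjective projection from [B] to [A]. It is applied to the
    factor of a product and to both projections of a graph. *)
Lemma indepA_imset N M (h : 'I_N -> 'I_M) (A : @pt F N -> Prop) (B : @pt F M -> Prop) (S : {set 'I_N}) :
  injective h -> (forall y, B y -> A (y \o h)) ->
  (forall x, A x -> exists2 y, B y & y \o h = x) ->
  indepA B [set h i | i in S] <-> indepA A S.
Proof.
move=> injh BA AB.
have ext (z : @pt F N) : exists z' : @pt F M, z' \o h = z.
  exists (fun a => if [pick i | h i == a] is Some i then z i else 0).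
  apply: functional_extensionality => i /=; case: pickP => [j /eqP /injh -> //|].
  by move/(_ i); rewrite eqxx.
have rs (y : @pt F M) i : restr [set h i | i in S] y (h i) = restr S (y \o h) i.
  by rewrite /restr mem_imset.
split=> iS p hp z.
  have E (y : @pt F M) : (rename h p).@[restr [set h i | i in S] y] = p.@[restr S (y \o h)].
    rewrite /rename meval_mmap; apply: meval_eq => i; by rewrite mevalXU rs.
  have [z' <-] := ext z; rewrite -E; apply: iS => y By; rewrite E; apply: hp; exact: BA.
pose u (a : 'I_M) : {mpoly F[N]} := if [pick i | h i == a] is Some i then 'X_i else 0.
have E (y : @pt F M) : (mmap (@mpolyC N F) u p).@[restr S (y \o h)] = p.@[restr [set h i | i in S] y].
  rewrite meval_mmap; apply: meval_eq => a; rewrite /u; case: pickP => [i /eqP <-|na].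
    by rewrite mevalXU rs.
  rewrite meval0 /restr; case: ifP => // /imsetP [i _ ea].
  by have := na i; rewrite ea eqxx.
rewrite -E; apply: iS => x /AB [y By ey]; rewrite -ey E; exact: hp.
Qed.

Lemma basisA_product N e (C : @pt F N -> Prop) (S : {set 'I_N}) : (exists x, C x) -> basisA C S ->
  basisA (prodset C (@affsp F e)) ([set lshift e i | i in S] :|: [set rshift N j | j in [set: 'I_e]]).
Proof.
move=> neC [iS mS].
set S' := _ :|: _.
have Sl i : (lshift e i \in S') = (i \in S).
  rewrite inE mem_imset; last exact: lshift_inj.
  case: (_ \in S) => //=; apply/negP => /imsetP [j _ /eqP].
  by rewrite eq_lrshift.
have Sr j : rshift N j \in S'.
  by rewrite inE orbC imset_f.
split.
  move=> p hp z.
  pose u a : {mpoly F[N]} := match split a with inl i => 'X_i | inr j => (z (rshift N j))%:MP end.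
  pose q := mmap (@mpolyC N F) u p.
  pose pr (x : @pt F N) : @pt F (N + e) := fun a => match split a with inl i => x i | inr j => z (rshift N j) end.
  have prl x i : pr x (lshift e i) = x i.
    by rewrite /pr split_lshift.
  have prr x i : pr x (rshift N i) = z (rshift N i).
    by rewrite /pr split_rshift.
  have E x : q.@[restr S x] = p.@[restr S' (pr x)].
    rewrite meval_mmap; apply: meval_eq => a; rewrite /u.
    case: split_ordP => k ->; rewrite ?mevalXU ?mevalC /restr ?Sl ?Sr ?prl ?prr //.
  have -> : restr S' z = restr S' (pr (fun i => z (lshift e i))).
    by apply: restr_ext => a _; case: (split_ordP a) => k ->; rewrite ?prl ?prr.
  rewrite -E; apply: iS => x Cx; rewrite E; apply: hp; split => //.
  by have -> : (fun i => pr x (lshift e i)) = x by apply: functional_extensionality => i.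
move=> a; case: (split_ordP a) => j ->; last by rewrite Sr.
rewrite Sl => jS h; apply: (mS j jS).
apply/(@indepA_imset _ _ (lshift e) C (prodset C (@affsp F e))).
- exact: lshift_inj.
- by move=> y [].
- move=> x Cx; exists (fun a => match split a with inl i => x i | inr j => 0 end).
    split=> //; have -> // : (fun i => match split (lshift e i) with inl i0 => x i0 | inr _ => 0 end) = x.
    by apply: functional_extensionality => i; rewrite split_lshift.
  by apply: functional_extensionality => i /=; rewrite split_lshift.
apply: indepA_subset h; apply/subsetP => b /imsetP [i]; rewrite !inE => /orP [/eqP ->|iS'] ->.
  by rewrite eqxx.
by rewrite imset_f ?orbT.
Qed.

Lemma card_product_basis N e (S : {set 'I_N}) :
  #|[set lshift e i | i in S] :|: [set rshift N j | j in [set: 'I_e]]| = (#|S| + e)%N.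
Proof.
rewrite cardsU (_ : _ :&: _ = set0) ?cards0 ?subn0; last first.
  apply/setP => a; rewrite !inE; apply/negP => /andP [/imsetP [i _ ->] /imsetP [j _ /eqP]].
  by rewrite eq_lrshift.
rewrite !card_imset ?cardsT ?card_ord //; [exact: rshift_inj | exact: lshift_inj].
Qed.

(* [X] and its image are both projections of the graph, whose coordinates are algebraic over either of them. *)
Lemma basisA_birational N M (X : @pt F N -> Prop) (f : 'I_M -> {mpoly F[N]})
    (g h : 'I_N -> {mpoly F[M]}) S T :
  let ff x := fun i => (f i).@[x] in
  irreducible X ->
  (forall j, exists2 x, X x & (h j).@[ff x] != 0) ->
  (forall j x, X x -> (h j).@[ff x] * x j = (g j).@[ff x]) ->
  basisA X S -> basisA (fun y => exists2 x, X x & y = ff x) T -> #|S| = #|T|.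
Proof.
move=> ff irX hN0 hg bS bT.
have [K [iota [xi gen]]] := irreducible_generic irX.
pose u (a : 'I_(N + M)) : {mpoly F[N]} := match split a with inl i => 'X_i | inr j => f j end.
pose w a := mmap iota xi (u a).
pose gr x : @pt F (N + M) := fun a => (u a).@[x].
pose B (y : @pt F (N + M)) := exists2 x, X x & y = gr x.
have ul i : u (lshift M i) = 'X_i.
  by rewrite /u split_lshift.
have ur i : u (rshift N i) = f i.
  by rewrite /u split_rshift.
have genB : generic iota w (vanish B).
  move=> p; rewrite -[mmap iota w p]mmap_mmap; split=> [/gen H y [x Xx ->]|H].
    by have := H x Xx; rewrite meval_mmap.
  by apply/gen => x Xx; rewrite meval_mmap; apply: H; exists x.
have wl i : w (lshift M i) = xi i by rewrite /w ul mmapX mmap1U.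
have iB1 (S' : {set 'I_N}) : indepA B [set lshift M i | i in S'] <-> indepA X S'.
  apply: indepA_imset; first exact: lshift_inj.
    move=> y [x Xx ->]; have -> // : gr x \o lshift M = x.
    by apply: functional_extensionality => i; rewrite /gr /= ul mevalXU.
  move=> x Xx; exists (gr x); first by exists x.
  by apply: functional_extensionality => i; rewrite /gr /= ul mevalXU.
have iB2 (S' : {set 'I_M}) : indepA B [set rshift N i | i in S'] <-> indepA (fun y => exists2 x, X x & y = ff x) S'.
  apply: indepA_imset; first exact: rshift_inj.
    move=> y [x Xx ->]; exists x => //.
    by apply: functional_extensionality => i; rewrite /gr /= ur.
  move=> y [x Xx ->]; exists (gr x); first by exists x.
  by apply: functional_extensionality => i; rewrite /gr /= ur.
have [iS mS] := bS; have [iT mT] := bT.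
have spS j : alg iota w [set lshift M i | i in S] (xi j).
  rewrite -wl; case: (boolP (j \in S)) => jS; first by apply: alg_in; apply: imset_f.
  apply: free_max_alg => //.
  - by apply/(indepA_free genB)/iB1.
  - by rewrite mem_imset //; apply: lshift_inj.
  by move=> /(indepA_free genB); rewrite -imsetU1 => /iB1; apply: mS.
have spT j : alg iota w [set rshift N i | i in T] (w (rshift N j)).
  case: (boolP (j \in T)) => jS; first by apply: alg_in; apply: imset_f.
  apply: free_max_alg => //.
  - by apply/(indepA_free genB)/iB2.
  - by rewrite mem_imset //; apply: rshift_inj.
  by move=> /(indepA_free genB); rewrite -imsetU1 => /iB2; apply: mT.
have le1 : (#|[set rshift N i | i in T]| <= #|[set lshift M i | i in S]|)%N.
  apply: (indepA_card genB); first exact/iB2.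
  by move=> a; apply: alg_mmap.
have le2 : (#|[set lshift M i | i in S]| <= #|[set rshift N i | i in T]|)%N.
  apply: (indepA_card genB); first exact/iB1.
  move=> a; apply: alg_mmap => j.
  pose ev (p : {mpoly F[M]}) := mmap iota (fun i => w (rshift N i)) p.
  have evE p : ev p = mmap iota xi (mmap (@mpolyC N F) f p).
    rewrite mmap_mmap; apply: mmap_ext => i; by rewrite /w ur.
  have h0 : ev (h j) != 0.
    apply/eqP; rewrite evE => /gen H; have [x Xx] := hN0 j.
    by have := H x Xx; rewrite meval_mmap => ->; rewrite eqxx.
  have e : ev (h j) * xi j = ev (g j).
    apply/eqP; rewrite -subr_eq0 !evE.
    have -> : mmap iota xi (mmap (@mpolyC N F) f (h j)) * xi j - mmap iota xi (mmap (@mpolyC N F) f (g j))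
       = mmap iota xi (mmap (@mpolyC N F) f (h j) * 'X_j - mmap (@mpolyC N F) f (g j)).
      by rewrite rmorphB rmorphM /= mmapX mmap1U.
    apply/eqP/gen => x Xx; rewrite mevalB mevalM mevalXU !meval_mmap.
    by apply/eqP; rewrite subr_eq0; apply/eqP; apply: hg.
  have -> : xi j = ev (g j) / ev (h j) by rewrite -e mulrC mulKf.
  by apply: alg_div; apply: alg_mmap => i; apply: spT.
have := conj le1 le2; rewrite !card_imset; try exact: rshift_inj; try exact: lshift_inj.
by move=> [h1 h2]; apply/eqP; rewrite eqn_leq h1 h2.
Qed.
End Rank.

(** * Minors of polynomial matrices modulo a power of t *)

Section ModX.
Context {F : fieldType}.
Implicit Types (p q : {poly F}) (k l : nat).

Definition modX k p := forall l, (l < k)%N -> p`_l = 0.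

Lemma modX0 k : modX k 0.
Proof. by move=> l _; rewrite coef0. Qed.

Lemma modXD k p q : modX k p -> modX k q -> modX k (p + q).
Proof. by move=> hp hq l lk; rewrite coefD hp ?hq ?addr0. Qed.

Lemma modXN k p : modX k p -> modX k (- p).
Proof. by move=> hp l lk; rewrite coefN hp ?oppr0. Qed.

Lemma modXM k p q : modX k q -> modX k (p * q).
Proof.
move=> hq l lk; rewrite coefM big1 // => i _; rewrite hq ?mulr0 //.
exact: leq_ltn_trans (leq_subr _ _) lk.
Qed.

Lemma modX_sum (I : Type) (s : seq I) (P : pred I) (f : I -> {poly F}) k :
  (forall i, P i -> modX k (f i)) -> modX k (\sum_(i <- s | P i) f i).
Proof. by move=> h; apply: big_ind => //; [apply: modX0 | apply: modXD]. Qed.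

Lemma modX_exp k p : p`_0 = 0 -> modX k (p ^+ k).
Proof.
move=> p0; elim: k => [|k IH] l lk //; rewrite exprS coefM big1 // => -[[|i] hi] _ /=.
  by rewrite p0 mul0r.
by rewrite IH ?mulr0 //; rewrite ltnS in lk; apply: leq_trans lk; rewrite ltn_subrL /=; apply: leq_ltn_trans (hi : (i < l)%N).
Qed.

Lemma modX_cancel k p q : p`_0 != 0 -> modX k (p * q) -> modX k q.
Proof.
move=> p0 h l; elim/ltn_ind: l => l IH lk.
have := h l lk; rewrite coefM big_ord_recl big1 => [|i _].
  by rewrite addr0 subn0 /= => /eqP; rewrite mulf_eq0 (negPf p0) => /eqP.
rewrite /= /bump /= add1n IH ?mulr0 //.
  by rewrite ltn_subrL /=; apply: leq_ltn_trans (ltn_ord i).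
by apply: leq_ltn_trans lk; apply: leq_subr.
Qed.

Definition congX k p q := modX k (p - q).

Lemma congX_refl k p : congX k p p.
Proof. by rewrite /congX subrr; apply: modX0. Qed.

Lemma congX_sym k p q : congX k p q -> congX k q p.
Proof. by move=> h; rewrite /congX -opprB; apply: modXN. Qed.

Lemma congX_trans k p q r : congX k p q -> congX k q r -> congX k p r.
Proof. by move=> h1 h2; rewrite /congX -(subrK q p) -addrA; apply: modXD. Qed.

Lemma congXD k p q p' q' : congX k p p' -> congX k q q' -> congX k (p + q) (p' + q').
Proof. by move=> h1 h2; rewrite /congX opprD addrACA; apply: modXD. Qed.

Lemma congXN k p q : congX k p q -> congX k (- p) (- q).
Proof. by move=> h; rewrite /congX -opprD; apply: modXN. Qed.

Lemma congXM k p q p' q' : congX k p p' -> congX k q q' -> congX k (p * q) (p' * q').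
Proof.
move=> h1 h2; rewrite /congX.
have -> : p * q - p' * q' = q * (p - p') + p' * (q - q') by ring.
by apply: modXD; apply: modXM.
Qed.

Lemma congX_modX k p q : congX k p q -> modX k p -> modX k q.
Proof. by move=> h hp; rewrite -(subrK p q); apply: modXD => //; apply: congX_sym. Qed.

Lemma congX_coef k p q l : congX k p q -> (l < k)%N -> p`_l = q`_l.
Proof. by move=> h /h; rewrite coefB => /eqP; rewrite subr_eq0 => /eqP. Qed.

Lemma congX_det k n (A B : 'M[{poly F}]_n) : (forall i j, congX k (A i j) (B i j)) ->
  congX k (\det A) (\det B).
Proof.
move=> h; apply: (big_ind2 (fun p q => congX k p q)); first exact: congX_refl.
  by move=> *; apply: congXD.
move=> s _; apply: congXM; first exact: congX_refl.
apply: (big_ind2 (fun p q => congX k p q)) => //; first exact: congX_refl.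
by move=> *; apply: congXM.
Qed.

Definition tpoly k (c : 'I_k -> F) : {poly F} := \sum_(l < k) (c l)%:P * 'X^l.

Lemma coef_tpoly k (c : 'I_k -> F) (l : 'I_k) : (tpoly c)`_l = c l.
Proof.
rewrite /tpoly coef_sum (bigD1 l) //= coefCM coefXn eqxx mulr1 big1 ?addr0 // => i il.
by rewrite coefCM coefXn (inj_eq val_inj) eq_sym (negPf il) mulr0.
Qed.

Lemma congX_tpoly k p : congX k (tpoly (fun l : 'I_k => p`_l)) p.
Proof.
move=> l lk; have := coef_tpoly (fun l : 'I_k => p`_l) (Ordinal lk).
by rewrite coefB /= => ->; rewrite subrr.
Qed.

End ModX.

Section Minors.
Context {F : fieldType}.

Definition incr m n (f : 'I_m -> 'I_n) := forall a b : 'I_m, (a < b)%N -> (f a < f b)%N.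

Definition minors m n (r k : nat) (X : 'M[{poly F}]_(m, n)) :=
  forall (f : 'I_r -> 'I_m) (g : 'I_r -> 'I_n), incr f -> incr g ->
    modX k (\det (\matrix_(a, b) X (f a) (g b))).

Lemma minors_congX m n r k (X X' : 'M[{poly F}]_(m, n)) :
  (forall i j, congX k (X i j) (X' i j)) -> minors r k X -> minors r k X'.
Proof.
move=> h mX f g hf hg; apply: congX_modX (mX f g hf hg).
by apply: congX_det => a b; rewrite !mxE.
Qed.

(** The matrix is the Schur complement of the corner 1 in the block matrix with rows (1, -w) and (c,
    Y), so both have the same determinant. Expanding the latter along its first row and first column
    leaves [\det Y] and minors of [Y] one size smaller. *)
Lemma det_rank_one (R : comNzRingType) n (Y : 'M[R]_n.+1) (c : 'cV[R]_n.+1) (w : 'rV[R]_n.+1) :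
  exists e : 'I_n.+1 -> 'I_n.+1 -> R,
    \det (Y + c *m w) = \sum_i \sum_j e i j * \det (row' i (col' j Y)).
Proof.
pose B : 'M[R]_(1 + n.+1) := block_mx 1%:M (- w) c Y.
have -> : \det (Y + c *m w) = \det B.
  have -> : B = block_mx 1%:M 0 c 1%:M *m block_mx 1%:M (- w) 0 (Y + c *m w).
    rewrite mulmx_block !mul1mx !mulmx1 !mul0mx !addr0.
    by rewrite mulmxN (addrC Y) addKr.
  by rewrite det_mulmx det_lblock det_ublock !det1 !mul1r.
have detY : exists e : 'I_n.+1 -> 'I_n.+1 -> R, \det Y = \sum_i \sum_j e i j * \det (row' i (col' j Y)).
  exists (fun i j => if i == ord0 then Y ord0 j * (-1) ^+ (i + j) else 0).
  rewrite (expand_det_row _ ord0) [RHS](bigD1 ord0) //= [X in _ + X]big1 ?addr0.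
    by apply: eq_bigr => j _; rewrite /cofactor mulrA.
  by move=> i /negPf i0; apply: big1 => j _; rewrite i0 mul0r.
have [e0 he0] := detY.
have B0 : B ord0 ord0 = 1.
  have -> : (ord0 : 'I_(1 + n.+1)) = lshift n.+1 ord0 by apply: val_inj.
  by rewrite block_mxEul mxE eqxx.
have BS i j : B (lift ord0 i) (lift ord0 j) = Y i j by rewrite -!rshift1 block_mxEdr.
have BC i : B (lift ord0 i) ord0 = c i ord0.
  rewrite -rshift1; have -> : (ord0 : 'I_(1 + n.+1)) = lshift n.+1 ord0 by apply: val_inj.
  by rewrite block_mxEdl.
clearbody B.
(* Deleting the border row and column together with one further row and column gives exactly a minor
   of [Y]. *)
have minorB i j : row' i (col' ord0 (row' ord0 (col' (lift ord0 j) B))) = row' i (col' j Y).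
  apply/matrixP => a b; rewrite !mxE -BS; congr (B _ _); apply: val_inj => /=.
  by rewrite /bump !leq0n !add1n ?ltnS ?addnS.
rewrite (expand_det_row _ ord0) big_ord_recl B0 mul1r.
have -> : cofactor B ord0 ord0 = \det Y.
  rewrite /cofactor expr0 mul1r; congr (\det _); apply/matrixP => i j; rewrite !mxE.
  exact: BS.
exists (fun i j => e0 i j + B ord0 (lift ord0 j) * (-1) ^+ (lift ord0 j) * (c i ord0 * (-1) ^+ (i))).
rewrite he0.
under [RHS]eq_bigr => i _ do (under eq_bigr => j _ do rewrite mulrDl; rewrite big_split).
rewrite big_split; congr (_ + _); rewrite [RHS]exchange_big; apply: eq_bigr => j _.
rewrite /cofactor (expand_det_col _ ord0) mulrA mulr_sumr; apply: eq_bigr => i _.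
rewrite /cofactor minorB !mxE.
have -> : B (lift ord0 i) (lift (lift ord0 j) ord0) = c i ord0.
  by rewrite -BC; congr (B _ _); apply: val_inj.
by rewrite !mulrA addn0 add0n.
Qed.

Section Bordered.
Context {m n : nat} (c : 'cV[{poly F}]_m.+1) (w : 'rV[{poly F}]_n.+1) (Y : 'M[{poly F}]_(m, n)).

(** The block matrix (0 0; 0 Y), whose minors through the first row or column are zero. *)
Definition border : 'M[{poly F}]_(m.+1, n.+1) :=
  \matrix_(i, j) if unlift ord0 i is Some i' then
    (if unlift ord0 j is Some j' then Y i' j' else 0) else 0.

Lemma borderSS i j : border (lift ord0 i) (lift ord0 j) = Y i j.
Proof. by rewrite mxE !liftK. Qed.

Lemma border0l j : border ord0 j = 0.
Proof. by rewrite mxE unlift_none. Qed.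

Lemma border0r i : border i ord0 = 0.
Proof. by rewrite mxE unlift_none; case: unlift. Qed.

Lemma minors_border r k : minors r k Y -> minors r k border.
Proof.
move=> hY f g hf hg.
have [[a fa]|hf0] := classic (exists a, f a = ord0).
  rewrite (expand_det_row _ a) big1; first exact: modX0.
  by move=> j _; rewrite mxE fa border0l mul0r.
have [[a ga]|hg0] := classic (exists a, g a = ord0).
  rewrite (expand_det_col _ a) big1; first exact: modX0.
  by move=> j _; rewrite mxE ga border0r mul0r.
have lft p (h : 'I_r -> 'I_p.+1) : incr h -> ~ (exists a, h a = ord0) ->
    exists2 h' : 'I_r -> 'I_p, incr h' & forall a, h a = lift ord0 (h' a).
  move=> hh h0.
  have ex a : {b | h a = lift ord0 b}.
    apply: constructive_indefinite_description; case: (unliftP ord0 (h a)) => [b ->|e].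
      by exists b.
    by case: h0; exists a.
  exists (fun a => sval (ex a)) => [a b ab|a]; last exact: (svalP (ex a)).
  have : (lift ord0 (sval (ex a)) < lift ord0 (sval (ex b)))%N.
    by rewrite -(svalP (ex a)) -(svalP (ex b)); apply: hh.
  by rewrite /= /bump !leq0n !add1n ltnS.
have [f' hf' ef] := lft _ f hf hf0; have [g' hg' eg] := lft _ g hg hg0.
have := hY f' g' hf' hg'; congr (modX k (\det _)).
by apply/matrixP => a b; rewrite mxE [in RHS]mxE ef eg borderSS.
Qed.

Lemma minors_bordered r k : minors r k Y -> minors r.+1 k (c *m w + border).
Proof.
move=> /minors_border hY f g hf hg.
pose Yfg : 'M[{poly F}]_r.+1 := \matrix_(a, b) border (f a) (g b).
pose cf : 'cV[{poly F}]_r.+1 := \col_a c (f a) ord0.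
pose wg : 'rV[{poly F}]_r.+1 := \row_b w ord0 (g b).
have -> : \matrix_(a, b) (c *m w + border) (f a) (g b) = Yfg + cf *m wg.
  by apply/matrixP => a b; rewrite !mxE !big_ord1 !mxE addrC.
have [e ->] := det_rank_one Yfg cf wg.
apply: modX_sum => i _; apply: modX_sum => j _; apply: modXM.
have := hY (fun a => f (lift i a)) (fun b => g (lift j b)).
have mono (p : nat) (q : 'I_p.+1) (a b : 'I_p) : (a < b)%N -> (lift q a < lift q b)%N.
  by rewrite /= /bump => ab; case: (leqP q a) => h1; case: (leqP q b) => h2;
     rewrite ?add1n ?add0n ?ltnS //; [rewrite ltnNge (leq_trans h1 (ltnW ab)) in h2 | apply: ltnW].
move=> H; have {H} := H (fun a b ab => hf _ _ (mono _ _ _ _ ab)) (fun a b ab => hg _ _ (mono _ _ _ _ ab)).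
by congr (modX k (\det _)); apply/matrixP => a b; rewrite !mxE.
Qed.

(** Extend a selection in [Y] by the first row and column. The larger minor factors into a
    unitriangular matrix and an upper block matrix, so it is the corner times the given minor, and
    the corner is a unit modulo t^k. *)
Lemma minors_unborder r k : c ord0 ord0 = 1 -> (w ord0 ord0)`_0 != 0 ->
  minors r.+1 k (c *m w + border) -> minors r k Y.
Proof.
move=> c1 w0 hX f g hf hg.
pose ex p (h : 'I_r -> 'I_p) (a : 'I_r.+1) : 'I_p.+1 :=
  if unlift ord0 a is Some a' then lift ord0 (h a') else ord0.
have exS p h a : @ex p h (lift ord0 a) = lift ord0 (h a) by rewrite /ex liftK.
have ex0 p h : @ex p h ord0 = ord0 by rewrite /ex unlift_none.
have exi p (h : 'I_r -> 'I_p) : incr h -> incr (ex p h).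
  move=> hh a b; case: (unliftP ord0 a) => [a' ->|->]; case: (unliftP ord0 b) => [b' ->|->];
    rewrite ?exS ?ex0 //= /bump !leq0n !add1n !ltnS; exact: hh.
have := hX _ _ (exi _ _ hf) (exi _ _ hg).
pose L : 'M[{poly F}]_(1 + r) := block_mx 1%:M 0 (\col_a c (lift ord0 (f a)) ord0) 1%:M.
pose U : 'M[{poly F}]_(1 + r) :=
  block_mx (w ord0 ord0)%:M (\row_b w ord0 (lift ord0 (g b))) 0 (\matrix_(a, b) Y (f a) (g b)).
have -> : \matrix_(a, b) (c *m w + border) (ex m f a) (ex n g b) = L *m U.
  have l0 p (i : 'I_1) : lshift p i = ord0 by apply: val_inj; rewrite (ord1 i).
  rewrite mulmx_block !mul1mx !mul0mx !addr0.
  apply/(@matrixP _ (1 + r) (1 + r)) => a b; rewrite [in LHS]mxE.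
  case: (split_ordP (a : 'I_(1 + r))) => a' ->; case: (split_ordP (b : 'I_(1 + r))) => b' ->;
    rewrite ?block_mxEul ?block_mxEur ?block_mxEdl ?block_mxEdr ?l0 ?rshift1 ?exS ?ex0 mxE mxE big_ord1.
  - by rewrite border0l addr0 c1 mul1r mxE !ord1 eqxx.
  - by rewrite border0l addr0 c1 mul1r mxE.
  - by rewrite border0r addr0 !mxE big_ord1 !mxE !ord1 eqxx.
  - by rewrite borderSS !mxE big_ord1 !mxE.
have dL : \det L = 1 by rewrite det_lblock !det1 mulr1.
have dU : \det U = w ord0 ord0 * \det (\matrix_(a, b) Y (f a) (g b)).
  by rewrite det_ublock det_scalar1.
have -> : \det (L *m U) = w ord0 ord0 * \det (\matrix_(a, b) Y (f a) (g b)).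
  by rewrite det_mulmx dL dU mul1r.
exact: modX_cancel.
Qed.
End Bordered.
End Minors.

(** * Rational maps *)

Section Regular.
Context {F : closedFieldType}.

Section OneDenominator.
Context {N : nat} (a : {mpoly F[N]}).
Implicit Types (u v : @pt F N -> F).

(** Functions regular where [a] is nonzero, with a power of [a] as the only denominator. Nothing is
    asserted about the values where [a] vanishes. *)
Definition rfun u := exists (p : {mpoly F[N]}) e, forall x, a.@[x] != 0 -> u x = p.@[x] / a.@[x] ^+ e.

Lemma rfun_ext u v : (forall x, a.@[x] != 0 -> u x = v x) -> rfun u -> rfun v.
Proof. by move=> h [p [e H]]; exists p, e => x ax; rewrite -h // H. Qed.

Lemma rfun_poly p : rfun (fun x => p.@[x]).
Proof. by exists p, 0%N => x _; rewrite expr0 divr1. Qed.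

Lemma rfun_const c : rfun (fun=> c).
Proof. by apply: rfun_ext (rfun_poly c%:MP) => x _; rewrite mevalC. Qed.

Lemma rfun_coord i : rfun (fun x => x i).
Proof. by apply: rfun_ext (rfun_poly 'X_i) => x _; rewrite mevalXU. Qed.

Lemma rfun_add u v : rfun u -> rfun v -> rfun (fun x => u x + v x).
Proof.
move=> [p [e hp]] [q [f hq]]; exists (p * a ^+ f + q * a ^+ e), (e + f)%N => x ax.
by rewrite hp // hq // mevalD !mevalM !rmorphXn /= exprD; field; rewrite !expf_neq0.
Qed.

Lemma rfun_mul u v : rfun u -> rfun v -> rfun (fun x => u x * v x).
Proof.
move=> [p [e hp]] [q [f hq]]; exists (p * q), (e + f)%N => x ax.
by rewrite hp // hq // mevalM exprD; field; rewrite !expf_neq0.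
Qed.

Lemma rfun_opp u : rfun u -> rfun (fun x => - u x).
Proof.
move=> hu; apply: rfun_ext (rfun_mul (rfun_const (-1)) hu) => x _.
by rewrite mulN1r.
Qed.

Lemma rfun_inv : rfun (fun x => (a.@[x])^-1).
Proof. by exists 1, 1%N => x _; rewrite meval1 div1r expr1. Qed.

Lemma rfun_sum (I : Type) (s : seq I) (P : pred I) (u : I -> @pt F N -> F) :
  (forall i, P i -> rfun (u i)) -> rfun (fun x => \sum_(i <- s | P i) u i x).
Proof.
move=> h; elim: s => [|i s IH].
  by apply: rfun_ext (rfun_const 0) => x _; rewrite big_nil.
case Pi: (P i); last by apply: rfun_ext IH => x _; rewrite big_cons Pi.
by apply: rfun_ext (rfun_add (h i Pi) IH) => x _; rewrite big_cons Pi.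
Qed.

Lemma rfun_exp u e : rfun u -> rfun (fun x => u x ^+ e).
Proof.
move=> hu; elim: e => [|e IH]; first by apply: rfun_ext (rfun_const 1) => x _; rewrite expr0.
by apply: rfun_ext (rfun_mul hu IH) => x _; rewrite exprS.
Qed.

Lemma rfun_prod (I : Type) (s : seq I) (P : pred I) (u : I -> @pt F N -> F) :
  (forall i, P i -> rfun (u i)) -> rfun (fun x => \prod_(i <- s | P i) u i x).
Proof.
move=> h; elim: s => [|i s IH].
  by apply: rfun_ext (rfun_const 1) => x _; rewrite big_nil.
case Pi: (P i); last by apply: rfun_ext IH => x _; rewrite big_cons Pi.
by apply: rfun_ext (rfun_mul (h i Pi) IH) => x _; rewrite big_cons Pi.
Qed.

Lemma rfun_comp M (f : @pt F N -> @pt F M) (p : {mpoly F[M]}) :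
  (forall i, rfun (fun x => f x i)) -> rfun (fun x => p.@[f x]).
Proof.
move=> hf; apply: (@rfun_ext (fun x => \sum_(m <- msupp p) p@_m * \prod_i f x i ^+ m i)).
  by move=> x _; rewrite mevalE.
apply: rfun_sum => m _; apply: rfun_mul; first exact: rfun_const.
by apply: rfun_prod => i _; apply: rfun_exp.
Qed.

Lemma rfun_family M (f : @pt F N -> @pt F M) : (forall i, rfun (fun x => f x i)) ->
  exists (g : 'I_M -> {mpoly F[N]}) e, forall x, a.@[x] != 0 ->
    forall i, f x i = (g i).@[x] / (a ^+ e).@[x].
Proof.
move=> hf.
have ex i : {pe : {mpoly F[N]} * nat | forall x, a.@[x] != 0 -> f x i = pe.1.@[x] / a.@[x] ^+ pe.2}.
  by apply: constructive_indefinite_description; have [p [e h]] := hf i; exists (p, e).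
(* The sum of all the exponents bounds each of them and yields one common denominator. *)
pose e i := (sval (ex i)).2; pose E := (\sum_i e i)%N.
exists (fun i => (sval (ex i)).1 * a ^+ (E - e i)), E => x ax i.
rewrite (svalP (ex i)) // -/(e i) mevalM !rmorphXn /=.
have le : (e i <= E)%N by rewrite /E (bigD1 i) //= leq_addr.
rewrite -{2}(subnK le) exprD; field.
by rewrite !expf_neq0.
Qed.

Lemma rfun_regular_on M (V : @pt F N -> Prop) (f : @pt F N -> @pt F M) :
  (forall x, V x -> a.@[x] != 0) -> (forall i, rfun (fun x => f x i)) -> regular_on V f.
Proof.
move=> aV /rfun_family [g [e H]] x Vx; exists g, (a ^+ e).
split=> [|y Vy _ i]; first by rewrite rmorphXn expf_neq0 // aV.
by apply: H; apply: aV.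
Qed.

(** Adding the locus [a = 0] makes the preimage closed: numerators are multiplied by [a], which
    absorbs the points where [f] is unconstrained. *)
Lemma rfun_preim_closed M (f : @pt F N -> @pt F M) C :
  (forall i, rfun (fun x => f x i)) -> zclosed C ->
  zclosed (fun x => a.@[x] = 0 \/ C (f x)).
Proof.
move=> hf clC.
exists (fun q => exists2 p, vanish C p & forall x, a.@[x] = 0 \/ p.@[f x] = 0 <-> q.@[x] = 0) => x.
split=> [h q [p vp hq]|h].
  by apply/hq; case: h => [->|Cf]; [left | right; apply: vp].
have [a0|a0] := eqVneq a.@[x] 0; [by left | right].
apply/(Zset_vanish clC) => p vp.
have [q [e hq]] := rfun_comp p hf.
have H y : a.@[y] = 0 \/ p.@[f y] = 0 <-> (a * q).@[y] = 0.
  rewrite mevalM; split=> [[->|]|/eqP]; first by rewrite mul0r.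
    have [->|ay] := eqVneq a.@[y] 0; first by rewrite mul0r.
    rewrite hq // => /eqP; rewrite mulf_eq0 invr_eq0 expf_eq0 (negPf ay) andbF orbF => /eqP ->.
    by rewrite mulr0.
  rewrite mulf_eq0 => /orP [/eqP ->|/eqP q0]; first by left.
  have [->|ay] := eqVneq a.@[y] 0; first by left.
  by right; rewrite hq // q0 mul0r.
have [|/eqP|//] := proj2 (H x); last by rewrite (negPf a0).
by apply: h; exists p.
Qed.

Lemma irreducible_image M (f : @pt F N -> @pt F M) A :
  (forall x, A x -> a.@[x] != 0) -> (forall i, rfun (fun x => f x i)) -> irreducible A ->
  irreducible (fun y => exists2 x, A x & y = f x).
Proof.
move=> aA hf [[x Ax] h]; split; first by exists (f x), x.
move=> C1 C2 cl1 cl2 hs.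
have [|s|s] := h _ _ (rfun_preim_closed hf cl1) (rfun_preim_closed hf cl2).
- by move=> y Ay; have [|c|c] := hs (f y); [exists y | left; right | right; right].
- left => _ [y Ay ->]; have [e|//] := s y Ay; by move: (aA y Ay); rewrite e eqxx.
- right => _ [y Ay ->]; have [e|//] := s y Ay; by move: (aA y Ay); rewrite e eqxx.
Qed.
End OneDenominator.

Definition polymap N M (f : @pt F N -> @pt F M) := forall i, rfun 1 (fun x => f x i).

Lemma polymap_poly N M (f : @pt F N -> @pt F M) : polymap f ->
  exists g : 'I_M -> {mpoly F[N]}, forall x, f x = fun i => (g i).@[x].
Proof.
move=> /rfun_family [g [e H]]; exists g => x; apply: functional_extensionality => i.
by rewrite H ?meval1 ?oner_eq0 // expr1n meval1 divr1.
Qed.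

Lemma polymap_preim_closed N M (f : @pt F N -> @pt F M) C : polymap f -> zclosed C -> zclosed (fun x => C (f x)).
Proof.
move=> hf clC; apply: zclosed_ext (rfun_preim_closed hf clC) => x.
by split=> [[|//]|]; [rewrite meval1 => /eqP; rewrite oner_eq0 | right].
Qed.

Lemma polymap_irreducible N M (f : @pt F N -> @pt F M) A : polymap f -> irreducible A ->
  irreducible (fun y => exists2 x, A x & y = f x).
Proof. by move=> hf; apply: irreducible_image hf => x _; rewrite meval1 oner_eq0. Qed.

Lemma polymap_regular_on N M (V : @pt F N -> Prop) (f : @pt F N -> @pt F M) : polymap f -> regular_on V f.
Proof. by move=> hf; apply: rfun_regular_on hf => x _; rewrite meval1 oner_eq0. Qed.

Definition joinpt N M (x : @pt F N) (y : @pt F M) : @pt F (N + M) :=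
  fun a => match split a with inl i => x i | inr j => y j end.

Lemma joinptl N M (x : @pt F N) (y : @pt F M) : (fun i => joinpt x y (lshift M i)) = x.
Proof. by apply: functional_extensionality => i; rewrite /joinpt split_lshift. Qed.

Lemma joinptr N M (x : @pt F N) (y : @pt F M) : (fun j => joinpt x y (rshift N j)) = y.
Proof. by apply: functional_extensionality => i; rewrite /joinpt split_rshift. Qed.

Lemma joinptK N M (z : @pt F (N + M)) : joinpt (fun i => z (lshift M i)) (fun j => z (rshift N j)) = z.
Proof.
by apply: functional_extensionality => a; rewrite /joinpt; case: split_ordP => i ->.
Qed.

Lemma joinpt_polymapr N M (x : @pt F N) : polymap (fun y : @pt F M => joinpt x y).
Proof.
move=> a; rewrite /joinpt; case: (split a) => i; [exact: rfun_const | exact: rfun_coord].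
Qed.

Lemma joinpt_polymapl N M (y : @pt F M) : polymap (fun x : @pt F N => joinpt x y).
Proof.
move=> a; rewrite /joinpt; case: (split a) => i; [exact: rfun_coord | exact: rfun_const].
Qed.

(** For closed [C1] and [C2] covering the product, each slice over [x] lies in one of them by
    irreducibility of [B]. The sets of such [x] are closed, so irreducibility of [A] selects one for
    all slices. *)
Lemma irreducible_prodset N M (A : @pt F N -> Prop) (B : @pt F M -> Prop) :
  irreducible A -> irreducible B -> irreducible (prodset A B).
Proof.
move=> [[x Ax] hA] [[y By] hB]; split.
  by exists (joinpt x y); split; rewrite ?joinptl ?joinptr.
move=> C1 C2 cl1 cl2 hs.
pose X (C : @pt F (N + M) -> Prop) x := forall y : {y | B y}, C (joinpt x (sval y)).
have clX C : zclosed C -> zclosed (X C).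
  by move=> clC; apply: zclosedI_fam => z; apply: polymap_preim_closed clC; apply: joinpt_polymapl.
have [|s|s] := hA _ _ (clX _ cl1) (clX _ cl2).
- move=> x' Ax'.
  have [|s|s] := hB _ _ (polymap_preim_closed (joinpt_polymapr x') cl1) (polymap_preim_closed (joinpt_polymapr x') cl2).
  + by move=> y' By'; apply: hs; split; rewrite ?joinptl ?joinptr.
  + by left => -[y' By'] /=; apply: s.
  + by right => -[y' By'] /=; apply: s.
- by left => z [Az Bz]; have := s _ Az (exist _ _ Bz); rewrite /= joinptK.
- by right => z [Az Bz]; have := s _ Az (exist _ _ Bz); rewrite /= joinptK.
Qed.

Lemma zclosed_prodset N M (A : @pt F N -> Prop) (B : @pt F M -> Prop) :
  zclosed A -> zclosed B -> zclosed (prodset A B).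
Proof.
move=> clA clB; apply: zclosedI.
  by apply: (@polymap_preim_closed _ _ (fun z i => z (lshift M i))) clA => i; apply: rfun_coord.
by apply: (@polymap_preim_closed _ _ (fun z i => z (rshift N i))) clB => i; apply: rfun_coord.
Qed.

Section PolyValued.
Context {N : nat} (a : {mpoly F[N]}).
Implicit Types (u v : @pt F N -> {poly F}).

Definition rpfun u := forall l, rfun a (fun x => (u x)`_l).

Lemma rpfun_const c : rpfun (fun=> c).
Proof. by move=> l; apply: rfun_const. Qed.

Lemma rpfun_add u v : rpfun u -> rpfun v -> rpfun (fun x => u x + v x).
Proof. by move=> hu hv l; apply: rfun_ext (rfun_add (hu l) (hv l)) => x _; rewrite coefD. Qed.

Lemma rpfun_opp u : rpfun u -> rpfun (fun x => - u x).
Proof. by move=> hu l; apply: rfun_ext (rfun_opp (hu l)) => x _; rewrite coefN. Qed.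

Lemma rpfun_mul u v : rpfun u -> rpfun v -> rpfun (fun x => u x * v x).
Proof.
move=> hu hv l; apply: (@rfun_ext _ _ (fun x => \sum_(i < l.+1) (u x)`_i * (v x)`_(l - i))).
  by move=> x _; rewrite coefM.
by apply: rfun_sum => i _; apply: rfun_mul.
Qed.

Lemma rpfun_exp u e : rpfun u -> rpfun (fun x => u x ^+ e).
Proof.
move=> hu; elim: e => [|e IH] l.
  by apply: rfun_ext (rpfun_const 1 l) => x _; rewrite expr0.
by apply: rfun_ext (rpfun_mul hu IH l) => x _; rewrite exprS.
Qed.

Lemma rpfun_polyC (u : @pt F N -> F) : rfun a u -> rpfun (fun x => (u x)%:P).
Proof.
move=> hu l; case: (eqVneq l 0%N) => [->|l0].
  by apply: rfun_ext hu => x _; rewrite coefC.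
by apply: rfun_ext (rfun_const a 0) => x _; rewrite coefC (negPf l0).
Qed.

Lemma rpfun_sum (I : Type) (s : seq I) (P : pred I) (u : I -> @pt F N -> {poly F}) :
  (forall i, P i -> rpfun (u i)) -> rpfun (fun x => \sum_(i <- s | P i) u i x).
Proof.
move=> h l; apply: (@rfun_ext _ _ (fun x => \sum_(i <- s | P i) (u i x)`_l)).
  by move=> x _; rewrite coef_sum.
by apply: rfun_sum => i Pi; apply: h.
Qed.

Lemma rpfun_tpoly k (c : @pt F N -> 'I_k -> F) :
  (forall l, rfun a (fun x => c x l)) -> rpfun (fun x => tpoly (c x)).
Proof.
move=> h; apply: rpfun_sum => l _; apply: rpfun_mul; last exact: rpfun_const.
exact: rpfun_polyC.
Qed.
End PolyValued.
End Regular.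

(** * The Schur complement parametrization *)

Section Coordinates.
Context {F : closedFieldType}.

Definition unmx {p q} (a : 'I_(p * q)) : 'I_p * 'I_q := enum_val (cast_ord (esym (mxvec_cast p q)) a).

Lemma unmxK p q (i : 'I_p) (j : 'I_q) : unmx (mxvec_index i j) = (i, j).
Proof. by rewrite /unmx /mxvec_index cast_ordK enum_rankK. Qed.

Lemma mxvec_index_unmx p q (a : 'I_(p * q)) : mxvec_index (unmx a).1 (unmx a).2 = a.
Proof. by case/mxvec_indexP: a => i j; rewrite unmxK. Qed.

Definition unidx {m n k} (a : 'I_(m * n * k)) : 'I_m * 'I_n * 'I_k := (unmx (unmx a).1, (unmx a).2).

Lemma unidxK m n k (i : 'I_m) (j : 'I_n) (l : 'I_k) : unidx (idx i j l) = (i, j, l).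
Proof. by rewrite /unidx /idx !unmxK. Qed.

Lemma idx_surj m n k (a : 'I_(m * n * k)) : exists i j l, a = idx i j l.
Proof.
exists (unidx a).1.1, (unidx a).1.2, (unidx a).2.
by rewrite /idx /unidx /= !mxvec_index_unmx.
Qed.

Lemma pt_eq m n k (x y : @pt F (m * n * k)) :
  (forall i j l, x (idx i j l) = y (idx i j l)) -> x = y.
Proof. by move=> h; apply: functional_extensionality => a; have [i [j [l ->]]] := idx_surj a. Qed.

Definition pack {m n k} (X : 'I_m -> 'I_n -> 'I_k -> F) : @pt F (m * n * k) :=
  fun a => X (unidx a).1.1 (unidx a).1.2 (unidx a).2.

Lemma packE m n k (X : 'I_m -> 'I_n -> 'I_k -> F) i j l : pack X (idx i j l) = X i j l.
Proof. by rewrite /pack unidxK. Qed.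

Definition matM {m n k} (x : @pt F (m * n * k)) : 'M[{poly F}]_(m, n) :=
  \matrix_(i, j) tpoly (fun l => x (idx i j l)).

Definition packM {m n} k (B : 'M[{poly F}]_(m, n)) : @pt F (m * n * k) := pack (fun i j l => (B i j)`_l).
Arguments packM {m n} k B _.

Lemma matM_packM m n k (B : 'M[{poly F}]_(m, n)) i j : congX k (matM (packM k B) i j) (B i j).
Proof.
rewrite mxE; have -> : (fun l : 'I_k => packM k B (idx i j l)) = (fun l : 'I_k => (B i j)`_l).
  by apply: functional_extensionality => l; rewrite /packM packE.
exact: congX_tpoly.
Qed.

Lemma packM_matM m n k (x : @pt F (m * n * k)) : packM k (matM x) = x.
Proof. by apply: pt_eq => i j l; rewrite /packM packE mxE coef_tpoly. Qed.

Lemma coef_matM m n k (x : @pt F (m * n * k)) i j (l : 'I_k) : (matM x i j)`_l = x (idx i j l).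
Proof. by rewrite mxE coef_tpoly. Qed.

Lemma packM_congX m n k (B B' : 'M[{poly F}]_(m, n)) :
  (forall i j, congX k (B i j) (B' i j)) -> packM k B = packM k B'.
Proof. by move=> h; apply: pt_eq => i j l; rewrite /packM !packE; apply: congX_coef (h i j) _. Qed.

Lemma Zset_ideal_gen N (G : {mpoly F[N]} -> Prop) x : Zset (ideal_gen G) x <-> Zset G x.
Proof.
split=> h p.
  move=> Gp; apply: h; exists 1%N, (fun=> 1), (fun=> p).
  by split=> //; rewrite big_ord1 mul1r.
move=> [s [c [g [hg ->]]]]; rewrite rmorph_sum big1 // => i _.
by rewrite rmorphM /= (h (g i)) ?mulr0.
Qed.

Lemma zclosed_Zvar m n r k : zclosed (@Zvar F m n r k).
Proof. exact: zclosed_Zset. Qed.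

(** Evaluation at a point commutes with determinants and coefficients, so the equations become
    minors of a matrix over [{poly F}] taken modulo t^k. *)
Lemma Zvar_minors m n r k (x : @pt F (m * n * k)) : Zvar m n r k x <-> minors r k (matM x).
Proof.
rewrite /Zvar /Iideal Zset_ideal_gen.
have E (f : 'I_r -> 'I_m) (g : 'I_r -> 'I_n) l :
    ((\det (\matrix_(a, b) Xt (F := F) m n k (f a) (g b)) : {poly {mpoly F[m * n * k]}})`_l).@[x] =
    (\det (\matrix_(a, b) matM x (f a) (g b)) : {poly F})`_l.
  rewrite -[LHS]/(meval x _) -coef_map /= -det_map_mx; congr (polyseq (\det _))`_l.
  apply/matrixP => a b; rewrite !mxE rmorph_sum; apply: eq_bigr => i _.
  by rewrite rmorphM /= map_polyC map_polyXn /= mevalXU.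
split=> [h f g hf hg l lk|h p [f [g [l [hf [hg ->]]]]]]; last by rewrite E; apply: h.
by rewrite -E; apply: h; exists f, g, (Ordinal lk).
Qed.

Lemma x0var_meval m n k (i : 'I_m) (j : 'I_n) (x : @pt F (m * n * k.+1)) :
  (x0var i j).@[x] = x (idx i j ord0).
Proof.
by rewrite /x0var (big_pred1 ord0) /xvar ?mevalXU.
Qed.
End Coordinates.
Arguments packM {F m n} k B _.

Lemma matM_rpfun (F : closedFieldType) (N : nat) (a : {mpoly F[N]}) p q k
    (y : @pt F N -> @pt F (p * q * k)) i j :
  (forall b, rfun a (fun x => y x b)) -> rpfun a (fun x => matM (y x) i j).
Proof.
move=> h l; apply: (@rfun_ext _ _ _ (fun x => (tpoly (fun l => y x (idx i j l)))`_l)).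
  by move=> x _; rewrite mxE.
by apply: rpfun_tpoly => l'; apply: h.
Qed.

Section Bijection.
Context {F : closedFieldType} (m n k : nat).
Local Notation m' := m.+1.
Local Notation n' := n.+1.
Local Notation k' := k.+1.
Local Notation ne := (m' + n' - 1)%N.
Local Notation Npt := (@pt F (m' * n' * k')).
Local Notation ypt := (@pt F (m * n * k')).
Local Notation upt := (@pt F (ne * k')).
Local Notation zpt := (@pt F (m * n * k' + ne * k')).

(** The frame coordinates are the entries of the first row, then the column entries below the
    leading 1. *)
Lemma frame_card : (n' + m = ne)%N.
Proof. by rewrite subn1 !addSn /= addnS addnC. Qed.

Definition rowi (j : 'I_n') : 'I_ne := cast_ord frame_card (lshift m j).
Definition coli (i : 'I_m) : 'I_ne := cast_ord frame_card (rshift n' i).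

Definition frame_row (u : upt) : 'rV[{poly F}]_n' := \row_j tpoly (fun l => u (mxvec_index (rowi j) l)).
Definition frame_col (u : upt) : 'cV[{poly F}]_m' :=
  \col_i if unlift ord0 i is Some i' then tpoly (fun l => u (mxvec_index (coli i') l)) else 1.

Definition Bmat (z : zpt) : 'M[{poly F}]_(m', n') :=
  frame_col (fun j => z (rshift _ j)) *m frame_row (fun j => z (rshift _ j)) + border (matM (fun i => z (lshift _ i))).

Definition Psi (z : zpt) : Npt := packM k' (Bmat z).

Definition xh : {mpoly F[m' * n' * k']} := x0var ord0 ord0.
(** The frame coordinate holding the constant term of the corner entry; its nonvanishing is the
    domain of the inverse map. *)
Definition uh : 'I_(m * n * k' + ne * k') := rshift _ (mxvec_index (rowi ord0) ord0).

(** With [a] the constant term of the corner entry, that entry is [a *: (1 - ratio x)] and [ratio x]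
    has no constant term. The truncated geometric series in [pinv] therefore inverts it modulo
    t^k. *)
Definition ratio (x : Npt) : {poly F} := - ((x (idx ord0 ord0 ord0))^-1 *: (matM x ord0 ord0 - (x (idx ord0 ord0 ord0))%:P)).
Definition pinv (x : Npt) : {poly F} := (x (idx ord0 ord0 ord0))^-1 *: \sum_(s < k') ratio x ^+ s.

Definition pcol (x : Npt) (i : 'I_m) : {poly F} := matM x (lift ord0 i) ord0 * pinv x.
Definition schur (x : Npt) : ypt :=
  packM k' (\matrix_(i, j) (matM x (lift ord0 i) (lift ord0 j) - pcol x i * matM x ord0 (lift ord0 j))).
Definition frame (x : Npt) : upt := fun a =>
  match split (cast_ord (esym frame_card) (unmx a).1) with
  | inl j => (matM x ord0 j)`_(unmx a).2
  | inr i => (pcol x i)`_(unmx a).2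
  end.
Definition Phi (x : Npt) : zpt := joinpt (schur x) (frame x).

Lemma frame_rowE x j (l : 'I_k') : frame x (mxvec_index (rowi j) l) = (matM x ord0 j)`_l.
Proof. by rewrite /frame unmxK /= /rowi cast_ordK split_lshift. Qed.

Lemma frame_colE x i (l : 'I_k') : frame x (mxvec_index (coli i) l) = (pcol x i)`_l.
Proof. by rewrite /frame unmxK /= /coli cast_ordK split_rshift. Qed.

Lemma upt_eq (u v : upt) : (forall j l, u (mxvec_index (rowi j) l) = v (mxvec_index (rowi j) l)) ->
  (forall i l, u (mxvec_index (coli i) l) = v (mxvec_index (coli i) l)) -> u = v.
Proof.
move=> h1 h2; apply: functional_extensionality => a.
rewrite -[a]mxvec_index_unmx -[(unmx a).1](cast_ordKV frame_card).
by case: (split_ordP (cast_ord (esym frame_card) (unmx a).1)) => j ->; [apply: h1 | apply: h2].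
Qed.

Lemma pinvP x : x (idx ord0 ord0 ord0) != 0 -> congX k' (matM x ord0 ord0 * pinv x) 1.
Proof.
set a := x _ => a0; rewrite /pinv -/a.
have -> : matM x ord0 ord0 = a *: (1 - ratio x).
  rewrite /ratio -/a opprK scalerDr scalerA mulfV // scale1r.
  by rewrite -[a *: 1]mul_polyC mulr1 addrC subrK.
rewrite -scalerAl -scalerAr scalerA mulfV // scale1r -[X in X * _]opprB mulNr -subrX1 opprB.
rewrite /congX addrC addrA addNr add0r; apply: modXN; apply: modX_exp.
rewrite /ratio -/a coefN coefZ coefB coefC /= (coef_matM _ _ _ ord0) -/a subrr mulr0 oppr0 //.
Qed.

Lemma Bmat0 z j : Bmat z ord0 j = tpoly (fun l => z (rshift _ (mxvec_index (rowi j) l))).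
Proof. by rewrite mxE border0l addr0 !mxE big_ord1 !mxE unlift_none mul1r. Qed.

Lemma BmatS0 z i : Bmat z (lift ord0 i) ord0 =
  tpoly (fun l => z (rshift _ (mxvec_index (coli i) l))) * tpoly (fun l => z (rshift _ (mxvec_index (rowi ord0) l))).
Proof. by rewrite mxE border0r addr0 !mxE big_ord1 !mxE liftK. Qed.

Lemma BmatSS z i j : Bmat z (lift ord0 i) (lift ord0 j) =
  tpoly (fun l => z (rshift _ (mxvec_index (coli i) l))) *
  tpoly (fun l => z (rshift _ (mxvec_index (rowi (lift ord0 j)) l))) + tpoly (fun l => z (lshift _ (idx i j l))).
Proof. by rewrite mxE borderSS !mxE big_ord1 !mxE liftK. Qed.

Lemma Psi_head z : Psi z (idx ord0 ord0 ord0) = z uh.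
Proof. by rewrite /Psi /packM packE Bmat0 (coef_tpoly _ ord0). Qed.

Lemma xh_meval x : xh.@[x] = x (idx ord0 ord0 ord0).
Proof. exact: x0var_meval. Qed.

Lemma tpoly_congX (c : 'I_k' -> F) (p : {poly F}) : (forall l, c l = p`_l) -> congX k' (tpoly c) p.
Proof.
move=> h; have -> : c = (fun l : 'I_k' => p`_l) by apply: functional_extensionality.
exact: congX_tpoly.
Qed.

Lemma PhiK x : x (idx ord0 ord0 ord0) != 0 -> Psi (Phi x) = x.
Proof.
move=> a0; rewrite -[RHS]packM_matM; apply: packM_congX => i j.
have rj j' : congX k' (tpoly (fun l => Phi x (rshift (m * n * k') (mxvec_index (rowi j') l)))) (matM x ord0 j').
  by apply: tpoly_congX => l; rewrite /Phi /joinpt split_rshift frame_rowE.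
have ci i' : congX k' (tpoly (fun l => Phi x (rshift (m * n * k') (mxvec_index (coli i') l)))) (pcol x i').
  by apply: tpoly_congX => l; rewrite /Phi /joinpt split_rshift frame_colE.
have yy i' j' : congX k' (tpoly (fun l => Phi x (lshift (ne * k') (idx i' j' l))))
    (matM x (lift ord0 i') (lift ord0 j') - pcol x i' * matM x ord0 (lift ord0 j')).
  by apply: tpoly_congX => l; rewrite /Phi /joinpt split_lshift /schur /packM packE mxE.
case: (unliftP ord0 i) => [i' ->|->]; last by rewrite Bmat0.
case: (unliftP ord0 j) => [j' ->|->].
  rewrite BmatSS.
  have -> : matM x (lift ord0 i') (lift ord0 j') = pcol x i' * matM x ord0 (lift ord0 j') +
    (matM x (lift ord0 i') (lift ord0 j') - pcol x i' * matM x ord0 (lift ord0 j')) by ring.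
  by apply: congXD => //; apply: congXM.
rewrite BmatS0; apply: (@congX_trans _ _ _ _ _ (congXM (ci i') (rj ord0))).
rewrite /pcol -mulrA -[X in congX _ _ X]mulr1; apply: congXM; first exact: congX_refl.
by rewrite mulrC; apply: pinvP.
Qed.

Lemma PsiK z : z uh != 0 -> Phi (Psi z) = z.
Proof.
move=> z0; set x := Psi z.
have a0 : x (idx ord0 ord0 ord0) != 0 by rewrite /x Psi_head.
have Mx i j : congX k' (matM x i j) (Bmat z i j) by apply: matM_packM.
have M0 j : congX k' (matM x ord0 j) (tpoly (fun l => z (rshift _ (mxvec_index (rowi j) l)))).
  by rewrite -Bmat0.
have pc i : congX k' (pcol x i) (tpoly (fun l => z (rshift _ (mxvec_index (coli i) l)))).
  rewrite /pcol; have := Mx (lift ord0 i) ord0; rewrite BmatS0 => h.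
  apply: (@congX_trans _ _ _ _ _ (congXM h (@congX_refl _ _ _))); rewrite -mulrA -[X in congX _ _ X]mulr1.
  apply: congXM; first exact: congX_refl.
  apply: congX_trans (pinvP a0); apply: congXM; last exact: congX_refl.
  by apply: congX_sym.
rewrite -[RHS]joinptK /Phi; congr joinpt; last first.
  apply: upt_eq => [j l|i l].
    by rewrite frame_rowE (congX_coef (M0 j)) // coef_tpoly.
  by rewrite frame_colE (congX_coef (pc i)) // coef_tpoly.
apply: pt_eq => i j l; rewrite /schur /packM packE mxE.
rewrite -(coef_tpoly (fun l => z (lshift _ (idx i j l)))); apply: congX_coef (ltn_ord l).
have := Mx (lift ord0 i) (lift ord0 j); rewrite BmatSS => h.
apply: (@congX_trans _ _ _ _ _ (congXD h (congXN (congXM (pc i) (M0 _))))).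
by rewrite addrAC subrr add0r; apply: congX_refl.
Qed.

(** This direction does not divide by the corner, so it holds on the whole product; that is why
    closures of images stay inside the determinantal variety. *)
Lemma Psi_Zvar r z : Zvar m n r k' (fun i => z (lshift _ i)) -> Zvar m' n' r.+1 k' (Psi z).
Proof.
move=> /Zvar_minors h; apply/Zvar_minors.
apply: (@minors_congX _ _ _ _ _ (Bmat z)); first by move=> i j; apply/congX_sym/matM_packM.
exact: minors_bordered.
Qed.

Lemma schur_Zvar r x : x (idx ord0 ord0 ord0) != 0 -> Zvar m' n' r.+1 k' x -> Zvar m n r k' (schur x).
Proof.
move=> a0 /Zvar_minors h; apply/Zvar_minors.
have e := PhiK a0.
have -> : schur x = (fun i => Phi x (lshift _ i)) by rewrite joinptl.
have : minors r.+1 k' (Bmat (Phi x)).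
  apply: minors_congX h => i j; rewrite -{1}e; exact: matM_packM.
apply: minors_unborder; first by rewrite mxE unlift_none.
rewrite mxE (coef_tpoly _ ord0) /Phi /joinpt split_rshift frame_rowE coef_matM //.
Qed.

Lemma Psi_polymap : polymap Psi.
Proof.
move=> a; have [i [j [l ->]]] := idx_surj a.
apply: (@rfun_ext _ _ _ (fun z => (Bmat z i j)`_l)).
  by move=> z _; rewrite /Psi /packM packE.
move: (nat_of_ord l) => {}l; move: l.
suff : rpfun 1 (fun z => Bmat z i j) by [].
have tp (h : 'I_k' -> 'I_(m * n * k' + ne * k')) : rpfun 1 (fun z : zpt => tpoly (fun l => z (h l))).
  by apply: rpfun_tpoly => l; apply: rfun_coord.
have ext (u v : zpt -> {poly F}) : (forall z, u z = v z) -> rpfun 1 u -> rpfun 1 v.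
  by move=> e hu l; apply: rfun_ext (hu l) => z _; rewrite e.
case: (unliftP ord0 i) => [i' ->|->]; last by apply: ext (tp _) => z; rewrite Bmat0.
case: (unliftP ord0 j) => [j' ->|->].
  by apply: ext (rpfun_add (rpfun_mul (tp _) (tp _)) (tp _)) => z; rewrite BmatSS.
by apply: ext (rpfun_mul (tp _) (tp _)) => z; rewrite BmatS0.
Qed.

Lemma pcol_rpfun i : rpfun xh (fun x => pcol x i).
Proof.
have M i' j' : rpfun xh (fun x : Npt => matM x i' j').
  by apply: (@matM_rpfun _ _ _ _ _ _ id) => b; apply: rfun_coord.
have inv : rpfun xh (fun x : Npt => ((x (idx ord0 ord0 ord0))^-1)%:P).
  by apply: rpfun_polyC; apply: rfun_ext (rfun_inv xh) => x _; rewrite xh_meval.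
have ext (u v : Npt -> {poly F}) : (forall z, u z = v z) -> rpfun xh u -> rpfun xh v.
  by move=> e hu l; apply: rfun_ext (hu l) => z _; rewrite e.
have hr : rpfun xh ratio.
  apply: (ext (fun x => - (((x (idx ord0 ord0 ord0))^-1)%:P * (matM x ord0 ord0 - (x (idx ord0 ord0 ord0))%:P)))).
    by move=> x; rewrite mul_polyC.
  apply: rpfun_opp; apply: rpfun_mul => //; apply: rpfun_add => //; apply: rpfun_opp.
  by apply: rpfun_polyC; apply: rfun_coord.
apply: rpfun_mul => //.
apply: (ext (fun x => ((x (idx ord0 ord0 ord0))^-1)%:P * \sum_(s < k') ratio x ^+ s)).
  by move=> x; rewrite mul_polyC.
by apply: rpfun_mul => //; apply: rpfun_sum => s _; apply: rpfun_exp.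
Qed.

Lemma schur_rfun i : rfun xh (fun x => schur x i).
Proof.
have M i' j' : rpfun xh (fun x : Npt => matM x i' j').
  by apply: (@matM_rpfun _ _ _ _ _ _ id) => b; apply: rfun_coord.
have [i' [j' [l ->]]] := idx_surj i.
apply: (@rfun_ext _ _ _ (fun x => (matM x (lift ord0 i') (lift ord0 j') - pcol x i' * matM x ord0 (lift ord0 j'))`_l)).
  by move=> x _; rewrite /schur /packM packE; congr (polyseq _)`_l; rewrite [RHS]mxE.
move: (nat_of_ord l) => {}l; move: l.
apply: (rpfun_add (M _ _)); apply: rpfun_opp; apply: rpfun_mul => //; exact: pcol_rpfun.
Qed.

Lemma Phi_rfun i : rfun xh (fun x => Phi x i).
Proof.
have M i' j' : rpfun xh (fun x : Npt => matM x i' j').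
  by apply: (@matM_rpfun _ _ _ _ _ _ id) => b; apply: rfun_coord.
rewrite /Phi /joinpt; case: (split i) => a; first exact: schur_rfun.
rewrite /frame; case: (split _) => b; first exact: M.
exact: pcol_rpfun.
Qed.
End Bijection.

(** * Components under elementary operations *)

Section Components.
Context {F : closedFieldType}.
Implicit Types (N : nat).

Lemma irreducible_point N (x : @pt F N) : irreducible (fun y => y = x).
Proof.
split; first by exists x.
by move=> C1 C2 _ _ hs; case: (hs x erefl) => c; [left|right] => y ->.
Qed.

(** Among the irreducible closed sets between [D] and [A], one whose basis is largest is maximal,
    since a strictly larger one would have a larger basis. Largest is expressed as least
    complement. *)
Lemma irr_comp_exists N (A D : @pt F N -> Prop) : zclosed A -> zclosed D -> irreducible D -> sincl D A ->
  exists2 C, irr_comp A C & sincl D C.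
Proof.
move=> clA clD irD DA.
pose Q (ES : (@pt F N -> Prop) * {set 'I_N}) :=
  [/\ zclosed ES.1, irreducible ES.1, sincl D ES.1, sincl ES.1 A & basisA ES.1 ES.2].
have basis (E : @pt F N -> Prop) : irreducible E -> exists S, basisA E S.
  by move=> [neE _]; have [S _ bS] := basisA_extend (indepA_set0 neE); exists S.
have [|[C S] [[clC irC DC CA bS] Cmin]] := @prop_argmin _ Q (fun ES => #|~: ES.2|).
  by have [S bS] := basis D irD; exists (D, S); split=> //= x.
exists C => //; split=> //; split=> //; split=> // E clE irE CE EA.
apply: NNPP => nEC; have [T bT] := basis E irE.
have lt := strict_subset_indep irE CE clC nEC bT (proj1 bS).
have := Cmin (E, T); rewrite /= leqNgt => H.
have /negP : ~~ (#|~: T| < #|~: S|)%N by apply: H; split=> //= y /DC /CE.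
apply; have hT := max_card (mem T); rewrite (cardsCs (~: T)) (cardsCs (~: S)) !setCK.
by apply: ltn_sub2l => //; apply: leq_trans lt hT.
Qed.

Lemma irr_comp_point N (A : @pt F N -> Prop) x : zclosed A -> A x -> exists2 C, irr_comp A C & C x.
Proof.
move=> clA Ax.
have [|C hC DC] := @irr_comp_exists _ A (zclosure (fun y => y = x)) clA (zclosure_closed _)
  (irreducible_zclosure (irreducible_point x)).
  by apply: zclosure_min => // y ->.
by exists C => //; apply: DC; apply: sub_zclosure.
Qed.

Lemma irr_comp_ext N (A C D : @pt F N -> Prop) : seqv C D -> irr_comp A C -> irr_comp A D.
Proof.
move=> e [clC [irC [CA mx]]]; split; first exact: zclosed_ext clC.
split; first exact: irreducible_ext irC.
split; first by move=> x /e /CA.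
by move=> E clE irE DE EA x Ex; apply/e; apply: (mx E) Ex => // y /e /DE.
Qed.

Lemma minprime_irr_comp N (I P : {mpoly F[N]} -> Prop) :
  minprime_over I P -> irr_comp (Zset I) (Zset P).
Proof.
move=> [hP [IP mn]]; split; first exact: zclosed_Zset.
split; first exact: prime_Zset_irreducible.
split; first by move=> x hx p /IP; apply: hx.
move=> D clD irD PD DI x Dx p Pp.
apply: (mn (vanish D) (irreducible_vanish_prime irD) _ _ _ Pp x Dx).
  by move=> q Iq y /DI; apply.
by move=> q hq; apply/(vanish_Zset _ hP) => y /PD; apply: hq.
Qed.

Lemma irr_comp_minprime N (I : {mpoly F[N]} -> Prop) C :
  irr_comp (Zset I) C -> minprime_over I (vanish C).
Proof.
move=> [clC [irC [CI mx]]]; split; first exact: irreducible_vanish_prime.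
split; first by move=> p Ip x /CI; apply.
move=> Q hQ IQ QC p hp; apply/(vanish_Zset _ hQ) => x Qx.
apply: hp; apply: (mx (Zset Q)) Qx.
- exact: zclosed_Zset.
- exact: prime_Zset_irreducible.
- by move=> y Cy q /QC; apply.
- by move=> y Qy q /IQ; apply: Qy.
Qed.

(** The closure of the image of C x A^1 under the family is irreducible, lies in [A], and contains
    [C] through the parameter 0; maximality forces it back into [C]. *)
Lemma irr_comp_stable N (A C : @pt F N -> Prop) (L : F -> @pt F N -> @pt F N) :
    polymap (fun z : @pt F (N + 1) => L (z (rshift N ord0)) (fun i => z (lshift 1 i))) ->
    (forall x, L 0 x = x) -> (forall c x, A x -> A (L c x)) -> zclosed A ->
    irr_comp A C -> forall c x, C x -> C (L c x).
Proof.
move=> hL L0 LA clA [clC [irC [CA mx]]] c x Cx.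
pose D y := exists2 z, prodset C (@affsp F 1) z & y = L (z (rshift N ord0)) (fun i => z (lshift 1 i)).
have inD c' x' : C x' -> D (L c' x').
  move=> Cx'; exists (joinpt x' (fun=> c')); first by split; rewrite ?joinptl.
  by rewrite joinptl /joinpt split_rshift.
apply: (mx (zclosure D)).
- exact: zclosure_closed.
- apply: irreducible_zclosure; apply: (polymap_irreducible hL).
  by apply: irreducible_prodset => //; apply: irreducible_affsp.
- by move=> y Cy; apply: sub_zclosure; rewrite -(L0 y); apply: inD.
- by apply: zclosure_min => // _ [z [Cz _] ->]; apply: LA; apply: CA.
by apply: sub_zclosure; apply: inD.
Qed.
End Components.

Definition adjacent (i j : nat) := i = j.+1 \/ j = i.+1.

Lemma ord_adjacent_ind m (Q : 'I_m -> Prop) :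
  (forall i j : 'I_m, adjacent i j -> Q i -> Q j) -> forall i j, Q i -> Q j.
Proof.
move=> h.
have H d : forall i j : 'I_m, j = (i + d)%N :> nat -> (Q i -> Q j) /\ (Q j -> Q i).
  elim: d => [|d IH] i j e.
    by have -> : j = i by apply: val_inj; rewrite /= e addn0.
  have lt : (i + d < m)%N by have := ltn_ord j; rewrite e addnS; apply: ltn_trans.
  have [h1 h2] := IH i (Ordinal lt) erefl.
  by split=> [/h1|] Qi; [apply: h Qi; right | apply: h2; apply: h Qi; left]; rewrite /= e addnS.
move=> i j; case: (leqP i j) => ij.
  by apply: (proj1 (H (j - i)%N i j _)); rewrite subnKC.
by apply: (proj2 (H (i - j)%N j i _)); rewrite subnKC // ltnW.
Qed.

Section ElementaryOperations.
Context {F : closedFieldType}.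

Definition rowop m n (i i' : 'I_m) (c : F) (X : 'M[{poly F}]_(m, n)) : 'M[{poly F}]_(m, n) :=
  \matrix_(a, b) (X a b + (if a == i then c *: X i' b else 0)).

(* For adjacent rows, replacing the row [i] by the row [i'] in an increasing selection gives either an increasing
   selection or a repeated row, so no sorting of row selections is needed. *)
Lemma minors_rowop m n r k (i i' : 'I_m) c (X : 'M[{poly F}]_(m, n)) :
  adjacent i i' -> minors r k X -> minors r k (rowop i i' c X).
Proof.
move=> adj hX f g hf hg.
have [[a0 fa0]|nf] := classic (exists a, f a = i); last first.
  have := hX f g hf hg; congr (modX k (\det _)); apply/matrixP => a b; rewrite !mxE.
  by case: eqP => [e|]; rewrite ?addr0 //; case: nf; exists a.
have injf a b : (f a == f b) = (a == b).
  apply/eqP/eqP => [e|->//]; apply: val_inj; apply/eqP; rewrite eqn_leq.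
  by apply/andP; split; rewrite leqNgt; apply/negP => /hf; rewrite e ltnn.
pose f' a := if a == a0 then i' else f a.
pose X0 : 'M[{poly F}]_r := \matrix_(a, b) X (f a) (g b).
pose X1 : 'M[{poly F}]_r := \matrix_(a, b) X (f' a) (g b).
rewrite (determinant_multilinear (B := X0) (C := X1) (i0 := a0) (b := 1) (c := c%:P)).
- rewrite mul1r; apply: modXD; first exact: hX.
  apply: modXM; have [[a1 fa1]|nf'] := classic (exists a, f a = i').
    have ne : a0 != a1.
      by apply/eqP => e; move: adj; rewrite -fa0 -fa1 e /adjacent; lia.
    rewrite (determinant_alternate ne); first exact: modX0.
    by move=> b; rewrite !mxE /f' eqxx eq_sym (negPf ne) fa1.
  apply: hX => // a b ab.
  have fab := hf a b ab.
  have n1 d : (f d != i' :> nat).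
    by apply/eqP => e; apply: nf'; exists d; apply: val_inj.
  rewrite /f'; move: (n1 a) (n1 b) => na nb.
  case: (eqVneq a a0) => [ea|_]; case: (eqVneq b a0) => [eb|_] //.
  + by move: ab; rewrite ea eb ltnn.
  + move: fab nb; rewrite ea fa0; case: adj => e; lia.
  + move: fab na; rewrite eb fa0; case: adj => e; lia.
- by apply/rowP => b; rewrite !mxE fa0 eqxx /f' eqxx mul1r mul_polyC.
- by apply/matrixP => a b; rewrite !mxE -fa0 injf eq_sym (negPf (neq_lift _ _)) addr0.
- by apply/matrixP => a b; rewrite !mxE -fa0 injf /f' eq_sym (negPf (neq_lift _ _)) addr0.
Qed.

Lemma minors_tr m n r k (X : 'M[{poly F}]_(m, n)) : minors r k X -> minors r k X^T.
Proof.
move=> h f g hf hg; rewrite -det_tr; have := h g f hg hf.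
by congr (modX k (\det _)); apply/matrixP => a b; rewrite !mxE.
Qed.

Context {m n r k : nat}.
Local Notation Z := (@Zvar F m n r k.+1).

Lemma irr_comp_op (C : @pt F (m * n * k.+1) -> Prop) (op : F -> 'M[{poly F}]_(m, n) -> 'M[{poly F}]_(m, n)) :
  (forall a b (N : nat) (u : @pt F N -> F) (X : @pt F N -> 'M[{poly F}]_(m, n)), rfun 1 u ->
    (forall a b, rpfun 1 (fun x => X x a b)) -> rpfun 1 (fun x => op (u x) (X x) a b)) ->
  (forall X, op 0 X = X) -> (forall c X, minors r k.+1 X -> minors r k.+1 (op c X)) ->
  irr_comp Z C -> forall c x, C x -> C (packM k.+1 (op c (matM x))).
Proof.
move=> hop op0 opm hC.
apply: (@irr_comp_stable _ _ Z C (fun c x => packM k.+1 (op c (matM x)))) => //.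
- move=> a; have [i [j [l ->]]] := idx_surj a.
  apply: rfun_ext (hop i j _ _ (fun z : @pt F (m * n * k.+1 + 1) => matM (fun i => z (lshift 1 i))) _ _ l).
  + by move=> z _; rewrite /packM packE.
  + exact: rfun_coord.
  + by move=> a' b'; apply: matM_rpfun => b; apply: rfun_coord.
- by move=> x; rewrite op0 packM_matM.
- move=> c x /Zvar_minors hx; apply/Zvar_minors.
  by apply: (@minors_congX _ _ _ _ _ (op c (matM x))); [move=> *; apply/congX_sym/matM_packM | apply: opm].
- exact: zclosed_Zvar.
Qed.

Lemma rpfun_rowop (m0 n0 N : nat) (i i' : 'I_m0) (u : @pt F N -> F) (X : @pt F N -> 'M[{poly F}]_(m0, n0)) a b :
  rfun 1 u -> (forall a b, rpfun 1 (fun x => X x a b)) -> rpfun 1 (fun x => rowop i i' (u x) (X x) a b).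
Proof.
move=> hu hX l.
apply: (@rfun_ext _ _ _ (fun x => (X x a b + (if a == i then (u x)%:P * X x i' b else 0))`_l)).
  by move=> x _; rewrite mxE mul_polyC.
move: l; apply: rpfun_add => //; case: eqP => _; last exact: rpfun_const.
by apply: rpfun_mul => //; apply: rpfun_polyC.
Qed.

Lemma rowop0 m0 n0 (i i' : 'I_m0) (X : 'M[{poly F}]_(m0, n0)) : rowop i i' 0 X = X.
Proof. by apply/matrixP => a b; rewrite mxE scale0r; case: eqP => _; rewrite addr0. Qed.

(** Adding an adjacent row keeps a point in [C] and adds the two constant terms. If the first always
    vanishes, so does the second. Columns follow by transposition, and adjacent steps reach every
    entry. *)
Lemma irr_comp_head (C : @pt F (m * n * k.+1) -> Prop) (i i' : 'I_m) (j j' : 'I_n) : irr_comp Z C ->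
  (forall x, C x -> x (idx i j ord0) = 0) -> forall x, C x -> x (idx i' j' ord0) = 0.
Proof.
move=> hC h.
have row a a' b : (forall x, C x -> x (idx a b ord0) = 0) -> forall x, C x -> x (idx a' b ord0) = 0.
  apply: (ord_adjacent_ind (Q := fun a => forall x, C x -> x (idx a b ord0) = 0)) => {}a {}a' adj H x Cx.
  have HC := @irr_comp_op C (rowop a a') _ _ _ hC 1 x Cx.
  have H1 := H x Cx.
  have := H _ (HC _ _ _); rewrite /packM packE mxE eqxx scale1r coefD !(coef_matM _ _ _ ord0) H1 add0r.
  apply.
  - by move=> *; apply: rpfun_rowop.
  - by move=> X; apply: rowop0.
  - by move=> c X; apply: minors_rowop.
have col a b b' : (forall x, C x -> x (idx a b ord0) = 0) -> forall x, C x -> x (idx a b' ord0) = 0.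
  apply: (ord_adjacent_ind (Q := fun b => forall x, C x -> x (idx a b ord0) = 0)) => {}b {}b' adj H x Cx.
  have HC := @irr_comp_op C (fun c X => (rowop b b' c X^T)^T) _ _ _ hC 1 x Cx.
  have E : (rowop b b' 1 (matM x)^T)^T a b = matM x a b + matM x a b'.
    by rewrite [LHS]mxE [LHS]mxE eqxx scale1r; congr (_ + _); rewrite [LHS]mxE.
  have := H _ (HC _ _ _); rewrite /packM packE E coefD !(coef_matM _ _ _ ord0) (H x Cx) add0r.
  apply.
  - move=> a1 b1 N u X hu hX l.
    apply: (@rfun_ext _ _ _ (fun x => (rowop b b' (u x) (X x)^T b1 a1)`_l)).
      by move=> y _; rewrite [in RHS]mxE.
    move: l; apply: rpfun_rowop => // a2 b2 l.
    by apply: rfun_ext (hX b2 a2 l) => y _; rewrite [in RHS]mxE.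
  - by move=> X; rewrite rowop0 trmxK.
  - by move=> c X hX; apply: minors_tr; apply: minors_rowop => //; apply: minors_tr.
by move=> x; apply: col; apply: row h.
Qed.
End ElementaryOperations.

(** * The main component *)

Section MainComponent.
Context {F : closedFieldType} (m n r k : nat).
Local Notation Z := (@Zvar F m.+1 n.+1 r.+1 k.+1).
Local Notation ZZ0 := (@Z0 F m.+1 n.+1 r.+1 k.+1).
Local Notation ZZ1 := (@Z1 F m.+1 n.+1 r.+1 k.+1).
Local Notation Y := (@Zvar F m n r k.+1).
Local Notation ne := (m.+1 + n.+1 - 1)%N.
Local Notation Npt := (@pt F (m.+1 * n.+1 * k.+1)).
Local Notation ypt := (@pt F (m * n * k.+1)).
Local Notation aff := (@affsp F (ne * k.+1)).
Local Notation h0 := (idx (m := m.+1) (n := n.+1) (k := k.+1) ord0 ord0 ord0).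
Local Notation xh := (@xh F m n k).

(** For a component, the choice of the corner is immaterial by [irr_comp_head]; the corner is fixed
    because the Schur complement uses it. *)
Definition off_head (C : Npt -> Prop) := exists2 x, C x & x h0 != 0.

Lemma off_head_any C i j : irr_comp Z C -> (exists2 x, C x & x (idx i j ord0) != 0) -> off_head C.
Proof.
move=> hC [x Cx xn]; apply: NNPP => h; move/eqP: xn; apply.
apply: (irr_comp_head (i := ord0) (j := ord0) _ _ hC _ Cx) => y Cy.
by apply/eqP/negPn/negP => yn; apply: h; exists y.
Qed.

Lemma off_head_all C i j : irr_comp Z C -> off_head C -> exists2 x, C x & x (idx i j ord0) != 0.
Proof.
move=> hC [x Cx xn]; apply: NNPP => h; move/eqP: xn; apply.
apply: (irr_comp_head (i := i) (j := j) _ _ hC _ Cx) => y Cy.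
by apply/eqP/negPn/negP => yn; apply: h; exists y.
Qed.

Lemma Z0_comp x : ZZ0 x <-> exists C, irr_comp Z C /\ off_head C /\ C x.
Proof.
split.
  move=> [P [hP [[i [j nP]] Px]]]; exists (Zset P).
  have hC := minprime_irr_comp hP; split=> //; split=> //.
  have hPr := proj1 hP.
  apply: (off_head_any (i := i) (j := j) hC).
  have [z [Pz hz]] := prime_nullstellensatz hPr nP.
  by exists z => //; rewrite -x0var_meval.
move=> [C [hC [[y Cy yn] Cx]]]; exists (vanish C); split; first exact: irr_comp_minprime.
split; last by move=> p; apply.
by exists ord0, ord0 => h; move/eqP: yn; apply; rewrite -x0var_meval; apply: h.
Qed.

Lemma comp_sub_Z0 C : irr_comp Z C -> off_head C -> sincl C ZZ0.
Proof. by move=> h1 h2 x Cx; apply/Z0_comp; exists C. Qed.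

Lemma Z0_sub_Z : sincl ZZ0 Z.
Proof. by move=> x /Z0_comp [C [[_ [_ [CZ _]]] [_ Cx]]]; apply: CZ. Qed.

Lemma Z1_sub_Z : sincl ZZ1 Z.
Proof. by move=> x []. Qed.

Lemma Z0_cover : exists N (C : nat -> Npt -> Prop),
  (forall i, (i < N)%N -> zclosed (C i)) /\
  (forall i x, C i x -> irr_comp Z (C i) /\ off_head (C i)) /\
  forall x, ZZ0 x <-> exists2 i, (i < N)%N & C i x.
Proof.
have [N [D [hD eD]]] := irreducible_decomposition (@zclosed_Zvar F m.+1 n.+1 r.+1 k.+1).
(* The guard replaces every piece that is not a component off the corner hyperplane by the empty
   set, so the finite indexing is kept. *)
exists N, (fun i x => (irr_comp Z (D i) /\ off_head (D i)) /\ D i x).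
have eqD i : irr_comp Z (D i) /\ off_head (D i) ->
    seqv (D i) (fun x => (irr_comp Z (D i) /\ off_head (D i)) /\ D i x).
  by move=> g x; split=> [|[]].
split; [|split].
- move=> i hi; have [g|ng] := classic (irr_comp Z (D i) /\ off_head (D i)).
    by apply: zclosed_ext (eqD i g) _; case: (hD i hi).
  by apply: zclosed_ext (@zclosed_empty F _) => x; split=> // -[].
- move=> i x [g _]; split; first by apply: irr_comp_ext (eqD i g) (proj1 g).
  by have [y Dy yn] := proj2 g; exists y.
move=> x; split; last by move=> [i _ [[g1 g2] Dx]]; apply: comp_sub_Z0 Dx.
move=> /Z0_comp [C [hC [hh Cx]]]; have [clC [irC [CZ mx]]] := hC.
have [||i hi CD] := @irreducible_finite _ _ C N D irC.
- by move=> i hi; case: (hD i hi).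
- by move=> y /CZ /eD.
have [clD irD] := hD i hi.
have DC : sincl (D i) C by apply: mx => // y Dy; apply/eD; exists i.
have e : seqv C (D i) by move=> y; split; [apply: CD | apply: DC].
exists i => //; split; last exact: CD.
by split; [apply: irr_comp_ext hC | case: hh => y Cy yn; exists y => //; apply: CD].
Qed.

Lemma Z0_closed : zclosed ZZ0.
Proof.
have [N [C [clC [_ e]]]] := Z0_cover.
by apply: zclosed_ext (zclosed_finite clC) => x; split=> /e.
Qed.

Lemma irr_in_Z0 C : irreducible C -> sincl C ZZ0 ->
  exists D, irr_comp Z D /\ off_head D /\ sincl C D.
Proof.
move=> irC CZ0; have [N [D [clD [gD e]]]] := Z0_cover.
have [|i hi CD] := @irreducible_finite _ _ C N D irC clD; first by move=> x /CZ0 /e.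
have [[x Cx] _] := irC.
have [g1 g2] := gD i x (CD x Cx).
by exists (D i).
Qed.

Lemma irr_comp_Z0 C : irr_comp ZZ0 C <-> irr_comp Z C /\ off_head C.
Proof.
split=> [[clC [irC [CZ0 mx]]]|[hC hh]].
  have [D [hD [hh CD]]] := irr_in_Z0 irC CZ0.
  have [clD [irD _]] := hD.
  have DC : sincl D C by apply: mx => //; apply: comp_sub_Z0.
  have e : seqv D C by move=> y; split; [apply: DC | apply: CD].
  by split; [apply: irr_comp_ext hD | case: hh => y Dy yn; exists y => //; apply: DC].
have [clC [irC [CZ mx]]] := hC; split=> //; split=> //; split; first exact: comp_sub_Z0.
by move=> D clD irD CD DZ; apply: mx => // x /DZ; apply: Z0_sub_Z.
Qed.

Theorem Zvar_Z0_Z1 : seqv Z (fun x => ZZ0 x \/ ZZ1 x).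
Proof.
move=> x; split=> [Zx|[]]; [|exact: Z0_sub_Z|exact: Z1_sub_Z].
have [C hC Cx] := irr_comp_point (@zclosed_Zvar F m.+1 n.+1 r.+1 k.+1) Zx.
have [hh|nh] := classic (off_head C); first by left; apply/Z0_comp; exists C.
right; split=> // i j; rewrite x0var_meval; apply/eqP/negPn/negP => xn.
by apply: nh; apply: (off_head_any hC); exists x; first exact: Cx; exact: xn.
Qed.

Lemma Uij_sub_Z0 i j : sincl (Uij m.+1 n.+1 r.+1 k.+1 i j) ZZ0.
Proof.
move=> x [Zx xn]; have [//|[_ h]] := proj1 (Zvar_Z0_Z1 x) Zx.
by rewrite h eqxx in xn.
Qed.

Lemma zclosure_Uij i j : seqv (zclosure (Uij m.+1 n.+1 r.+1 k.+1 i j)) ZZ0.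
Proof.
move=> x; split.
  by apply: zclosure_min; [apply: Z0_closed | apply: Uij_sub_Z0].
move=> /Z0_comp [C [hC [hh]]]; have [clC [irC [CZ _]]] := hC.
have [y Cy yn] := off_head_all i j hC hh.
apply: (irreducible_open_dense (p := x0var i j) irC Cy).
- by rewrite x0var_meval.
- exact: zclosure_closed.
by move=> z Cz zn; apply: sub_zclosure; split=> //; apply: CZ.
Qed.

Lemma zclosure_Uall : seqv (zclosure (Uall m.+1 n.+1 r.+1 k.+1)) ZZ0.
Proof.
move=> x; split.
  apply: zclosure_min; first exact: Z0_closed.
  by move=> y [Zy yn]; apply: (@Uij_sub_Z0 ord0 ord0).
move=> /Z0_comp [C [hC [hh]]]; have [clC [irC [CZ _]]] := hC.
have [[_ _] [n1 hpr]] := irreducible_vanish_prime irC.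
pose p : {mpoly F[m.+1 * n.+1 * k.+1]} := \prod_i \prod_j x0var i j.
(* The vanishing ideal is prime and contains none of the factors, so one point of [C] has all
   constant terms nonzero. *)
have np : ~ vanish C p.
  have nM a b : ~ vanish C a -> ~ vanish C b -> ~ vanish C (a * b) by move=> ha hb /hpr [].
  apply: (big_ind (fun q => ~ vanish C q)) => // i _.
  apply: (big_ind (fun q => ~ vanish C q)) => // j _ h.
  have [y Cy yn] := off_head_all i j hC hh.
  by move/eqP: yn; apply; rewrite -x0var_meval; apply: h.
have [y Cy yn] : exists2 y, C y & p.@[y] != 0.
  apply: NNPP => h; apply: np => y Cy; apply/eqP/negPn/negP => yn; apply: h; by exists y.
apply: (irreducible_open_dense irC Cy yn); first exact: zclosure_closed.
move=> z Cz; rewrite /p rmorph_prod => /prodf_neq0 h; apply: sub_zclosure; split; first exact: CZ.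
by move=> i j; have := h i isT; rewrite rmorph_prod => /prodf_neq0 /(_ j isT).
Qed.

(** The matrix with all entries 1 has equal rows, so every minor of size at least two vanishes,
    while its corner is a unit. *)
Lemma Z0_nonempty : (0 < r)%N -> exists x, ZZ0 x.
Proof.
move=> r0; pose x : Npt := packM k.+1 (const_mx 1).
have x1 : x h0 = 1 by rewrite /x /packM packE mxE coefC.
exists x; apply: (@Uij_sub_Z0 ord0 ord0); split; last by rewrite x0var_meval x1 oner_eq0.
apply/Zvar_minors; apply: (@minors_congX _ _ _ _ _ (const_mx 1)).
  by move=> i j; apply/congX_sym/matM_packM.
move=> f g _ _; have ne : (ord0 : 'I_r.+1) != ord_max by rewrite -(inj_eq val_inj) /= eq_sym -lt0n.
rewrite (determinant_alternate ne); first exact: modX0.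
by move=> j; rewrite !mxE.
Qed.

Definition Psi_image (C : ypt -> Prop) : Npt -> Prop :=
  fun x => exists2 z, prodset C aff z & x = Psi z.

Definition comp_map (C : ypt -> Prop) : Npt -> Prop := zclosure (Psi_image C).

(** A frame with unit corner: composed with [Psi] it gives a section of [schur], so every point of
    the smaller variety has a preimage off the corner hyperplane. *)
Definition one_frame (y : ypt) : @pt F (m * n * k.+1 + ne * k.+1) := joinpt y (fun=> 1).

Lemma one_frame_uh y : one_frame y (uh m n k) = 1.
Proof. by rewrite /one_frame /uh /joinpt split_rshift. Qed.

Lemma Psi_one_frame_head y : Psi (one_frame y) h0 = 1.
Proof. by rewrite Psi_head one_frame_uh. Qed.

Lemma schur_Psi (z : @pt F (m * n * k.+1 + ne * k.+1)) : z (uh m n k) != 0 -> schur (Psi z) = fun i => z (lshift _ i).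
Proof.
move=> zn; transitivity (fun i => Phi (Psi z) (lshift (ne * k.+1) i)); first by rewrite joinptl.
by rewrite PsiK.
Qed.

Lemma schur_one_frame y : schur (Psi (one_frame y)) = y.
Proof. by rewrite schur_Psi ?one_frame_uh ?oner_eq0 // joinptl. Qed.

Lemma in_comp_map (C : ypt -> Prop) y : C y -> comp_map C (Psi (one_frame y)).
Proof.
move=> Cy; apply: sub_zclosure; exists (one_frame y) => //.
by split=> //; rewrite joinptl.
Qed.

Lemma comp_map_schur (C : ypt -> Prop) x : x h0 != 0 -> C (schur x) -> comp_map C x.
Proof.
move=> xn Cx; apply: sub_zclosure; exists (Phi x); last by rewrite PhiK.
by split=> //; rewrite joinptl.
Qed.

Lemma comp_map_irreducible C : irreducible C -> irreducible (comp_map C).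
Proof.
move=> irC; apply: irreducible_zclosure; apply: (polymap_irreducible (@Psi_polymap F m n k)).
by apply: irreducible_prodset => //; apply: irreducible_affsp.
Qed.

Lemma comp_map_Z C : sincl C Y -> sincl (comp_map C) Z.
Proof.
move=> CY; apply: zclosure_min; first exact: zclosed_Zvar.
by move=> x [z [Cz _] ->]; apply: Psi_Zvar; apply: CY.
Qed.

(** The candidate inverse of [comp_map], taken on the open part where the Schur complement is
    defined. *)
Definition schur_closure (D : Npt -> Prop) : ypt -> Prop :=
  zclosure (fun y => exists2 x, D x /\ xh.@[x] != 0 & y = schur x).

Lemma schur_closure_irreducible D : irreducible D -> off_head D -> irreducible (schur_closure D).
Proof.
move=> irD [x Dx xn]; apply: irreducible_zclosure.
apply: (irreducible_image (a := xh)); first by move=> y [].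
  by move=> i; apply: schur_rfun.
by apply: (irreducible_open irD Dx); rewrite xh_meval.
Qed.

Lemma schur_closure_Y D : sincl D Z -> sincl (schur_closure D) Y.
Proof.
move=> DZ; apply: zclosure_min; first exact: zclosed_Zvar.
by move=> y [x [Dx xn] ->]; apply: schur_Zvar; [rewrite -xh_meval | apply: DZ].
Qed.

Lemma sub_comp_map D C : irreducible D -> off_head D -> sincl (schur_closure D) C -> sincl D (comp_map C).
Proof.
move=> irD [x Dx xn] DC; apply: (irreducible_open_dense (p := xh) irD Dx).
- by rewrite xh_meval.
- exact: zclosure_closed.
move=> y Dy yn; apply: comp_map_schur; first by rewrite -xh_meval.
by apply: DC; apply: sub_zclosure; exists y.
Qed.

(** A larger irreducible [D] has a Schur closure containing [C], hence contained in [C] by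
    maximality; since [D] is the closure of its part off the corner hyperplane, it lies in
    [comp_map C]. *)
Lemma comp_map_comp C : irr_comp Y C -> irr_comp Z (comp_map C) /\ off_head (comp_map C).
Proof.
move=> [clC [irC [CY mx]]].
have hh : off_head (comp_map C).
  have [[y Cy] _] := irC; exists (Psi (one_frame y)); first exact: in_comp_map.
  by rewrite Psi_one_frame_head oner_eq0.
split=> //; split; first exact: zclosure_closed.
split; first exact: comp_map_irreducible.
split; first exact: comp_map_Z.
move=> D clD irD CD DZ.
have hD : off_head D by have [x Cx xn] := hh; exists x => //; apply: CD.
apply: sub_comp_map => //; apply: mx.
- exact: zclosure_closed.
- exact: schur_closure_irreducible.
- move=> y Cy; apply: sub_zclosure; exists (Psi (one_frame y)); last by rewrite schur_one_frame.
  by split; [apply: CD; apply: in_comp_map | rewrite xh_meval Psi_one_frame_head oner_eq0].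
exact: schur_closure_Y.
Qed.

(** The set where the corner vanishes or the Schur complement lies in [C2] is closed and contains
    [comp_map C2]; the points of [C1] with unit frame decide which alternative holds. *)
Lemma comp_map_inj C1 C2 : zclosed C2 -> sincl (comp_map C1) (comp_map C2) -> sincl C1 C2.
Proof.
move=> cl2 h y C1y.
have H : sincl (comp_map C2) (fun x => xh.@[x] = 0 \/ C2 (schur x)).
  apply: zclosure_min; first by apply: rfun_preim_closed cl2 => i; apply: schur_rfun.
  move=> _ [z [C2z _] ->]; rewrite xh_meval Psi_head.
  by have [->|zn] := eqVneq (z (uh m n k)) 0; [left | right; rewrite schur_Psi].
have [] := H _ (h _ (in_comp_map C1y)); last by rewrite schur_one_frame.
by rewrite xh_meval Psi_one_frame_head => /eqP; rewrite oner_eq0.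
Qed.

Lemma comp_map_surj D : irr_comp Z D -> off_head D -> exists2 C, irr_comp Y C & seqv (comp_map C) D.
Proof.
move=> [clD [irD [DZ mx]]] hD.
have [||||C hC EC] := @irr_comp_exists _ _ Y (schur_closure D).
- exact: zclosed_Zvar.
- exact: zclosure_closed.
- exact: schur_closure_irreducible.
- exact: schur_closure_Y.
have [clC [irC [CY _]]] := hC.
have DC := sub_comp_map irD hD EC.
exists C => // x; split; last exact: DC.
apply: mx => //; [exact: zclosure_closed | exact: comp_map_irreducible | exact: comp_map_Z].
Qed.

Lemma comp_map_dim C : zclosed C -> irreducible C ->
  exists d, dimP C d /\ dimP (comp_map C) (d + ne * k.+1).
Proof.
move=> clC irC.
have [S _ bS] := basisA_extend (indepA_set0 (proj1 irC)).
have bS' := @basisA_product F _ (ne * k.+1) C S (proj1 irC) bS.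
have irP : irreducible (prodset C aff) by apply: irreducible_prodset => //; apply: irreducible_affsp.
have irI : irreducible (Psi_image C) by apply: polymap_irreducible irP; apply: Psi_polymap.
have [T _ bT] := basisA_extend (indepA_set0 (proj1 irI)).
exists #|S|; split; first exact: basisA_dim.
have [f hf] := polymap_poly (@Psi_polymap F m n k).
have [g [e hg]] := rfun_family (@Phi_rfun F m n k).
have E : #|[set lshift (ne * k.+1) i | i in S] :|: [set rshift (m * n * k.+1) j | j in [set: 'I_(ne * k.+1)]]| = #|T|.
  (* The extra factor [xh] on both sides makes the identity for the inverse hold on the whole
     product, also where the corner vanishes and the inverse formula says nothing. *)
  apply: (basisA_birational (f := f) (g := fun j => xh * g j) (h := fun=> xh * xh ^+ e) irP _ _ bS').
  - move=> _; have [[y Cy] _] := irC; exists (one_frame y); first by split=> //; rewrite joinptl.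
    by rewrite -hf mevalM rmorphXn /= xh_meval Psi_one_frame_head expr1n mulr1 oner_eq0.
  - move=> j z _; rewrite -hf !mevalM.
    have [->|xn] := eqVneq xh.@[Psi z] 0; first by rewrite !mul0r.
    have zn : z (uh m n k) != 0 by rewrite -Psi_head -xh_meval.
    have := hg (Psi z) xn j; rewrite PsiK // => ->.
    by rewrite -mulrA; congr (_ * _); rewrite mulrC divfK // rmorphXn expf_neq0.
  split.
    apply: indepA_sub (proj1 bT) => x [z Cz ->]; exists z => //; exact: hf.
  move=> j jT h; apply: (proj2 bT j jT); apply: indepA_sub h => x [z Cz ->].
  by exists z => //; rewrite hf.
rewrite -card_product_basis E; apply: basisA_dim.
- exact: zclosure_closed.
- exact: comp_map_irreducible.
by split; [apply/indepA_zclosure; case: bT | move=> j jT /indepA_zclosure; apply: (proj2 bT)].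
Qed.

Theorem Z0_birational : birational ZZ0 (prodset Y aff).
Proof.
exists (Uij m.+1 n.+1 r.+1 k.+1 ord0 ord0), (fun z => prodset Y aff z /\ z (uh m n k) != 0).
split; [|split].
- split; last exact: zclosure_Uij.
  exists (fun x => (x0var ord0 ord0).@[x] = 0); split; first exact: zclosed_zero.
  move=> x; split=> [hx|[Zx /eqP xn]]; last by split=> //; apply: Z0_sub_Z.
  by split; [apply: Uij_sub_Z0 hx | case: hx => _ /eqP].
- split.
    exists (fun z => ('X_(uh m n k) : {mpoly F[_]}).@[z] = 0); split; first exact: zclosed_zero.
    by move=> z; split=> -[h1 h2]; split=> //; move/eqP: h2; rewrite mevalXU.
  move=> z; split.
    apply: zclosure_min; last by move=> y [].
    by apply: zclosed_prodset; [apply: zclosed_Zvar | apply: zclosed_affsp].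
  move=> [Yz _].
  (* Density is checked fibrewise: over each point of the smaller variety the fibre is an affine
     space, and [one_frame] shows that it meets the open set. *)
  have irP : irreducible (prodset (fun y => y = (fun i => z (lshift _ i))) aff).
    by apply: irreducible_prodset; [apply: irreducible_point | apply: irreducible_affsp].
  apply: (irreducible_open_dense (p := 'X_(uh m n k)) irP (x := one_frame (fun i => z (lshift _ i)))).
  + by split=> //; rewrite joinptl.
  + by rewrite mevalXU one_frame_uh oner_eq0.
  + exact: zclosure_closed.
  + move=> w [ew _] wn; apply: sub_zclosure; split; last by rewrite mevalXU in wn.
    by split=> //; rewrite ew.
  by [].
exists (@Phi F m n k), (@Psi F m n k); split; [|split; [|split; [|split; [|split]]]].
- apply: (rfun_regular_on (a := xh)); first by move=> x [].
  exact: Phi_rfun.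
- exact/polymap_regular_on/Psi_polymap.
- move=> x [Zx]; rewrite x0var_meval => xn; split.
    by split=> //; rewrite joinptl; apply: schur_Zvar.
  by rewrite /Phi /uh /joinpt split_rshift frame_rowE coef_matM.
- move=> z [[Yz _] zn]; split; first exact: Psi_Zvar.
  by rewrite x0var_meval Psi_head.
- by move=> x [_]; rewrite x0var_meval => xn; apply: PhiK.
- by move=> z [_ zn]; apply: PsiK.
Qed.

(** A component on which one constant term vanishes lies in [Z1]. Were it also in [Z0], it would lie
    in, hence equal, a component off the corner hyperplane. *)
Theorem Z1_sub_Z0 : sincl ZZ1 ZZ0 <->
  ~ exists P, minprime_over (Iideal m.+1 n.+1 r.+1 k.+1) P /\
      exists (i : 'I_m.+1) (j : 'I_n.+1), P (x0var (F := F) (k := k.+1) i j).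
Proof.
split.
  move=> h [P [hP [i [j Pij]]]].
  have hC := minprime_irr_comp hP; have [clC [irC [CZ mx]]] := hC.
  have z0 x : Zset P x -> ZZ1 x.
    move=> Px; split; first exact: CZ.
    move=> i' j'; rewrite x0var_meval; apply: (irr_comp_head (i := i) (j := j) _ _ hC _ Px) => y Py.
    by rewrite -x0var_meval; apply: Py.
  have [D [hD [[x Dx xn] CD]]] := irr_in_Z0 irC (fun x Px => h x (z0 x Px)).
  have [clD [irD [DZ _]]] := hD.
  have DC := mx D clD irD CD DZ.
  have [_ H] := z0 x (DC x Dx).
  by move/eqP: xn; apply; rewrite -x0var_meval; apply: H.
move=> h x [Zx _]; have [C hC Cx] := irr_comp_point (@zclosed_Zvar F m.+1 n.+1 r.+1 k.+1) Zx.
apply/Z0_comp; exists C; split=> //; split=> //; apply: NNPP => nh; apply: h.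
exists (vanish C); split; first exact: irr_comp_minprime.
exists ord0, ord0 => y Cy; rewrite x0var_meval; apply/eqP/negPn/negP => yn.
by apply: nh; exists y.
Qed.

Theorem minprime_in_Z1 P : minprime_over (Iideal m.+1 n.+1 r.+1 k.+1) P ->
  (exists (i : 'I_m.+1) (j : 'I_n.+1), P (x0var (F := F) (k := k.+1) i j)) ->
  (forall (i : 'I_m.+1) (j : 'I_n.+1), P (x0var (F := F) (k := k.+1) i j)) /\
  irr_comp ZZ1 (Zset P) /\ irr_comp Z (Zset P).
Proof.
move=> hP [i [j Pij]].
have hC := minprime_irr_comp hP; have [clC [irC [CZ mx]]] := hC.
have all0 i' j' x : Zset P x -> (x0var i' j').@[x] = 0.
  move=> Px; rewrite x0var_meval; apply: (irr_comp_head (i := i) (j := j) _ _ hC _ Px) => y Py.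
  by rewrite -x0var_meval; apply: Py.
split; first by move=> i' j'; apply/(vanish_Zset _ (proj1 hP)) => x; apply: all0.
split=> //; split=> //; split=> //; split.
  by move=> x Px; split; [apply: CZ | move=> i' j'; apply: all0].
by move=> D clD irD CD DZ1; apply: mx => // x /DZ1; apply: Z1_sub_Z.
Qed.
End MainComponent.

(** * Matrices divisible by t *)

Section VanishingConstantTerm.
Context {F : closedFieldType} (m n r k : nat).
Local Notation Npt := (@pt F (m * n * k)).

Lemma modX_mulXn (p : {poly F}) s l : modX l ('X^s * p) <-> modX (l - s) p.
Proof.
split=> h a al.
  have asl : (a + s < l)%N by lia.
  by have := h _ asl; rewrite coefXnM ltnNge leq_addl addnK.
by rewrite coefXnM; case: ltnP => // sa; apply: h; lia.
Qed.

Definition shiftM (x : Npt) : 'M[{poly F}]_(m, n) := \matrix_(i, j) (\poly_(l < k) (matM x i j)`_l.+1).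

Lemma coef_matM_large (x : Npt) i j l : (k <= l)%N -> (matM x i j)`_l = 0.
Proof.
move=> kl; rewrite mxE /tpoly coef_sum big1 // => a _.
by rewrite coefCM coefXn gtn_eqF ?mulr0 // (leq_trans (ltn_ord a)).
Qed.

Lemma coef_shiftM (x : Npt) i j l : (shiftM x i j)`_l = (matM x i j)`_l.+1.
Proof.
rewrite mxE coef_poly; case: ltnP => // kl; rewrite coef_matM_large //.
by apply: leqW.
Qed.

Lemma matM_shiftM (x : Npt) : (forall i j, (matM x i j)`_0 = 0) -> matM x = 'X *: shiftM x.
Proof.
move=> h; apply/matrixP => i j; rewrite [RHS]mxE; apply/polyP => -[|l]; rewrite coefXM /=.
  exact: h.
by rewrite coef_shiftM.
Qed.

(** Each of the [r] rows contributes one factor t. The subtraction is truncated, so for [k <= r] the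
    condition on the quotient matrix is empty. *)
Lemma minors_shiftM (x : Npt) : (forall i j, (matM x i j)`_0 = 0) ->
  minors r k (matM x) <-> minors r (k - r) (shiftM x).
Proof.
move=> /matM_shiftM e.
have E (f : 'I_r -> 'I_m) (g : 'I_r -> 'I_n) : \det (\matrix_(a, b) matM x (f a) (g b)) =
    'X^r * \det (\matrix_(a, b) shiftM x (f a) (g b)).
  rewrite -detZ e; congr (\det _); apply/matrixP => a b.
  by rewrite [LHS]mxE [LHS]mxE [RHS]mxE [in RHS]mxE.
by split=> h f g hf hg; [apply/modX_mulXn; rewrite -E; apply: h | rewrite E; apply/modX_mulXn; apply: h].
Qed.

Lemma x0var_coef (x : Npt) i j : (x0var i j).@[x] = (matM x i j)`_0.
Proof.
rewrite /x0var rmorph_sum mxE /tpoly coef_sum [RHS](bigID (fun l : 'I_k => nat_of_ord l == 0%N)) /=.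
rewrite [X in _ + X]big1 ?addr0 => [|l /negPf l0].
  by apply: eq_bigr => l /eqP l0; rewrite mevalXU coefCM coefXn l0 eqxx mulr1.
by rewrite coefCM coefXn eq_sym l0 mulr0.
Qed.

Lemma packM_polymap N q (B : @pt F N -> 'M[{poly F}]_(m, n)) :
  (forall i j, rpfun 1 (fun x => B x i j)) -> polymap (fun x => packM q (B x)).
Proof.
move=> h a; have [i [j [l ->]]] := idx_surj a.
by apply: rfun_ext (h i j l) => x _; rewrite /packM packE.
Qed.

Lemma rpfun_coefs N q (u : @pt F N -> {poly F}) (s : nat -> nat) : rpfun 1 u ->
  rpfun 1 (fun x => \poly_(l < q) (u x)`_(s l)).
Proof.
move=> hu l; case: (ltnP l q) => lq.
  by apply: rfun_ext (hu (s l)) => x _; rewrite coef_poly lq.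
by apply: rfun_ext (rfun_const 1 0) => x _; rewrite coef_poly ltnNge lq.
Qed.

(** The first [q] coefficients of each entry after division by t. [highpart] holds the next [q']
    ones, and [gluept] reassembles them as t Y + t^(q+1) V. *)
Definition lowpart q (x : Npt) : @pt F (m * n * q) := packM q (\matrix_(i, j) \poly_(l < q) (matM x i j)`_l.+1).
Arguments lowpart _ _ _ : clear implicits.
Definition highpart q q' (x : Npt) : @pt F (m * n * q') :=
  packM q' (\matrix_(i, j) \poly_(l < q') (matM x i j)`_(l + q.+1)).
Definition gluept q q' (y : @pt F (m * n * q)) (v : @pt F (m * n * q')) : Npt :=
  packM k (\matrix_(i, j) ('X * matM y i j + 'X^(q.+1) * matM v i j)).

Arguments highpart _ _ _ _ : clear implicits.
Arguments gluept {q q'} y v _.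

Lemma lowpart_polymap q : polymap (@lowpart q).
Proof.
apply: packM_polymap => i j l.
have H : rpfun 1 (fun x : Npt => \poly_(l < q) (matM x i j)`_l.+1).
  by apply: rpfun_coefs; apply: (@matM_rpfun _ _ _ _ _ _ id) => b; apply: rfun_coord.
by apply: rfun_ext (H l) => x _; rewrite [in RHS]mxE.
Qed.

Lemma highpart_polymap q q' : polymap (@highpart q q').
Proof.
apply: packM_polymap => i j l.
have H : rpfun 1 (fun x : Npt => \poly_(l < q') (matM x i j)`_(l + q.+1)).
  by apply: rpfun_coefs; apply: (@matM_rpfun _ _ _ _ _ _ id) => b; apply: rfun_coord.
by apply: rfun_ext (H l) => x _; rewrite [in RHS]mxE.
Qed.

Lemma gluept_polymap N q q' (y : @pt F N -> @pt F (m * n * q)) (v : @pt F N -> @pt F (m * n * q')) :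
  polymap y -> polymap v -> polymap (fun x => gluept (y x) (v x)).
Proof.
move=> hy hv; apply: packM_polymap => i j l.
have H : rpfun 1 (fun x => 'X * matM (y x) i j + 'X^(q.+1) * matM (v x) i j).
  by apply: rpfun_add; apply: rpfun_mul; try exact: rpfun_const; apply: matM_rpfun.
by apply: rfun_ext (H l) => x _; rewrite [in RHS]mxE.
Qed.

Lemma coef_packM q (B : 'M[{poly F}]_(m, n)) i j l : (l < q)%N -> (matM (packM q B) i j)`_l = (B i j)`_l.
Proof. by move=> lq; apply: congX_coef lq; apply: matM_packM. Qed.

Lemma coef_lowpart q (x : Npt) i j l : (l < q)%N -> (matM (lowpart q x) i j)`_l = (matM x i j)`_l.+1.
Proof. by move=> lq; rewrite /lowpart coef_packM // [X in polyseq X]mxE coef_poly lq. Qed.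

Lemma coef_highpart q q' (x : Npt) i j l : (l < q')%N ->
  (matM (highpart q q' x) i j)`_l = (matM x i j)`_(l + q.+1).
Proof. by move=> lq; rewrite /highpart coef_packM // [X in polyseq X]mxE coef_poly lq. Qed.

Lemma coef_gluept q q' (y : @pt F (m * n * q)) (v : @pt F (m * n * q')) i j l : (l < k)%N ->
  (matM (gluept y v) i j)`_l = (if l is l'.+1 then (matM y i j)`_l' else 0) +
    (if (q < l)%N then (matM v i j)`_(l - q.+1) else 0).
Proof.
move=> lk; rewrite /gluept coef_packM // [X in polyseq X]mxE coefD coefXM coefXnM ltnS leqNgt.
by case: (q < l)%N; case: l {lk}.
Qed.
End VanishingConstantTerm.
Arguments lowpart {F m n k} q x _.
Arguments highpart {F m n k} q q' x _.
Arguments gluept {F m n} k {q q'} y v _.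

Lemma matM_inj (F : closedFieldType) m n k (x y : @pt F (m * n * k)) :
  (forall i j l, (l < k)%N -> (matM x i j)`_l = (matM y i j)`_l) -> x = y.
Proof.
move=> h; rewrite -(packM_matM x) -(packM_matM y); apply: pt_eq => i j l.
by rewrite /packM !packE; apply: h.
Qed.

Section Z1Iso.
Context {F : closedFieldType} (m n r k : nat).

Lemma glueptK q q' (y : @pt F (m * n * q)) (v : @pt F (m * n * q')) : k = (q + q').+1 ->
  lowpart q (gluept k y v) = y /\ highpart q q' (gluept k y v) = v.
Proof.
move=> ek; split; apply: matM_inj => i j l lq.
  rewrite coef_lowpart // coef_gluept; last by lia.
  by rewrite ltnS leqNgt lq addr0.
rewrite coef_highpart // coef_gluept; last by lia.
rewrite addnS ltnS leq_addl subSS addnK coef_matM_large ?add0r //.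
by rewrite leq_addl.
Qed.

Lemma gluept_parts q q' (x : @pt F (m * n * k)) : k = (q + q').+1 -> (forall i j, (matM x i j)`_0 = 0) ->
  gluept k (lowpart q x) (highpart q q' x) = x.
Proof.
move=> ek x0; apply: matM_inj => i j l lk; rewrite coef_gluept //.
case: l lk => [|l] lk; first by rewrite x0 addr0.
rewrite ltnS; case: leqP => ql; last by rewrite addr0 coef_lowpart.
rewrite coef_matM_large // add0r coef_highpart; last by lia.
by congr (_`_ _); lia.
Qed.

Lemma Z1_lowpart q (x : @pt F (m * n * k)) : (k - r <= q)%N -> (q < k)%N ->
  (forall i j, (matM x i j)`_0 = 0) -> Zvar m n r k x <-> minors r (k - r) (matM (lowpart q x)).
Proof.
move=> kr qk x0; rewrite Zvar_minors minors_shiftM //.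
have e i j : congX (k - r) (shiftM x i j) (matM (lowpart q x) i j).
  move=> l lk; rewrite coefB coef_shiftM coef_lowpart ?subrr //; exact: leq_trans kr.
by split; apply: minors_congX => i j; [exact: e | apply/congX_sym].
Qed.

Lemma gluept0 q q' (y : @pt F (m * n * q)) (v : @pt F (m * n * q')) i j : (0 < k)%N ->
  (matM (gluept k y v) i j)`_0 = 0.
Proof. by move=> k0; rewrite coef_gluept // addr0. Qed.

Theorem Z1_iso_product : (0 < r)%N -> (r < k)%N ->
  var_iso (@Z1 F m n r k) (prodset (@Zvar F m n r (k - r)) (@affsp F (m * n * (r - 1)))).
Proof.
(* One coefficient of each entry is zero, [k - r] are constrained by the minors and [r - 1] are
   free. *)
move=> r0 rk; have ek : k = ((k - r) + (r - 1)).+1 by lia.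
have k0 : (0 < k)%N by lia.
have low (x : @pt F (m * n * k)) : (forall i j, (matM x i j)`_0 = 0) ->
    Zvar m n r k x <-> Zvar m n r (k - r) (lowpart (k - r) x).
  move=> x0; have kk : (k - r < k)%N by lia.
  have h := Z1_lowpart (leqnn _) kk x0.
  by split=> [/h|] hx; [apply/Zvar_minors | apply/h/Zvar_minors].
exists (fun x => joinpt (lowpart (k - r) x) (highpart (k - r) (r - 1) x)),
  (fun z => gluept k (fun i => z (lshift _ i)) (fun i => z (rshift _ i))).
split; [|split; [|split; [|split; [|split]]]].
- apply: polymap_regular_on => a; rewrite /joinpt; case: (split a) => b.
    exact: lowpart_polymap.
  exact: highpart_polymap.
- by apply: polymap_regular_on; apply: gluept_polymap => b; apply: rfun_coord.
- move=> x [Zx x0]; split=> //; rewrite joinptl; apply/low => // i j.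
  by rewrite -x0var_coef.
- move=> z [Zz _]; have z0 i j := gluept0 (fun i => z (lshift _ i)) (fun i => z (rshift _ i)) i j k0.
  split; last by move=> i j; rewrite x0var_coef.
  by apply/low => //; rewrite (proj1 (glueptK _ _ ek)).
- move=> x [_ x0]; rewrite joinptl joinptr; apply: gluept_parts => // i j.
  by rewrite -x0var_coef.
- by move=> z _; have [-> ->] := glueptK (fun i => z (lshift _ i)) (fun i => z (rshift _ i)) ek; rewrite joinptK.
Qed.

Theorem Z1_iso_affine : (0 < k)%N -> (k <= r)%N ->
  var_iso (@Z1 F m n r k) (@affsp F (m * n * (k - 1))).
Proof.
move=> k0 kr; have ek : k = ((k - 1) + 0).+1 by lia.
have kr0 : (k - r = 0)%N by lia.
(* The point of a zero-dimensional affine space, serving as an empty high part. *)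
pose o : @pt F (m * n * 0) := fun=> 0.
exists (lowpart (k - 1)), (fun z => gluept k z o).
split; [|split; [|split; [|split; [|split]]]] => //.
- exact/polymap_regular_on/lowpart_polymap.
- by apply: polymap_regular_on; apply: gluept_polymap => b; [apply: rfun_coord | apply: rfun_const].
- move=> z _; have z0 i j := gluept0 z o i j k0.
  split; last by move=> i j; rewrite x0var_coef.
  by apply/(@Z1_lowpart (k - 1)) => //; rewrite ?kr0 //; lia.
- move=> x [_ x0]; have -> : o = highpart (k - 1) 0 x by apply: matM_inj.
  by apply: gluept_parts => // i j; rewrite -x0var_coef.
- by move=> z _; have [-> _] := glueptK z o ek.
Qed.
End Z1Iso.

Theorem theorem2p8 (F : closedFieldType) (m n r k : nat)
    (hr : (2 <= r)%N) (hrm : (r <= m)%N) (hmn : (m <= n)%N) (hk : (1 <= k)%N) :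
  (* (1) *)
  seqv (Zvar (F:=F) m n r k) (fun x => Z0 (F:=F) m n r k x \/ Z1 (F:=F) m n r k x) /\
  (* (2) *)
  ((exists x, Z0 (F:=F) m n r k x) /\
   (forall (i : 'I_m) (j : 'I_n), seqv (zclosure (Uij (F:=F) m n r k i j)) (Z0 (F:=F) m n r k)) /\
   seqv (zclosure (Uall (F:=F) m n r k)) (Z0 (F:=F) m n r k)) /\
  (* (3) *)
  ((forall C, irr_comp (Z0 (F:=F) m n r k) C -> irr_comp (Zvar (F:=F) m n r k) C) /\
   exists phi : (pt (F:=F) (m.-1 * n.-1 * k) -> Prop) -> (pt (F:=F) (m * n * k) -> Prop),
     (forall C, irr_comp (Zvar (F:=F) m.-1 n.-1 r.-1 k) C -> irr_comp (Z0 (F:=F) m n r k) (phi C)) /\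
     (forall C1 C2, irr_comp (Zvar (F:=F) m.-1 n.-1 r.-1 k) C1 ->
        irr_comp (Zvar (F:=F) m.-1 n.-1 r.-1 k) C2 -> seqv (phi C1) (phi C2) -> seqv C1 C2) /\
     (forall D, irr_comp (Z0 (F:=F) m n r k) D ->
        exists C, irr_comp (Zvar (F:=F) m.-1 n.-1 r.-1 k) C /\ seqv (phi C) D) /\
     (forall C, irr_comp (Zvar (F:=F) m.-1 n.-1 r.-1 k) C ->
        exists d1 d2, dimP C d1 /\ dimP (phi C) d2 /\
          (m.-1 * n.-1 * k - d1 = m * n * k - d2)%N)) /\
  (* (4) *)
  birational (Z0 (F:=F) m n r k)
    (prodset (Zvar (F:=F) m.-1 n.-1 r.-1 k) (affsp (F:=F) ((m + n - 1) * k))) /\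
  (* (5) *)
  (((r < k)%N -> var_iso (Z1 (F:=F) m n r k)
       (prodset (Zvar (F:=F) m n r (k - r)) (affsp (F:=F) (m * n * (r - 1))))) /\
   ((k <= r)%N -> var_iso (Z1 (F:=F) m n r k) (affsp (F:=F) (m * n * (k - 1))))) /\
  (* (6) *)
  ((sincl (Z1 (F:=F) m n r k) (Z0 (F:=F) m n r k) <->
      ~ exists P, minprime_over (Iideal (F:=F) m n r k) P /\
          exists (i : 'I_m) (j : 'I_n), P (x0var (F:=F) (k:=k) i j)) /\
   (forall P, minprime_over (Iideal (F:=F) m n r k) P ->
      (exists (i : 'I_m) (j : 'I_n), P (x0var (F:=F) (k:=k) i j)) ->
      (forall (i : 'I_m) (j : 'I_n), P (x0var (F:=F) (k:=k) i j)) /\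
      irr_comp (Z1 (F:=F) m n r k) (Zset P) /\ irr_comp (Zvar (F:=F) m n r k) (Zset P))).
Proof.
(* All four indices are positive; writing them as successors turns the predecessors in the statement
   into the indices of the smaller variety. *)
case: r hr hrm => // r0; case: m hmn => // m0; case: n => // n0; case: k hk => // k0.
move=> _ hmn hr hrm.
split; first exact: Zvar_Z0_Z1.
split.
  split; first by apply: Z0_nonempty.
  by split; [apply: zclosure_Uij | apply: zclosure_Uall].
split.
  split; first by move=> C /irr_comp_Z0 [].
  exists (@comp_map F m0 n0 k0).
  split; first by move=> C hC; apply/irr_comp_Z0/comp_map_comp.
  split.
    move=> C1 C2 h1 h2 e y.
    by split; apply: comp_map_inj => //; [case: h2 | move=> x /e | case: h1 | move=> x /e].
  split.
    move=> D /irr_comp_Z0 [hD hh].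
    by have [C hC e] := comp_map_surj hD hh; exists C.
  move=> C [clC [irC _]].
  have [d [h1 h2]] := comp_map_dim clC irC.
  exists d, (d + (m0.+1 + n0.+1 - 1) * k0.+1)%N; split=> //; split=> //=.
  (* The ambient dimensions differ by the number of frame coordinates, which is also the difference
     of the two dimensions of components. *)
  have -> : (m0.+1 * n0.+1 * k0.+1 = m0 * n0 * k0.+1 + (m0.+1 + n0.+1 - 1) * k0.+1)%N.
    by rewrite -mulnDl; congr (_ * _)%N; nia.
  by rewrite subnDr.
split; first exact: Z0_birational.
split; first by split=> h; [apply: Z1_iso_product | apply: Z1_iso_affine].
split; first exact: Z1_sub_Z0.
exact: minprime_in_Z1.
Qed.
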